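(* Let $X$ be a complex Banach space and $I=[0,1]$. Suppose that for every $t\in I$ the operator $A(t):D(A(t))\subset X\to X$ is the generator of a strongly continuous group on $X$ such that the families $A^+:=A(\,\cdot\,)$ and $A^-:=-A(1-\,\cdot\,)$ are $(M,\omega)$-stable for some $M\in[1,\infty)$ and $\omega\in\mathbb{R}$. Suppose further that $Y$ is, for every $t\in I$, an $A^{\pm}(t)$-admissible subspace of $X$ contained in $\bigcap_{\tau\in I}D(A(\tau))$, and that $A(t)|_Y$ is a bounded operator from $Y$ to $X$ for every $t\in I$ such that $t\mapsto A(t)|_Y$ is strongly continuous. Finally, suppose that for each $t\in I$ and each sign $\pm$ there exists a norm $\|\cdot\|_t^{\pm}$ on $Y$ equivalent to the original norm of $Y$ such that $Y_t^{\pm}:=(Y,\|\cdot\|_t^{\pm})$ is uniformly convex and $$\|y\|_t^{\pm}\le e^{c^{\pm}|t-s|}\,\|y\|_s^{\pm}\qquad(y\in Y,\ s,t\in I)$$ for some constant $c^{\pm}\in(0,\infty)$, and such that the part $\tilde A^{\pm}(t)$ of $A^{\pm}(t)$ in $Y$ generates a quasicontraction semigroup in $Y_t^{\pm}$, more precisely $$\|e^{\tilde A^{\pm}(t)\tau}y\|_t^{\pm}\le e^{\omega_0\tau}\,\|y\|_t^{\pm}\qquad(\tau\in[0,\infty),\ y\in Y,\ t\in I)$$ for some $t$-independent growth exponent $\omega_0\in\mathbb{R}$. Then there exists a unique evolution system $U$ for $A$ on $Y$.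
   Context: Write $\Delta=\{(s,t)\in I^2:s\le t\}$. Statements with $\pm$ are to hold for both signs. $(M,\omega)$-stability: a family $A$ of semigroup generators $A(t)$, $t\in I$, on $X$ is $(M,\omega)$-stable if $\|e^{A(t_n)s_n}\cdots e^{A(t_1)s_1}\|\le Me^{\omega(s_1+\dots+s_n)}$ for all $n\in\mathbb{N}$, all $t_1,\dots,t_n\in I$ with $t_n\ge\dots\ge t_1$, and all $s_1,\dots,s_n\in[0,\infty)$. Part: the part of an operator $B$ in a subspace $Y$ (the $Y$-part of $B$) is the operator $\tilde B$ with $D(\tilde B)=\{y\in D(B)\cap Y:By\in Y\}$ and $\tilde By=By$. Admissibility: for a semigroup generator $B$ on $X$, a subspace $Y$ of $X$ endowed with a norm $\|\cdot\|_*$ is $B$-admissible if $(Y,\|\cdot\|_* )$ is a Banach space densely and continuously embedded in $X$, $e^{Bs}Y\subset Y$ for all $s\ge0$, and the restriction $e^{B\,\cdot}|_Y$ is a strongly continuous semigroup in $(Y,\|\cdot\|_* )$ (this restricted semigroup is then generated by the part $\tilde B$ of $B$ in $Y$). Here one and the same normed space $Y$ is used for all $t$ and both signs; its norm is the ''original norm'' of $Y$. Evolution system: let $Y$ be a dense subspace of $X$ contained in $\bigcap_{\tau\in I}D(A(\tau))$. An evolution system for $A$ on $Y$ is a family of bounded operators $U(t,s)$ on $X$, $(s,t)\in\Delta$, such that (i) for every $y\in Y$ and $s\in[0,1)$ the map $[s,1]\ni t\mapsto U(t,s)y$ is a continuously differentiable (in the norm of $X$) solution, with values in $Y$, of the initial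 value problem $x'(t)=A(t)x(t)$ $(t\in[s,1])$, $x(s)=y$; (ii) $U(t,s)U(s,r)=U(t,r)$ for all $r\le s\le t$ in $I$, and $\Delta\ni(s,t)\mapsto U(t,s)$ is strongly continuous (on $X$). *)

(* Defs.v *)
From HB Require Import structures.
From mathcomp Require Import all_boot all_order all_algebra.
From mathcomp Require Import all_classical all_reals all_analysis.
From mathcomp Require Import complex.
Set Implicit Arguments.
Unset Strict Implicit.
Unset Printing Implicit Defensive.
Import Order.TTheory GRing.Theory Num.Theory.
Import numFieldNormedType.Exports.
Local Open Scope classical_set_scope.
Local Open Scope complex_scope.
Local Open Scope ring_scope.

Section Definitions.
Context {R : realType} {X : normedModType R[i]}.

(* Only the data; linearity and the norm axioms are [is_normed_subspace] below.
   The values of [nrm] outside [carrier] are irrelevant. *)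
Record normed_subspace := NormedSubspace {
  carrier :> set X ;
  nrm : X -> R
}.

Definition is_norm (V : set X) (N : X -> R) : Prop :=
  [/\ forall x, V x -> 0 <= N x,
      forall x, V x -> N x = 0 -> x = 0,
      forall (a : R[i]) x, V x -> (N (a *: x))%:C = `|a| * (N x)%:C
    & forall x y, V x -> V y -> N (x + y) <= N x + N y].

Definition is_normed_subspace (E : normed_subspace) : Prop :=
  submod_closed [in carrier E] /\ is_norm E (nrm E).

(* The library norm on X takes its values in R[i]; they are real. *)
Definition whole : normed_subspace :=
  NormedSubspace setT (fun x : X => complex.Re `|x|).

Definition is_banach (E : normed_subspace) : Prop :=
  is_normed_subspace E /\
  forall u : nat -> X, (forall n, carrier E (u n)) ->
    (forall e : R, 0 < e -> exists n0 : nat, forall m n : nat,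
      (n0 <= m)%N -> (n0 <= n)%N -> nrm E (u m - u n) < e) ->
    exists y, carrier E y /\ nrm E (u n - y) @[n --> \oo] --> (0 : R).

Definition uniformly_convex (E : normed_subspace) : Prop :=
  forall e : R, 0 < e -> exists d : R, 0 < d /\
    forall x y, carrier E x -> carrier E y -> nrm E x = 1 -> nrm E y = 1 ->
      e <= nrm E (x - y) -> nrm E ((2^-1 : R)%:C *: (x + y)) <= 1 - d.

Definition equivalent_norms (V : set X) (N N' : X -> R) : Prop :=
  exists c C : R, [/\ 0 < c, 0 < C &
    forall x, V x -> c * N x <= N' x /\ N' x <= C * N x].

Definition linear_on (V : set X) (f : X -> X) : Prop :=
  forall (a : R[i]) x y, V x -> V y -> f (a *: x + y) = a *: f x + f y.

Definition bounded_on (E F : normed_subspace) (f : X -> X) : Prop :=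
  [/\ forall x, carrier E x -> carrier F (f x), linear_on E f &
      exists C : R, forall x, carrier E x -> nrm F (f x) <= C * nrm E x].

(* A partial operator D(B) -> X; the values of [app] outside [dom] are
   irrelevant. *)
Record operator := Operator {
  dom : set X ;
  app :> X -> X
}.

Definition opp_operator (B : operator) : operator :=
  Operator (dom B) (fun x => - B x).

Definition part (B : operator) (Y : set X) : operator :=
  Operator [set y | [/\ dom B y, Y y & Y (B y)]] B.

(* The time set J is `[0, +oo[ for semigroups and setT for groups; the values
   of T at times outside J, or at points outside E, are irrelevant. *)
Definition strongly_continuous_rep (J : set R) (E : normed_subspace)
    (T : R -> X -> X) : Prop :=
  [/\ forall s, J s -> bounded_on E E (T s),
      forall x, carrier E x -> T 0 x = x,
      forall s r x, J s -> J r -> carrier E x -> T (s + r) x = T s (T r x) &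
      forall s x, J s -> carrier E x ->
        nrm E (T r x - T s x) @[r --> within J (nbhs s)] --> (0 : R)].

(* B is the derivative at 0 of T, in the norm of E, with its maximal domain. *)
Definition generates (J : set R) (E : normed_subspace) (B : operator)
    (T : R -> X -> X) : Prop :=
  strongly_continuous_rep J E T /\
  forall x z, (dom B x /\ B x = z) <->
    [/\ carrier E x, carrier E z &
        nrm E ((h^-1)%:C *: (T h x - x) - z) @[h --> within J (dnbhs 0)]
          --> (0 : R)].

Definition is_semigroup_generator (E : normed_subspace) (B : operator) : Prop :=
  exists T, generates `[0, +oo[ E B T.

Definition is_group_generator (E : normed_subspace) (B : operator) : Prop :=
  exists T, generates setT E B T.

(* s |-> e^{Bs}, s >= 0, for a semigroup generator B on E. A semigroup is
   determined on E by its generator, so the choice only concerns irrelevant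
   values. *)
Definition semigroup (E : normed_subspace) (B : operator) : R -> X -> X :=
  get [set T | generates `[0, +oo[ E B T].

(* The list [:: (t_1, s_1); ...; (t_n, s_n)] stands for the product
   e^{A(t_n)s_n} ... e^{A(t_1)s_1}. *)
Definition stable (M w : R) (A : R -> operator) : Prop :=
  (forall t, t \in `[0, 1] -> is_semigroup_generator whole (A t)) /\
  forall l : seq (R * R),
    all (fun p => (p.1 \in `[0, 1]) && (0 <= p.2)) l ->
    sorted <=%R (map fst l) ->
    forall x, nrm whole (foldl (fun y p => semigroup whole (A p.1) p.2 y) x l)
      <= M * expR (w * \sum_(p <- l) p.2) * nrm whole x.

Definition admissible (B : operator) (E : normed_subspace) : Prop :=
  [/\ is_semigroup_generator whole B,
      is_banach E,
      dense (carrier E),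
      bounded_on E whole id &
      strongly_continuous_rep `[0, +oo[ E (semigroup whole B)].

Definition has_derivative_within (J : set R) (u : R -> X) (t : R) (l : X) :
    Prop :=
  ((r - t)^-1)%:C *: (u r - u t) @[r --> within J (dnbhs t)] --> l.

Definition solution_on (A : R -> operator) (Y : set X) (s : R) (y : X)
    (u : R -> X) : Prop :=
  [/\ u s = y,
      forall t, t \in `[s, 1] -> Y (u t),
      forall t, t \in `[s, 1] -> dom (A t) (u t) /\
        has_derivative_within `[s, 1] u t (A t (u t)) &
      {within `[s, 1], continuous (fun t => A t (u t))}].

Definition evolution_system (A : R -> operator) (Y : set X)
    (U : R -> R -> X -> X) : Prop :=
  [/\ forall s t : R, 0 <= s -> s <= t -> t <= 1 -> bounded_on whole whole (U t s),
      forall (s : R) y, 0 <= s -> s < 1 -> Y y ->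
        solution_on A Y s y (fun t => U t s y),
      forall (r s t : R) x, 0 <= r -> r <= s -> s <= t -> t <= 1 ->
        U t s (U s r x) = U t r x &
      forall x, {within [set p : R * R | 0 <= p.1 /\ p.1 <= p.2 /\ p.2 <= 1],
        continuous (fun p => U p.2 p.1 x)}].

(* A^+ for b = true and A^- for b = false. *)
Definition signed (b : bool) (A : R -> operator) : R -> operator :=
  if b then A else fun t => opp_operator (A (1 - t)).

End Definitions.

Arguments normed_subspace {R} X.
Arguments operator {R} X.
Arguments whole {R} X.

(* Main.v *)
Require Import Defs.
From HB Require Import structures.
From mathcomp Require Import all_boot all_order all_algebra.
From mathcomp Require Import all_classical all_reals all_analysis.
From mathcomp Require Import complex.
From mathcomp Require Import ring lra ssrAC.

(** Freeze the generators on n equal cells of [0, 1], each at the midpoint of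
    its cell, and multiply the resulting semigroups. Stability bounds these
    products U_n on X, uniformly in n, and the theorem follows once they
    converge to a family with enough regularity in Y.

    Convergence. Since t |-> A(t) is only strongly continuous on Y, the
    difference of two products applied to y cannot be estimated at once: the
    integrand (A_n(r) - A_m(r)) U_m(r, s) y is not small uniformly in m. It is
    small along a fixed orbit, though: U_n(T, t) y and
    U_n(T, t + h) e^(A(t) h) y differ by at most a small multiple of h for h
    small and n large ([step_product_local]). Such steps can be chained, and a
    maximality argument ([maximal_chain_reaches]) carries the chain from s to T.
    The chain does not get stuck at an intermediate time because its points are
    Lipschitz in X, hence converge there, and balls for a uniformly convex
    complete norm on Y are closed in X ([uniformly_convex_ball_closed]), so that
    the limit is in Y with the right bound. The end point of the chain is close
    to U_n(T, s) y for all large n ([step_product_chain]), so these form a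
    Cauchy sequence. The limit U is a propagator with right derivative A(t) on
    the diagonal ([evolution_limit]) and N_T (U(T, s) y) is at most
    e^(C (T - s)) N_s y.

    Regularity. That bound and uniform convexity make t |-> U(t, s) y right
    continuous in Y (the Radon-Riesz property, [radon_riesz]). Cells and
    midpoints are symmetric under t |-> 1 - t, so the products for A^- are the
    exact inverses of those for A^+; the limits are inverse to each other, and
    right continuity of the backward limit is left continuity of the forward
    one. Therefore A(t) U(t, s) y is continuous in X, and a continuous right
    derivative is a derivative ([derivative_of_right_derivative]).

    The estimates in X, and uniqueness, come from one comparison principle
    ([propagator_compare]), which is the mean value inequality applied to
    r |-> U(T, r) v(r).

    Two preliminaries connect the hypotheses with this argument: the operators
    A(t) are uniformly bounded from Y to X ([uniform_boundedness]), and the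
    semigroup generated by the part of A(t) in Y is the restriction of
    e^(A(t) s) ([part_semigroup]), because the domain of that part is dense in
    Y ([generator_dense]). *)

Import Order.TTheory GRing.Theory Num.Theory.
Import numFieldNormedType.Exports.
Local Open Scope classical_set_scope.
Local Open Scope complex_scope.
Local Open Scope ring_scope.

Set Implicit Arguments.
Unset Strict Implicit.
Unset Printing Implicit Defensive.

(** * Normed subspaces and epsilon-delta convergence *)

(** Using only the facts moved to the goal keeps the linear problem small. *)
Ltac lra_goal := repeat match goal with H : is_true _ |- _ => clear H end; lra.

Section NormedSubspace.
Context {R : realType} {X : normedModType R[i]}.

Lemma normC_real (r : R) : `|r%:C| = `|r|%:C :> R[i].
Proof. by rewrite normc_def /= expr0n addr0 sqrtr_sqr. Qed.

Lemma normX_real (x : X) : `|x| = (nrm (whole X) x)%:C.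
Proof.
have := ger0_Im (normr_ge0 x).
by rewrite /=; case: `|x| => a b /= ->.
Qed.

Lemma whole_normed : is_normed_subspace (whole X).
Proof.
split; first by split=> [|a x y _ _]; rewrite inE.
split=> [x _|x _ x0|a x _|x y _ _].
- by rewrite -lecR -normX_real normr_ge0.
- by apply/eqP; rewrite -normr_eq0 normX_real x0.
- by rewrite -!normX_real normrZ.
- by rewrite -lecR rmorphD /= -!normX_real ler_normD.
Qed.

Section Abstract.
Variables (E : normed_subspace X) (hE : is_normed_subspace E).

Lemma ns0 : carrier E 0.
Proof. by case: hE => -[+ _] _; rewrite inE. Qed.

Lemma nsZD (a : R[i]) x y : carrier E x -> carrier E y -> carrier E (a *: x + y).
Proof. by case: hE => -[_ +] _ => /(_ a x y); rewrite !inE. Qed.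

Lemma nsZ (a : R[i]) x : carrier E x -> carrier E (a *: x).
Proof. by move=> hx; rewrite -[_ *: _]addr0; apply: nsZD => //; exact: ns0. Qed.

Lemma nsD x y : carrier E x -> carrier E y -> carrier E (x + y).
Proof. by move=> hx hy; rewrite -[x]scale1r; exact: nsZD. Qed.

Lemma nsN x : carrier E x -> carrier E (- x).
Proof. by rewrite -scaleN1r; exact: nsZ. Qed.

Lemma nsB x y : carrier E x -> carrier E y -> carrier E (x - y).
Proof. by move=> hx hy; apply: nsD => //; exact: nsN. Qed.

Lemma nrm_ge0 x : carrier E x -> 0 <= nrm E x.
Proof. by case: hE => _ [+ _ _ _]; exact. Qed.

Lemma nrm_eq0 x : carrier E x -> nrm E x = 0 -> x = 0.
Proof. by case: hE => _ [_ + _ _]; exact. Qed.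

Lemma nrmZ (r : R) x : carrier E x -> nrm E (r%:C *: x) = `|r| * nrm E x.
Proof.
move=> hx; case: hE => _ [_ _ /(_ r%:C x hx) + _].
by rewrite normC_real -rmorphM => /(congr1 (@complex.Re R)).
Qed.

Lemma nrmD x y : carrier E x -> carrier E y -> nrm E (x + y) <= nrm E x + nrm E y.
Proof. by case: hE => _ [_ _ _ +]; exact. Qed.

Lemma nrm0 : nrm E 0 = 0.
Proof.
have := nrmZ 0 ns0; by rewrite scaler0 normr0 mul0r.
Qed.

Lemma nrmN x : carrier E x -> nrm E (- x) = nrm E x.
Proof.
move=> hx; have := nrmZ (-1) hx.
by rewrite rmorphN rmorph1 scaleN1r normrN normr1 mul1r.
Qed.

Lemma nrmC x y : carrier E x -> carrier E y -> nrm E (x - y) = nrm E (y - x).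
Proof. by move=> hx hy; rewrite -nrmN ?opprB //; exact: nsB. Qed.

Lemma nrmB x y : carrier E x -> carrier E y -> nrm E (x - y) <= nrm E x + nrm E y.
Proof. by move=> hx hy; rewrite -(nrmN hy); apply: nrmD => //; exact: nsN. Qed.

Lemma nrm_tri y x z : carrier E x -> carrier E y -> carrier E z ->
  nrm E (x - z) <= nrm E (x - y) + nrm E (y - z).
Proof.
move=> hx hy hz.
have -> : x - z = (x - y) + (y - z) by rewrite addrA subrK.
by apply: nrmD; exact: nsB.
Qed.

Lemma nrm_subr x y : carrier E x -> carrier E y -> nrm E x <= nrm E y + nrm E (x - y).
Proof.
by move=> hx hy; rewrite -{1}(subrK y x) addrC; apply: nrmD => //; exact: nsB.
Qed.

Lemma nrm_eq x y : carrier E x -> carrier E y ->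
  (forall e : R, 0 < e -> nrm E (x - y) <= e) -> x = y.
Proof.
move=> hx hy h; apply/eqP; rewrite -subr_eq0; apply/eqP.
apply: nrm_eq0; first exact: nsB.
apply/eqP; rewrite eq_le nrm_ge0 ?andbT; last exact: nsB.
by apply/ler_addgt0Pl => e e0; rewrite addr0 h.
Qed.

End Abstract.

Lemma cvg0_within (J : set R) (s : R) (g : R -> R) :
  (g r @[r --> within J (nbhs s)] --> (0 : R)) <->
  forall e : R, 0 < e -> exists2 d : R, 0 < d &
    forall r : R, J r -> `|r - s| < d -> `|g r| < e.
Proof.
split.
- move=> /cvgrPdist_lt h e /h; rewrite near_withinE => /nbhs_ballP[d /= d0 hd].
  exists d => // r hr rs; have := hd r; rewrite /ball /= distrC => /(_ rs hr).
  by rewrite sub0r normrN.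
- move=> h; apply/cvgrPdist_lt => e /h[d d0 hd].
  rewrite near_withinE; apply/nbhs_ballP; exists d => //= r.
  by rewrite /ball /= distrC sub0r normrN => rs hr; exact: hd.
Qed.

Lemma cvg0_dnbhs (J : set R) (s : R) (g : R -> R) :
  (g r @[r --> within J (dnbhs s)] --> (0 : R)) <->
  forall e : R, 0 < e -> exists2 d : R, 0 < d &
    forall r : R, J r -> r != s -> `|r - s| < d -> `|g r| < e.
Proof.
split.
- move=> /cvgrPdist_lt h e /h; rewrite near_withinE near_withinE.
  move=> /nbhs_ballP[d /= d0 hd].
  exists d => // r hr rs' rs; have := hd r.
  by rewrite /ball /= distrC => /(_ rs rs' hr); rewrite sub0r normrN.
- move=> h; apply/cvgrPdist_lt => e /h[d d0 hd].
  rewrite near_withinE near_withinE; apply/nbhs_ballP; exists d => //= r.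
  by rewrite /ball /= distrC sub0r normrN => rs hrs hr; exact: hd.
Qed.

Lemma cvg0_seq (u : nat -> R) : (forall n, 0 <= u n) ->
  (u n @[n --> \oo] --> (0 : R)) <->
  forall e : R, 0 < e -> exists n0, forall n, (n0 <= n)%N -> u n < e.
Proof.
move=> u0; split.
- move=> /cvgrPdist_lt h e /h[n0 _ hn]; exists n0 => n /hn /=.
  by rewrite sub0r normrN ger0_norm.
- move=> h; apply/cvgrPdist_lt => e /h[n0 hn]; exists n0 => // n /hn /=.
  by rewrite sub0r normrN ger0_norm.
Qed.

Lemma cvg_whole (T : Type) (F : set_system T) (FF : Filter F) (f : T -> X) l :
  (f x @[x --> F] --> l) <->
  forall e : R, 0 < e -> \forall x \near F, nrm (whole X) (f x - l) < e.
Proof.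
split.
- move=> /cvgrPdist_lt h e e0; have := h e%:C.
  rewrite ltcR => /(_ e0); apply: filterS => x.
  by rewrite normX_real ltcR (nrmC whole_normed).
- move=> h; apply/cvgrPdist_lt => -[a b]; rewrite ltcE /= => /andP[/eqP ? a0].
  subst b; apply: filterS (h a a0) => x.
  by rewrite normX_real ltcR (nrmC whole_normed).
Qed.

Lemma continuous_within_whole (D : set R) (f : R -> X) :
  {within D, continuous f} <->
  forall t, D t -> forall e : R, 0 < e -> exists2 d : R, 0 < d &
    forall r, D r -> `|r - t| < d -> nrm (whole X) (f r - f t) < e.
Proof.
split.
- move=> /subspace_continuousP h t /h /cvg_whole h' e /h'.
  rewrite near_withinE => /nbhs_ballP[d /= d0 hd].
  by exists d => // r hr rs; apply: hd => //; rewrite /ball /= distrC.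
- move=> h; apply/subspace_continuousP => t Dt; apply/cvg_whole => e e0.
  have [d d0 hd] := h t Dt e e0.
  rewrite near_withinE; apply/nbhs_ballP; exists d => //= r.
  by rewrite /ball /= distrC => rs hr; exact: hd.
Qed.

End NormedSubspace.

Lemma whole_banach (R : realType) (X : completeNormedModType R[i]) :
  is_banach (whole X).
Proof.
split; first exact: whole_normed.
move=> u _ hu.
have cu : cvg (u @ \oo).
  apply/cauchy_cvgP/cauchy_exP => -[a b]; rewrite ltcE /= => /andP[/eqP ? a0].
  subst b; have [n0 hn] := hu a a0.
  exists (u n0); exists n0 => // n /= n0n.
  by rewrite -ball_normE /= normX_real ltcR; exact: hn.
exists (lim (u @ \oo)); split => //; apply/cvg0_seq => [n|e e0].
  exact: (nrm_ge0 whole_normed).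
have /cvg_whole/(_ e e0)[n0 _ hn] := cu.
by exists n0 => n /hn.
Qed.

(** * A chain principle and the mean value inequality *)

Section Reach.
Context {R : realType}.

Lemma monotone_limit (u : nat -> R) (b : R) : (forall k, u k <= u k.+1) ->
  (forall k, u k <= b) ->
  exists t, [/\ t <= b, forall k, u k <= t &
    forall d : R, 0 < d -> exists n0, forall k, (n0 <= k)%N -> t - d < u k].
Proof.
move=> umono ub.
have mono k l : (k <= l)%N -> u k <= u l.
  by apply: (homo_leq (@lexx _ R) (@le_trans _ R)).
have hs : has_sup (range u).
  by split; [exists (u 0%N), 0%N | exists b => _ [k _ <-]].
exists (sup (range u)); split.
- by apply: ge_sup; [exists (u 0%N), 0%N | move=> _ [k _ <-]].
- by move=> k; apply: ub_le_sup; [case: hs | exists k].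
- move=> d d0; have [_ [n0 _ <-] h] := sup_adherent d0 hs.
  by exists n0 => k /mono; exact: lt_le_trans.
Qed.

(** A chain principle in the style of Brezis and Browder: choosing each
    successor so as to advance at least half as far as possible, the times of
    an upper bound of the resulting sequence cannot be exceeded any more. *)
Lemma maximal_chain_reaches (Z : Type) (tm : Z -> R) (le : Z -> Z -> Prop) (b : R) :
  (forall x, le x x) ->
  (forall x y z, le x y -> le y z -> le x z) ->
  (forall x, tm x <= b) ->
  (forall x y, le x y -> tm x <= tm y) ->
  (forall x, tm x < b -> exists2 y, le x y & tm x < tm y) ->
  (forall u : nat -> Z, (forall k, le (u k) (u k.+1)) ->
     exists z, forall k, le (u k) z) ->
  forall x, exists2 y, le x y & tm y = b.
Proof.
move=> lexx' letr tmb tmle succ ubd x.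
(* From y, go at least half of the way that is still possible. *)
have greedy y : exists z, le y z /\
    forall z', le y z' -> tm z' - tm y <= 2 * (tm z - tm y).
  pose S := [set tm z | z in le y].
  have hs : has_sup S by split; [exists (tm y), y | exists b => _ [z _ <-]].
  have le_sup z : le y z -> tm z <= sup S.
    by move=> hz; apply: ub_le_sup; [case: hs | exists z].
  have := le_sup y (lexx' y); rewrite le_eqVlt => /orP[/eqP e|lt].
    exists y; split => // z' /le_sup; rewrite -e subrr mulr0 subr_le0//.
  have e0 : 0 < (sup S - tm y) / 2 by lra.
  have [_ [z hz <-] h] := sup_adherent e0 hs.
  by exists z; split => // z' /le_sup h'; lra.
have [f hf] := choice greedy.
pose u k := iter k f x.
have ule k : le (u k) (u k.+1) by case: (hf (u k)).
have [z hz] := ubd u ule.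
exists z; first exact: (hz 0%N).
apply/eqP; rewrite eq_le tmb /= leNgt; apply/negP => /succ[z' lez' ltz'].
have step k : tm (u k) + (tm z' - tm z) / 2 <= tm (u k.+1).
  have [_ /(_ z' (letr _ _ _ (hz k) lez'))] := hf (u k).
  by have := tmle _ _ (hz k); rewrite -[f (u k)]/(u k.+1); lra.
have grow k : tm x + k%:R * ((tm z' - tm z) / 2) <= tm (u k).
  elim: k => [|k IH]; first by rewrite mul0r addr0.
  by rewrite -natr1 mulrDl mul1r addrA (le_trans _ (step k)) // lerD2r.
have d0 : 0 < (tm z' - tm z) / 2 by lra.
pose k := Num.bound ((b - tm x) / ((tm z' - tm z) / 2)).
have hk : (b - tm x) / ((tm z' - tm z) / 2) < k%:R.
  apply: archi_boundP; apply: divr_ge0; last exact: ltW.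
  by rewrite subr_ge0.
move: hk; rewrite ltr_pdivrMr // => hk.
by have := grow k; have := tmb (u k); lra.
Qed.

End Reach.

Section MVI.
Context {R : realType} {X : normedModType R[i]}.

(** Only one point r > t is asked for at each t: by left continuity, the times
    up to which the estimate holds form a chain that can only end at b. Right
    derivatives, and derivatives known only along a sequence of increments, are
    covered in this form. *)
Lemma mean_value_ineq (E : normed_subspace X) (f : R -> X) (a b C : R) :
  is_normed_subspace E -> a <= b -> 0 <= C ->
  (forall r : R, a <= r <= b -> carrier E (f r)) ->
  (forall t : R, a <= t <= b -> forall e : R, 0 < e -> exists2 d : R, 0 < d &
    forall r : R, a <= r <= t -> t - r < d -> nrm E (f r - f t) < e) ->
  (forall t : R, a <= t < b -> forall h : R, 0 < h -> exists2 r : R, t < r <= b &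
    nrm E (f r - f t) <= (C + h) * (r - t)) ->
  nrm E (f b - f a) <= C * (b - a).
Proof.
move=> hE ab C0 Ef lcont dini.
apply/ler_addgt0Pr => e e0.
pose h := e / (b - a + 1).
have h0 : 0 < h by apply: divr_gt0 => //; lra.
have hba : h * (b - a) <= e.
  by rewrite /h mulrAC ler_pdivrMr; [rewrite ler_pM2l //; lra | lra].
suff : nrm E (f b - f a) <= (C + h) * (b - a) by lra.
pose Z := {t : R | a <= t <= b}.
pose le (s t : Z) := sval s <= sval t /\
  nrm E (f (sval t) - f (sval s)) <= (C + h) * (sval t - sval s).
have EZ (z : Z) : carrier E (f (sval z)) by apply: Ef; case: z.
have za : a <= a <= b by rewrite lexx.
suff [[t ht] [/= _ +] tb] : exists2 y : Z, le (exist _ a za) y & sval y = b.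
  by rewrite /= in tb; subst t.
apply: (@maximal_chain_reaches _ Z sval le b).
- by move=> x; split=> //; rewrite !subrr (nrm0 hE) mulr0.
- move=> x y z [xy h1] [yz h2]; split; first exact: le_trans yz.
  by have := nrm_tri hE (EZ z) (EZ y) (EZ x); lra.
- by case=> t /= /andP[].
- by move=> x y [h1 _].
- case=> t ht tb'; have /andP[ta tb] := ht.
  have [|r /andP[tr rb] hr] := dini t _ h h0; first by rewrite ta.
  have hr' : a <= r <= b by rewrite rb andbT; lra.
  by exists (exist _ r hr') => //; split => //=; exact: ltW.
- move=> u hu.
  have [||t [tb ut ct]] := @monotone_limit R (fun k => sval (u k)) b.
  + by move=> k; case: (hu k).
  + by move=> k; case: (u k) => x /= /andP[].
  have at_ : a <= t <= b.
    by rewrite tb andbT (le_trans _ (ut 0%N)) //; case: (u 0%N) => x /= /andP[].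
  exists (exist _ t at_) => k; split => //=.
  apply/ler_addgt0Pr => e' e'0.
  have [d d0 hd] := lcont t at_ e' e'0.
  have [n0 hn] := ct d d0.
  have chain l : (k <= l)%N -> nrm E (f (sval (u l)) - f (sval (u k))) <=
      (C + h) * (sval (u l) - sval (u k)).
    elim: l => [|l IH]; first by rewrite leqn0 => /eqP->; rewrite !subrr (nrm0 hE) mulr0.
    rewrite leq_eqVlt => /orP[/eqP->|]; first by rewrite !subrr (nrm0 hE) mulr0.
    rewrite ltnS => /IH; have [_ ] := hu l.
    by have := nrm_tri hE (EZ (u l.+1)) (EZ (u l)) (EZ (u k)); lra.
  pose l := maxn k n0.
  have := chain l (leq_maxl _ _); have := hn l (leq_maxr _ _) => h1 h2.
  have h3 : nrm E (f (sval (u l)) - f t) < e'.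
    by apply: hd; [rewrite ut andbT; case: (u l) => x /= /andP[]|lra].
  have := nrm_tri hE (Ef t at_) (EZ (u l)) (EZ (u k)).
  rewrite (nrmC hE (Ef t at_) (EZ (u l))).
  have : (C + h) * (sval (u l) - sval (u k)) <= (C + h) * (t - sval (u k)).
    by apply: ler_wpM2l; [lra | rewrite lerD2r].
  lra.
Qed.

End MVI.

(** * Uniformly convex norms *)

Section UniformConvexity.
Context {R : realType} {X : normedModType R[i]}.
Variable E : normed_subspace X.
Hypotheses (hE : is_normed_subspace E) (ucE : uniformly_convex E).

Let N := nrm E.
Let nX := nrm (whole X).
Let hX := @whole_normed R X.

Lemma scale_half (x : X) : (2^-1 : R)%:C *: (x + x) = x.
Proof.
rewrite scalerDr -scalerDl -rmorphD /=.
by rewrite (_ : _ + _ = 1 :> R) ?scale1r //; lra.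
Qed.

(** If the midpoint is almost a unit vector then so are both points, and
    normalizing them changes everything by little. *)
Lemma uniformly_convex_ball (e : R) : 0 < e -> exists2 d : R, 0 < d &
  forall x y, carrier E x -> carrier E y -> N x <= 1 -> N y <= 1 ->
    e <= N (x - y) -> N ((2^-1 : R)%:C *: (x + y)) <= 1 - d.
Proof.
move=> e0; have [|d1 [d10 hd1]] := ucE (e := e / 2); first by lra.
pose d := Num.min (e / 8) (Num.min (d1 / 4) (1 / 4)).
have [de [dd d4]] : d <= e / 8 /\ d <= d1 / 4 /\ d <= 1 / 4.
  by rewrite /d !ge_min !lexx !orbT.
have d0 : 0 < d by rewrite /d !lt_min; apply/and3P; split; lra.
exists d => // x y Ex Ey x1 y1 exy; rewrite leNgt; apply/negP => hlt.
have half_le u v : carrier E u -> carrier E v ->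
    N ((2^-1 : R)%:C *: (u + v)) <= 2^-1 * (N u + N v).
  move=> Eu Ev; rewrite /N (nrmZ hE _ (nsD hE Eu Ev)) ger0_norm; last by lra.
  by apply: ler_wpM2l; [lra | exact: nrmD].
have hxy := half_le x y Ex Ey.
have unit u : carrier E u -> 1 - 2 * d < N u -> N u <= 1 ->
    exists v, [/\ carrier E v, N v = 1 & N (v - u) <= 2 * d].
  move=> Eu u1 u2; have Nu : 0 < N u by lra.
  exists ((N u)^-1%:C *: u); split; first exact: nsZ.
    by rewrite /N nrmZ // ger0_norm ?mulVf ?gt_eqF // invr_ge0 ltW.
  rewrite -[X in _ - X]scale1r -scalerBl -[1](rmorph1 (real_complex R)) -rmorphB.
  rewrite /N nrmZ // -/N ger0_norm ?subr_ge0 ?invf_ge1 //.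
  by rewrite mulrBl mulVf ?gt_eqF // mul1r; lra.
have [|//|x' [Ex' x'1 xx']] := unit x Ex; first by lra.
have [|//|y' [Ey' y'1 yy']] := unit y Ey; first by lra.
have big : e / 2 <= N (x' - y').
  have h1 := nrm_tri hE Ex Ex' Ey; have h2 := nrm_tri hE Ex' Ey' Ey.
  by move: h1; rewrite (nrmC hE Ex Ex') -/N; move: h2; rewrite -/N; lra.
have := hd1 x' y' Ex' Ey' x'1 y'1 big; rewrite -/N.
have Exy := nsZ hE ((2^-1 : R)%:C) (nsD hE Ex Ey).
have Exy' := nsZ hE ((2^-1 : R)%:C) (nsD hE Ex' Ey').
have := nrm_subr hE Exy Exy'; rewrite -/N -scalerBr.
have -> : x + y - (x' + y') = (x - x') + (y - y').
  by rewrite opprD !addrA; congr (_ - _); rewrite addrAC.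
have := half_le _ _ (nsB hE Ex Ex') (nsB hE Ey Ey').
rewrite /N (nrmC hE Ex Ex') (nrmC hE Ey Ey') -/N; lra.
Qed.

(** Points and midpoint all nearly of norm rho: the form in which uniform
    convexity yields Cauchy sequences and strong convergence. *)
Lemma uniformly_convex_scaled (rho e : R) : 0 <= rho -> 0 < e ->
  exists2 h : R, 0 < h & forall x y, carrier E x -> carrier E y ->
    N x <= rho + h -> N y <= rho + h ->
    rho - h <= N ((2^-1 : R)%:C *: (x + y)) -> N (x - y) < e.
Proof.
rewrite le_eqVlt => /orP[/eqP <-|rho0] e0.
  exists (e / 3) => [|x y Ex Ey]; first by lra.
  by have := nrmB hE Ex Ey; rewrite -/N; lra.
have [d d0 hd] := @uniformly_convex_ball (e / (2 * rho)) ltac:(by apply: divr_gt0; lra).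
pose h := Num.min rho (d * rho / 4).
have [hr hd4] : h <= rho /\ h <= d * rho / 4 by rewrite /h !ge_min !lexx orbT.
have drho : 0 < d * rho by exact: mulr_gt0.
have h0 : 0 < h by rewrite /h lt_min rho0 /=; lra.
exists h => // x y Ex Ey hx hy hm; rewrite ltNge; apply/negP => he.
pose r := rho + h; have r0 : 0 < r by rewrite /r; lra.
have Nr u : carrier E u -> N (r^-1%:C *: u) = r^-1 * N u.
  by move=> Eu; rewrite /N nrmZ // ger0_norm // invr_ge0 ltW.
have := hd (r^-1%:C *: x) (r^-1%:C *: y).
rewrite -scalerBr -scalerDr scalerA -rmorphM [2^-1 * _]mulrC rmorphM -scalerA.
rewrite !Nr //; try (by apply: nsZ => //; exact: nsD); try exact: nsB.
rewrite !ler_pdivrMl // mulr1 => H.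
have {H} := H (nsZ hE _ Ex) (nsZ hE _ Ey) hx hy.
rewrite ler_pdivlMl // => H.
have : r * (e / (2 * rho)) <= N (x - y).
  apply: le_trans he; rewrite mulrA ler_pdivrMr; last by lra.
  by rewrite mulrC ler_pM2l // /r; lra.
move=> /H; rewrite mulrBr mulr1 /r mulrDl.
have : 0 < h * d by exact: mulr_gt0.
lra.
Qed.

Hypothesis bE : is_banach E.
Variable CX : R.
Hypothesis emb : forall y, carrier E y -> nX y <= CX * N y.

Lemma seq_small (e : R) : 0 < e ->
  exists n0, forall n, (n0 <= n)%N -> n.+1%:R^-1 < e.
Proof.
move=> e0; exists (Num.bound e^-1) => n hn.
rewrite invf_plt ?posrE // (@lt_le_trans _ _ (Num.bound e^-1)%:R) //.
  by apply: archi_boundP; rewrite invr_ge0 ltW.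
by rewrite ler_nat (leq_trans hn).
Qed.

Lemma midpoint_near (x v y : X) (d : R) : nX (x - y) < d -> nX (v - y) < d ->
  nX ((2^-1 : R)%:C *: (x + v) - y) < d.
Proof.
move=> xd vd.
rewrite -[in X in _ - X](scale_half y) -scalerBr.
have -> : x + v - (y + y) = (x - y) + (v - y).
  by rewrite opprD !addrA; congr (_ - _); rewrite addrAC.
rewrite /nX nrmZ // ger0_norm; last by lra.
by have := @nrmD _ _ _ hX (x - y) (v - y) I I; rewrite -/nX; lra.
Qed.

(** What reflexivity of E would give through weak limits, obtained directly:
    near-minimizers of the norm in shrinking X-neighbourhoods of y converge. *)
Lemma uniformly_convex_ball_closed (y : X) (C : R) :
  (forall d : R, 0 < d -> exists v, [/\ carrier E v, nX (v - y) < d & N v <= C]) ->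
  carrier E y /\ N y <= C.
Proof.
move=> H.
pose S : set R := [set r | exists2 d : R, 0 < d &
  forall v, carrier E v -> nX (v - y) < d -> r <= N v].
have S0 : S 0 by exists 1 => // v Ev _; exact: nrm_ge0.
have SC r : S r -> r <= C.
  by case=> d d0 h; have [v [Ev vd /(le_trans _)]] := H d d0; apply; exact: h.
have hs : has_sup S by split; [exists 0 | exists C => r /SC].
pose rho := sup S.
have rho0 : 0 <= rho by apply: ub_le_sup => //; case: hs.
have rhoC : rho <= C by apply: ge_sup; [exists 0 | move=> r /SC].
(* rho is the limit of the infimum of N over the X-balls around y. Midpoints
   stay in these balls, so near-minimizers are N-Cauchy by uniform convexity. *)
have lower h : 0 < h -> exists2 d : R, 0 < d &
    forall v, carrier E v -> nX (v - y) < d -> rho - h <= N v.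
  move=> h0; have [r [d d0 hd] hr] := sup_adherent h0 hs.
  by exists d => // v Ev vd; exact: le_trans (ltW hr) (hd v Ev vd).
have upper d h : 0 < d -> 0 < h ->
    exists v, [/\ carrier E v, nX (v - y) < d & N v <= rho + h].
  move=> d0 h0; apply: contrapT => hn.
  have /ub_le_sup : S (rho + h).
    exists d => // v Ev vd; rewrite leNgt; apply/negP => hlt.
    by apply: hn; exists v; split => //; exact: ltW.
  by move=> /(_ (proj2 hs)); rewrite -/rho; lra.
have pos n : 0 < (n.+1%:R^-1 : R) by rewrite invr_gt0.
have [v hv] := choice (fun n => upper _ _ (pos n) (pos n)).
have Ev n : carrier E (v n) by case: (hv n).
have cauchy e : 0 < e -> exists n0 : nat, forall m n : nat,
    (n0 <= m)%N -> (n0 <= n)%N -> nrm E (v m - v n) < e.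
  move=> e0; have [h h0 hh] := uniformly_convex_scaled rho0 e0.
  have [d d0 hd] := lower h h0.
  have [n1 hn1] := seq_small h0; have [n2 hn2] := seq_small d0.
  exists (maxn n1 n2) => m n; rewrite !geq_max => /andP[m1 m2] /andP[l1 l2].
  have [_ vm Nm] := hv m; have [_ vn Nn] := hv n.
  apply: hh => //.
  - by apply: (le_trans Nm); rewrite lerD2l ltW ?hn1.
  - by apply: (le_trans Nn); rewrite lerD2l ltW ?hn1.
  - apply: hd; first by apply: nsZ => //; exact: nsD.
    apply: midpoint_near.
      exact: (lt_trans vm (hn2 m m2)).
    exact: (lt_trans vn (hn2 n l2)).
have [z [Ez /cvg0_seq hz]] := (proj2 bE) v Ev cauchy.
have {}hz := hz (fun n => nrm_ge0 hE (nsB hE (Ev n) Ez)).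
have zy : z = y.
  apply: (nrm_eq hX) => // e e0.
  pose C1 := `|CX| + 1; have C10 : 0 < C1 by rewrite /C1; have := normr_ge0 CX; lra.
  have [|n1 hn1] := hz (e / 2 / C1); first by apply: divr_gt0 => //; lra.
  have [|n2 hn2] := @seq_small (e / 2); first by lra.
  pose n := maxn n1 n2.
  have a1 := hn2 n (leq_maxr _ _).
  have := hn1 n (leq_maxl _ _); rewrite ltr_pdivlMr // mulrC => a2.
  have [_ /lt_trans/(_ a1) vn _] := hv n.
  have := @nrm_tri _ _ _ hX (v n) z y I I I.
  have := emb (nsB hE (Ev n) Ez); rewrite (nrmC hX (_ : carrier (whole X) z) (_ : carrier (whole X) (v n))) // -/nX -/N.
  have : CX * N (v n - z) <= C1 * N (v n - z).
    by apply: ler_wpM2r; [apply: nrm_ge0 => //; exact: nsB | rewrite /C1; have := ler_norm CX; lra].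
  rewrite -/N in a2; lra.
rewrite -zy; split => //.
apply: (le_trans _ rhoC).
apply/ler_addgt0Pr => e e0.
have [|n1 hn1] := hz (e / 2); first by lra.
have [|n2 hn2] := @seq_small (e / 2); first by lra.
pose n := maxn n1 n2.
have := hn1 n (leq_maxl _ _).
have [_ _ /le_trans Nn] := hv n.
have {}Nn := Nn (rho + e / 2) (ltac:(by rewrite lerD2l ltW // hn2 // leq_maxr)).
have := nrm_subr hE Ez (Ev n); rewrite (nrmC hE Ez (Ev n)) -/N; lra.
Qed.

(** The midpoint of v and y is close to y in X, so by lower semicontinuity its
    norm is almost that of y, and uniform convexity applies. *)
Lemma radon_riesz (y : X) (e : R) : carrier E y -> 0 < e ->
  exists2 d : R, 0 < d & forall v, carrier E v -> nX (v - y) < d ->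
    N v <= N y + d -> N (v - y) < e.
Proof.
move=> Ey e0; have Ny0 : 0 <= N y by exact: nrm_ge0.
have [h h0 hh] := uniformly_convex_scaled Ny0 e0.
have [d d0 hd] : exists2 d : R, 0 < d &
    forall v, carrier E v -> nX (v - y) < d -> N y - h <= N v.
  apply: contrapT => hn.
  suff [_] : carrier E y /\ N y <= N y - h by lra.
  apply: uniformly_convex_ball_closed => d d0; apply: contrapT => hn'; apply: hn.
  exists d => // v Ev vd; rewrite leNgt; apply/negP => hlt; apply: hn'.
  by exists v; split => //; exact: ltW.
exists (Num.min d h) => [|v Ev]; first by rewrite lt_min d0.
rewrite lt_min => /andP[vd vh] Nv.
have hmin : Num.min d h <= h by rewrite ge_min lexx orbT.
apply: hh => //; [by lra | by lra |].
apply: hd; first by apply: nsZ => //; exact: nsD.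
by apply: midpoint_near => //; rewrite subrr /nX (nrm0 hX).
Qed.

End UniformConvexity.

(** * Uniform boundedness *)

Section UniformBoundedness.
Context {R : realType} {X : normedModType R[i]}.
Let nX := nrm (whole X).
Let hX := @whole_normed R X.

Lemma linear_onB (V : set X) (f : X -> X) x y : linear_on V f ->
  V x -> V y -> f (x - y) = f x - f y.
Proof.
move=> lf hx hy; have := lf (-1) y x hy hx.
by rewrite !scaleN1r ![- _ + _]addrC.
Qed.

(** Sokal's gliding hump: move to points where one operator after the other is
    large, within radii so small that the earlier values survive in the limit. *)
Lemma uniform_boundedness (E : normed_subspace X) (J : Type) (D : set J)
    (f : J -> X -> X) :
  is_banach E -> (forall i, D i -> bounded_on E (whole X) (f i)) ->
  (forall x, carrier E x -> exists C, forall i, D i -> nX (f i x) <= C) ->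
  exists2 C : R, 0 <= C & forall i x, D i -> carrier E x -> nX (f i x) <= C * nrm E x.
Proof.
move=> [hE complete] fb ptw; apply: contrapT => unb.
have f0 i : D i -> f i 0 = 0.
  by case/fb => _ lf _; rewrite -{1}(subrr 0) (linear_onB lf) ?subrr //; exact: ns0.
pose St := {p : X * R | carrier E p.1 /\ 0 < p.2}.
(* Later points stay within 2 * r of the new one; 3 leaves room for passing to
   the limit. *)
have step (q : nat * St) : exists p : J * St, let: (i, s') := p in
    [/\ D i, nrm E ((sval s').1 - (sval q.2).1) <= (sval q.2).2,
        (sval s').2 <= (sval q.2).2 / 2, q.1%:R + 1 < nX (f i (sval s').1) &
        forall z, carrier E z -> nrm E z <= 3 * (sval s').2 -> nX (f i z) <= 1].
  case: q => k [[a r] /= [Ea r0]].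
  have [i [x [Di Ex hx]]] : exists i x, [/\ D i, carrier E x &
      (k%:R + 1) / r * nrm E x < nX (f i x)].
    apply: contrapT => hn; apply: unb; exists ((k%:R + 1) / r).
      by apply: divr_ge0; [rewrite addr_ge0 | exact: ltW].
    move=> i x Di Ex; rewrite leNgt; apply/negP => hlt; apply: hn.
    by exists i, x.
  have [_ lf [C0 hC0]] := fb i Di.
  have Nx : 0 < nrm E x.
    rewrite lt_neqAle nrm_ge0 // andbT; apply/negP => /eqP /esym Nx.
    move: hx; rewrite Nx mulr0 (nrm_eq0 hE Ex Nx) f0 //.
    by rewrite /nX (nrm0 hX) ltxx.
  pose x' := (r / nrm E x)%:C *: x.
  have rN : 0 < r / nrm E x by apply: divr_gt0.
  have Ex' : carrier E x' by exact: nsZ.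
  have Nx' : nrm E x' = r.
    by rewrite /x' nrmZ // ger0_norm ?ltW // mulfVK // gt_eqF.
  have fx' : k%:R + 1 < nX (f i x').
    have -> : f i x' = (r / nrm E x)%:C *: f i x.
      have := lf (r / nrm E x)%:C x 0 Ex (ns0 hE).
      by rewrite f0 // !addr0.
    rewrite /nX (nrmZ hX) // ger0_norm ?ltW //.
    rewrite -ltr_pdivrMl //; apply: le_lt_trans hx.
    by rewrite invf_div mulrC mulrA mulrAC lexx.
  (* f i x' is half the difference of the values at a + x' and a - x', so one
     of these two values is at least as large. *)
  have [a' [Ea' Na' fa']] : exists a', [/\ carrier E a', nrm E (a' - a) <= r &
      k%:R + 1 < nX (f i a')].
    have [h|h] := ltP (k%:R + 1) (nX (f i (a + x'))).
      by exists (a + x'); split => //; [exact: nsD | rewrite addrC addKr Nx'].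
    exists (a - x'); split; first exact: nsB.
      by rewrite addrC addKr nrmN // Nx'.
    have := @nrmB _ _ _ hX (f i (a + x')) (f i (a - x')) I I.
    rewrite -(linear_onB lf) //; [|exact: nsD|exact: nsB].
    have -> : a + x' - (a - x') = 1 *: x' + x'.
      by rewrite scale1r opprB addrC addrA subrK.
    rewrite lf // scale1r -[f i x' + f i x']scale1r.
    have -> : 1 *: (f i x' + f i x') = (2 : R)%:C *: f i x'.
      by rewrite scale1r rmorphD rmorph1 scalerDl scale1r.
    by rewrite (nrmZ hX) // ger0_norm // -/nX; lra.
  pose C1 := `|C0| + 1; have C10 : 0 < C1 by rewrite /C1; have := normr_ge0 C0; lra.
  pose r' := Num.min (r / 2) (3 * C1)^-1.
  have r'0 : 0 < r' by rewrite /r' lt_min invr_gt0; apply/andP; split; lra.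
  have r'1 : r' <= r / 2 by rewrite /r' ge_min lexx.
  have r'2 : r' <= (3 * C1)^-1 by rewrite /r' ge_min lexx orbT.
  exists (i, exist (fun p : X * R => carrier E p.1 /\ 0 < p.2) (a', r') (conj Ea' r'0)).
  split=> //= z Ez hz; apply: (le_trans (hC0 z Ez)).
  have h1 : C0 * nrm E z <= C1 * nrm E z.
    by apply: ler_wpM2r; [exact: nrm_ge0 | rewrite /C1; have := ler_norm C0; lra].
  have h2 : C1 * nrm E z <= C1 * (3 * (3 * C1)^-1).
    by rewrite ler_pM2l //; apply: (le_trans hz); rewrite ler_pM2l.
  have e1 : C1 * (3 * (3 * C1)^-1) = 1 by field; rewrite gt_eqF.
  by rewrite e1 in h2; lra.
have [g hg] := choice step.
pose s0 : St := exist (fun p : X * R => carrier E p.1 /\ 0 < p.2) (0, 1) (conj (ns0 hE) ltr01).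
pose s := fix s k := if k is k'.+1 then (g (k', s k')).2 else s0.
pose a k := (sval (s k)).1; pose r k := (sval (s k)).2.
have Ea k : carrier E (a k) by rewrite /a; case: (s k) => p [].
have r0 k : 0 < r k by rewrite /r; case: (s k) => p [].
have hs k : [/\ D (g (k, s k)).1, nrm E (a k.+1 - a k) <= r k, r k.+1 <= r k / 2,
    k%:R + 1 < nX (f (g (k, s k)).1 (a k.+1)) &
    forall z, carrier E z -> nrm E z <= 3 * r k.+1 -> nX (f (g (k, s k)).1 z) <= 1].
  by have := hg (k, s k); rewrite /a /r /=; case: (g (k, s k)).
have dist k l : nrm E (a (k + l)%N - a k) <= 2 * r k - 2 * r (k + l)%N.
  elim: l => [|l IH]; first by rewrite addn0 subrr nrm0 //; have := r0 k; lra.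
  rewrite addnS; have [_ h1 h2 _ _] := hs (k + l)%N.
  have := nrm_tri hE (Ea (k + l).+1) (Ea (k + l)%N) (Ea k).
  (* The radii at least halve, so the drop of 2 * r pays for the step. *)
  have := r0 (k + l)%N; lra.
have rsmall k : r k <= k.+1%:R^-1.
  elim: k => [|k IH]; first by rewrite /r /= invr1.
  have [_ _ h _ _] := hs k; apply: (le_trans h).
  rewrite ler_pdivrMr //; apply: (le_trans IH).
  rewrite [leRHS]mulrC -[leLHS]mul1r ler_pdivrMr // mulrAC ler_pdivlMr //.
  by rewrite mul1r -natrM ler_nat mul2n -addnn addnS ltnS leq_addr.
have cauchy e : 0 < e -> exists n0 : nat, forall m n : nat,
    (n0 <= m)%N -> (n0 <= n)%N -> nrm E (a m - a n) < e.
  move=> e0; have [|n0 hn0] := @seq_small _ (e / 4); first by lra.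
  exists n0 => m n /subnKC <- /subnKC <-.
  have h1 := dist n0 (m - n0)%N; have h2 := dist n0 (n - n0)%N.
  have := nrm_tri hE (Ea (n0 + (m - n0))%N) (Ea n0) (Ea (n0 + (n - n0))%N).
  rewrite (nrmC hE (Ea n0)) //.
  have := le_lt_trans (rsmall n0) (hn0 n0 (leqnn _)).
  have := r0 (n0 + (m - n0))%N; have := r0 (n0 + (n - n0))%N.
  lra.
have [y [Ey /cvg0_seq hy]] := complete a Ea cauchy.
have {}hy := hy (fun n => nrm_ge0 hE (nsB hE (Ea n) Ey)).
have [C hC] := ptw y Ey.
pose k := Num.bound `|C|.
have hk : C < k%:R by apply: le_lt_trans (archi_boundP (normr_ge0 C)); exact: ler_norm.
have [Di _ _ h1 h2] := hs k.
have := hC _ Di.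
have yk : nrm E (a k.+1 - y) <= 3 * r k.+1.
  have [n0 hn0] := hy (r k.+1) (r0 _).
  have h3 := hn0 (k.+1 + n0)%N (leq_addl _ _).
  have h4 := dist k.+1 n0; have := r0 (k.+1 + n0)%N.
  have := nrm_tri hE (Ea k.+1) (Ea (k.+1 + n0)%N) Ey.
  by rewrite (nrmC hE (Ea k.+1) (Ea (k.+1 + n0)%N)); lra.
have h3 := h2 _ (nsB hE (Ea _) Ey) yk.
have [_ lf _] := fb _ Di.
have := @nrm_subr _ _ _ hX (f (g (k, s k)).1 (a k.+1)) (f (g (k, s k)).1 y) I I.
by rewrite -(linear_onB lf) // -/nX; lra.
Qed.

End UniformBoundedness.

(** * Strongly continuous semigroups *)

Section Semigroups.
Context {R : realType} {X : normedModType R[i]}.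

Lemma nrm_quotient (E : normed_subspace X) (h : R) u z :
  is_normed_subspace E -> h != 0 -> carrier E u -> carrier E z ->
  nrm E (h^-1%:C *: u - z) = `|h|^-1 * nrm E (u - h%:C *: z).
Proof.
move=> hE h0 Eu Ez; rewrite -normfV -nrmZ //; last first.
  by apply: nsB => //; exact: nsZ.
by rewrite scalerBr scalerA -rmorphM mulVf // rmorph1 scale1r.
Qed.

Lemma ray_mem (s : R) : 0 <= s -> [set` `[0, +oo[] s.
Proof. by move=> s0; rewrite /= in_itv /= andbT. Qed.

Lemma subrBB (V : zmodType) (a b c d : V) : a - b - (c - d) = (a - c) + (d - b).
Proof. by rewrite opprB [d - c]addrC addrACA [- b + d]addrC. Qed.

Section Rep.
Variables (E : normed_subspace X) (T : R -> X -> X).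
Hypotheses (hE : is_normed_subspace E) (hT : strongly_continuous_rep `[0, +oo[ E T).

Lemma sg_carrier s x : 0 <= s -> carrier E x -> carrier E (T s x).
Proof.
by case: hT => h _ _ _ /ray_mem/h[+ _ _]; exact.
Qed.

Lemma sg_linear s : 0 <= s -> linear_on E (T s).
Proof. by case: hT => h _ _ _ /ray_mem/h[]. Qed.

Lemma sg0 x : carrier E x -> T 0 x = x.
Proof. by case: hT => _ + _ _; exact. Qed.

Lemma sgD s r x : 0 <= s -> 0 <= r -> carrier E x -> T (s + r) x = T s (T r x).
Proof. by case: hT => _ _ + _ s0 r0; apply; rewrite /= in_itv /= andbT. Qed.

Lemma sg_cont (s : R) x (e : R) : 0 <= s -> carrier E x -> 0 < e -> exists2 d : R, 0 < d &
  forall r : R, 0 <= r -> `|r - s| < d -> nrm E (T r x - T s x) < e.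
Proof.
move=> s0 Ex e0; case: hT => _ _ _ /(_ s x (ray_mem s0) Ex)/cvg0_within/(_ e e0)[d d0 hd]; exists d => // r r0 rs.
have := hd r (ray_mem r0) rs.
by rewrite ger0_norm // nrm_ge0 //; apply: nsB => //; exact: sg_carrier.
Qed.

Lemma sgB s x y : 0 <= s -> carrier E x -> carrier E y ->
  T s (x - y) = T s x - T s y.
Proof. by move=> s0; apply: linear_onB; exact: sg_linear. Qed.

Lemma sgZ s a x : 0 <= s -> carrier E x -> T s (a *: x) = a *: T s x.
Proof.
move=> s0 Ex; have T0 : T s 0 = 0.
  by rewrite -{1}(subrr 0) sgB ?subrr //; exact: ns0.
have := sg_linear s0 a Ex (ns0 hE).
by rewrite T0 !addr0.
Qed.

(** The difference quotient multiplied out, which is the form used in all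
    estimates. *)
Lemma generatesP (B : operator X) (x z : X) : generates `[0, +oo[ E B T ->
  (dom B x /\ B x = z) <->
  [/\ carrier E x, carrier E z & forall e : R, 0 < e -> exists2 d : R, 0 < d &
    forall h : R, 0 < h -> h < d -> nrm E (T h x - x - h%:C *: z) <= e * h].
Proof.
move=> [_ gen]; rewrite gen; split=> -[Ex Ez H]; split => //.
- move=> e e0; have /cvg0_dnbhs/(_ e e0)[d d0 hd] := H; exists d => // h h0 hd'.
  have := hd h; rewrite /= in_itv /= andbT subr0 gtr0_norm // gt_eqF //.
  move=> /(_ (ltW h0) isT hd').
  have Eu : carrier E (T h x - x) by apply: nsB => //; apply: sg_carrier => //; exact: ltW.
  rewrite nrm_quotient ?gt_eqF // (gtr0_norm h0) ger0_norm.
    by rewrite mulrC ltr_pdivrMr // => /ltW.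
  apply: mulr_ge0; first by rewrite invr_ge0 ltW.
  by apply: nrm_ge0 => //; apply: nsB => //; exact: nsZ.
- apply/cvg0_dnbhs => e e0; have [|d d0 hd] := H (e / 2); first by lra.
  exists d => // h; rewrite /= in_itv /= andbT subr0 => hge0 hn0 hd'.
  have h0 : 0 < h by rewrite lt_neqAle eq_sym hn0.
  have Eu : carrier E (T h x - x) by apply: nsB => //; exact: sg_carrier.
  rewrite gtr0_norm // in hd'; have := hd h h0 hd'.
  rewrite nrm_quotient ?gt_eqF // (gtr0_norm h0) ger0_norm.
    by move=> hle; rewrite mulrC ltr_pdivrMr // (le_lt_trans hle) // ltr_pM2r //; lra.
  apply: mulr_ge0; first by rewrite invr_ge0 ltW.
  by apply: nrm_ge0 => //; apply: nsB => //; exact: nsZ.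
Qed.

Variable w : R.
Hypothesis growth : forall (s : R) y, 0 <= s -> carrier E y ->
  nrm E (T s y) <= expR (w * s) * nrm E y.

Let N := nrm E.

Lemma growth_abs (s : R) y (b : R) : 0 <= s -> s <= b -> carrier E y ->
  N (T s y) <= expR (`|w| * b) * N y.
Proof.
move=> s0 sb Ey; apply: (le_trans (growth s0 Ey)).
apply: ler_wpM2r; first exact: nrm_ge0.
rewrite ler_expR (@le_trans _ _ (`|w| * s)) //.
  by apply: ler_wpM2r => //; exact: ler_norm.
by apply: ler_wpM2l.
Qed.

Let half : R[i] := (2^-1 : R)%:C.

(** The mean of T r v over the multiples r of h / 2^n in [0, h), factored as the
    product of the operators (1 + T (h / 2^i)) / 2 for i = 1, ..., n. The
    factorization replaces Riemann sums: compositions, bounds and telescoping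
    all become inductions on n. *)
Fixpoint dyadic_mean (n : nat) (h : R) (v : X) : X :=
  if n is n'.+1 then
    half *: (dyadic_mean n' (h / 2) v + T (h / 2) (dyadic_mean n' (h / 2) v))
  else v.

Lemma dm_carrier n (h : R) v : 0 <= h -> carrier E v -> carrier E (dyadic_mean n h v).
Proof.
elim: n h => //= n IH h h0 Ev; have h20 : 0 <= h / 2 by lra.
by apply: nsZ => //; apply: nsD => //; [exact: IH | apply: sg_carrier => //; exact: IH].
Qed.

Lemma dm_linear n h : 0 <= h -> linear_on E (dyadic_mean n h).
Proof.
elim: n h => //= n IH h h0 a x y Ex Ey; have h20 : 0 <= h / 2 by lra.
rewrite IH // sg_linear //; [|exact: dm_carrier|exact: dm_carrier].
by rewrite addrACA -(scalerDr a) (scalerDr half) !scalerA [a * half]mulrC.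
Qed.

Lemma nrm_half x y : carrier E x -> carrier E y ->
  N (half *: (x + y)) <= 2^-1 * (N x + N y).
Proof.
move=> Ex Ey; rewrite /N nrmZ //; last exact: nsD.
by rewrite ger0_norm //; apply: ler_wpM2l => //; exact: nrmD.
Qed.

Lemma dm_bound n (h : R) v : 0 <= h -> carrier E v ->
  N (dyadic_mean n h v) <= expR (`|w| * h) * N v.
Proof.
elim: n h => [|n IH] h h0 Ev /=.
  rewrite -[leLHS]mul1r; apply: ler_wpM2r; first exact: nrm_ge0.
  by rewrite -expR0 ler_expR mulr_ge0.
have h20 : 0 <= h / 2 by lra.
have Em := dm_carrier n h20 Ev.
apply: (le_trans (nrm_half Em (sg_carrier h20 Em))).
have h1 := growth_abs h20 (lexx _) Em; have h2 := IH _ h20 Ev.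
set q := expR (`|w| * (h / 2)) in h1 h2.
have q1 : 1 <= q by rewrite /q -[leLHS]expR0 ler_expR mulr_ge0.
have -> : expR (`|w| * h) = q * q by rewrite /q -expRD -mulrDr -splitr.
set m := N (dyadic_mean n (h / 2) v) in h1 h2 *.
have : q * m <= q * (q * N v) by apply: ler_wpM2l h2; lra.
have m0 : 0 <= m by exact: nrm_ge0.
have : 1 * m <= q * m by exact: ler_wpM2r.
rewrite -mulrA; lra.
Qed.

(** A mean of values T s v that are all within e of v. *)
Lemma dm_osc n (h r b e : R) v : 0 <= h -> 0 <= r -> r + h <= b -> carrier E v ->
  (forall s : R, 0 <= s <= b -> N (T s v - v) <= e) ->
  N (T r (dyadic_mean n h v) - v) <= e.
Proof.
elim: n h r => [|n IH] h r h0 r0 rh Ev osc /=; first by apply: osc; lra.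
have h20 : 0 <= h / 2 by lra.
have Em := dm_carrier n h20 Ev.
rewrite sgZ //; last by apply: nsD => //; exact: sg_carrier.
have -> : T r (dyadic_mean n (h / 2) v + T (h / 2) (dyadic_mean n (h / 2) v)) =
    T r (dyadic_mean n (h / 2) v) + T (r + h / 2) (dyadic_mean n (h / 2) v).
  rewrite sgD // -[X in X + T _ _]scale1r sg_linear ?scale1r //.
  exact: sg_carrier.
have r1 : r + h / 2 <= b by lra.
have r2 : r + h / 2 + h / 2 <= b by lra.
have r3 : 0 <= r + h / 2 by lra.
have h1 := IH _ _ h20 r0 r1 Ev osc; have h2 := IH _ _ h20 r3 r2 Ev osc.
rewrite -[X in _ - X](scale_half v) -scalerBr opprD addrACA.
have Er s : 0 <= s -> carrier E (T s (dyadic_mean n (h / 2) v) - v).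
  by move=> s0; apply: nsB => //; exact: sg_carrier.
by apply: (le_trans (nrm_half (Er _ r0) (Er _ r3))); lra.
Qed.

Lemma dm_comp n m h v : 0 <= h -> carrier E v ->
  dyadic_mean (n + m) h v = dyadic_mean n h (dyadic_mean m (h / 2 ^+ n) v).
Proof.
elim: n h => [|n IH] h h0 Ev /=; first by rewrite expr0 divr1.
have h20 : 0 <= h / 2 by lra.
by rewrite IH // exprS invfM mulrA.
Qed.

Hypothesis bE : is_banach E.

Lemma pow2_small (h e : R) : 0 < e -> 0 <= h ->
  exists n0, forall n, (n0 <= n)%N -> h / 2 ^+ n < e.
Proof.
move=> e0 h0; have [|n0 hn0] := @seq_small R (e / (h + 1)).
  by apply: divr_gt0 => //; lra.
exists n0 => n /hn0; rewrite ltr_pdivlMr; last by lra.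
apply: le_lt_trans; rewrite mulrC.
apply: ler_pM; [by rewrite invr_ge0 exprn_ge0|by []| |by lra].
by rewrite lef_pV2 ?posrE ?exprn_gt0 // -natrX ler_nat ltn_expl.
Qed.

Lemma osc_small v (e : R) : carrier E v -> 0 < e -> exists2 b : R, 0 < b &
  forall s : R, 0 <= s <= b -> N (T s v - v) <= e.
Proof.
move=> Ev e0; have [d d0 hd] := sg_cont (lexx 0) Ev e0.
exists (d / 2) => [|s /andP[s0 sd]]; first by lra.
have := hd s s0; rewrite subr0 (sg0 Ev) ger0_norm // => h.
by apply: ltW; apply: h; lra.
Qed.

(** Here m h plays the role of h^-1 times the integral of T r v over [0, h]. *)
Lemma mean_exists v : carrier E v -> exists m : R -> X, forall h : R, 0 <= h ->
  [/\ carrier E (m h),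
      m h = half *: (m (h / 2) + T (h / 2) (m (h / 2))) &
      forall b e, h <= b -> (forall s : R, 0 <= s <= b -> N (T s v - v) <= e) ->
        N (m h - v) <= e].
Proof.
move=> Ev.
have ex h : exists m, 0 <= h -> carrier E m /\
    forall e : R, 0 < e -> exists n0, forall n, (n0 <= n)%N ->
      N (dyadic_mean n h v - m) < e.
  have [h0|hn] := leP 0 h; last by exists 0.
  have Em n : carrier E (dyadic_mean n h v) by exact: dm_carrier.
  have [|m [Em' /cvg0_seq hm]] := (proj2 bE) _ Em; last first.
    exists m => _; split => // e e0; apply: hm => // n.
    by apply: nrm_ge0 => //; exact: nsB.
  move=> e e0.
  set q := expR (`|w| * h); have q0 : 0 < q by exact: expR_gt0.
  have e40 : 0 < e / 4 / q by apply: divr_gt0 => //; lra.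
  have [b b0 osc] := osc_small Ev e40.
  have [n0 hn0] := pow2_small b0 h0.
  have near n : (n0 <= n)%N ->
      N (dyadic_mean n h v - dyadic_mean n0 h v) <= e / 4.
    move=> n0n; rewrite -(subnKC n0n) dm_comp //.
    have hd0 : 0 <= h / 2 ^+ n0 by apply: divr_ge0 => //; exact: exprn_ge0.
    rewrite -(linear_onB (dm_linear n0 h0)) //; last exact: dm_carrier.
    apply: (le_trans (dm_bound _ h0 (nsB hE (dm_carrier _ hd0 Ev) Ev))).
    rewrite -/q mulrC -ler_pdivlMr //.
    have := @dm_osc (n - n0)%N (h / 2 ^+ n0) 0 b _ v hd0 (lexx 0) _ Ev osc.
    rewrite sg0; last exact: dm_carrier.
    by apply; rewrite add0r ltW // hn0.
  exists n0 => m n /near hm /near hn.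
  have := nrm_tri hE (Em m) (Em n0) (Em n).
  by rewrite (nrmC hE (Em n0) (Em n)) -/N; lra.
have [m hm] := choice ex.
exists m => h h0; have h20 : 0 <= h / 2 by lra.
have [Em cm] := hm h h0; have [Em2 cm2] := hm _ h20.
have ET := sg_carrier h20 Em2.
split => //.
- apply: (nrm_eq hE) => //; first by apply: nsZ => //; exact: nsD.
  move=> e e0; set q := expR (`|w| * (h / 2)); have q0 : 0 < q by exact: expR_gt0.
  have e40 : 0 < e / 2 by lra.
  have e4q : 0 < e / (1 + q) by apply: divr_gt0 => //; lra.
  have [n1 hn1] := cm _ e40; have [n2 hn2] := cm2 _ e4q.
  pose n := maxn n1 n2.
  have h1 := hn1 n.+1 (leqW (leq_maxl _ _)).
  have := hn2 n (leq_maxr _ _); rewrite ltr_pdivlMr; last by lra.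
  have Ed := dm_carrier n h20 Ev.
  have h3 := growth_abs h20 (lexx _) (nsB hE Ed Em2).
  rewrite sgB // -/q in h3.
  have h4 := nrm_half (nsB hE Ed Em2) (nsB hE (sg_carrier h20 Ed) ET).
  rewrite addrACA -opprD scalerBr in h4.
  have Em1 := dm_carrier n.+1 h0 Ev.
  have Eh : carrier E (half *: (m (h / 2) + T (h / 2) (m (h / 2)))).
    by apply: nsZ => //; exact: nsD.
  have := nrm_tri hE Em Em1 Eh; rewrite (nrmC hE Em Em1) -/N.
  move: h1 h4; rewrite -/dyadic_mean /= -/N; lra.
- move=> b e hb osc; apply/ler_addgt0Pr => e' e'0.
  have [n0 hn0] := cm _ e'0; have h1 := hn0 n0 (leqnn _).
  have Ed := dm_carrier n0 h0 Ev.
  have := @dm_osc n0 h 0 b e v h0 (lexx 0) _ Ev osc.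
  rewrite add0r sg0 // => /(_ hb) h2.
  by have := nrm_tri hE Em Ed Ev; rewrite (nrmC hE Em Ed) -/N; lra.
Qed.

(** The means m h lie in the domain, with B (m h) = (T h v - v) / h. The
    dyadic structure gives the derivative only along h / 2^n, which suffices for
    the mean value inequality, and that gives the full derivative. *)
Lemma generator_dense (B : operator X) v (e : R) : generates `[0, +oo[ E B T ->
  carrier E v -> 0 < e -> exists2 y, dom B y & carrier E y /\ N (y - v) <= e.
Proof.
move=> gen Ev e0; have [m hm] := mean_exists Ev.
have [h h0 osc] := osc_small Ev e0.
have hge0 := ltW h0.
have [Em _ /(_ h e (lexx _) osc) mv] := hm h hge0.
have ETv := sg_carrier hge0 Ev.
pose z := h^-1%:C *: (T h v - v).
have Ez : carrier E z by apply: nsZ => //; exact: nsB.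
have dy n : 0 < h / 2 ^+ n by apply: divr_gt0 => //; exact: exprn_gt0.
(* Each dyadic factor turns the increment over h / 2^n.+1 into half of the
   increment over h / 2^n, so the increment over h / 2^n is 2^-n times the
   one over h, taken at a mean close to v. *)
have tele n g : 0 <= g -> T (g / 2 ^+ n) (m g) - m g =
    (2 ^- n : R)%:C *: (T g (m (g / 2 ^+ n)) - m (g / 2 ^+ n)).
  elim: n g => [|n IH] g g0.
    by rewrite expr0 invr1 mulr1 rmorph1 scale1r.
  have g20 : 0 <= g / 2 by lra.
  have g2n : 0 <= g / 2 / 2 ^+ n by apply: divr_ge0 => //; exact: exprn_ge0.
  have -> : g / 2 ^+ n.+1 = g / 2 / 2 ^+ n by rewrite exprS invfM mulrA.
  have [Eg mg _] := hm g g0; have [Eg2 _ _] := hm _ g20; have [Eg2n _ _] := hm _ g2n.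
  set a := m (g / 2 / 2 ^+ n) in IH Eg2n *; set r := g / 2 / 2 ^+ n.
  have lin s u : 0 <= s -> carrier E u ->
      T s (half *: (u + T (g / 2) u)) = half *: (T s u + T (g / 2) (T s u)).
    move=> s0 Eu; rewrite sgZ //; last by apply: nsD => //; exact: sg_carrier.
    congr (_ *: _); rewrite -[X in X + T _ u]scale1r sg_linear //; last exact: sg_carrier.
    by rewrite scale1r -!sgD // [s + _]addrC.
  have ETr : carrier E (T r (m (g / 2))) by exact: sg_carrier.
  rewrite {1}mg lin // {1}mg -scalerBr opprD addrACA -sgB // IH //.
  rewrite sgZ //; last by apply: nsB => //; exact: sg_carrier.
  rewrite -scalerDr scalerA /half -rmorphM -invfM -exprS; congr (_ *: _).
  have ETa := sg_carrier g20 Eg2n.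
  rewrite sgB // -sgD // -splitr.
  by rewrite addrC addrA subrK.
suff [Dm _] : dom B (m h) /\ B (m h) = z by exists (m h).
apply/(generatesP _ _ gen).
split => // e1 e10.
have [d d0 osc2] := osc_small Ez (ltac:(lra) : 0 < e1 / 2).
exists d => // r r0 rd.
have Eo s : 0 <= s -> carrier E (T s (m h) - s%:C *: z).
  by move=> s0; apply: nsB; [|exact: sg_carrier|exact: nsZ].
have := @mean_value_ineq R X E (fun s => T s (m h) - s%:C *: z) 0 r (e1 / 2) hE (ltW r0) _ _ _ _.
rewrite sg0 // scale0r subr0 subr0 addrAC => MV.
apply: (le_trans (MV _ _ _ _)); [by lra| | | |by nra].
- by move=> s /andP[s0 _]; exact: Eo.
- move=> t /andP[t0 tr] e2 e20.
  have [d2 d20 hd2] := sg_cont t0 Em (ltac:(lra) : 0 < e2 / 2).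
  have Nz : 0 <= N z by exact: nrm_ge0.
  exists (Num.min d2 (e2 / 2 / (N z + 1))) => [|s /andP[s0 st]].
    by rewrite lt_min d20 /=; apply: divr_gt0; lra.
  rewrite lt_min => /andP[ts1]; rewrite ltr_pdivlMr; last by lra.
  move=> ts2.
  have h1 : nrm E (T s (m h) - T t (m h)) < e2 / 2.
    by apply: hd2 => //; rewrite distrC ger0_norm //; lra.
  rewrite subrBB -scalerBl -rmorphB.
  apply: (le_lt_trans (nrmD hE _ _)); first by apply: nsB => //; apply: sg_carrier => //; lra.
    exact: nsZ.
  rewrite nrmZ // ger0_norm; last by lra.
  by rewrite -/N in h1 *; rewrite mulrDr mulr1 in ts2; lra.
- move=> t /andP[t0 tr] h1 h10.
  set qh := expR (`|w| * h); have qh0 : 0 < qh by exact: expR_gt0.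
  set qt := expR (`|w| * t); have qt0 : 0 < qt by exact: expR_gt0.
  have e30 : 0 < h1 * h / (qt * (qh + 1)).
    by apply: divr_gt0; apply: mulr_gt0 => //; lra.
  have [b b0 oscb] := osc_small Ev e30.
  have [n1 hn1] := pow2_small b0 hge0.
  have [|n2 hn2] := @pow2_small h (r - t) _ hge0; first by lra.
  pose n := maxn n1 n2; have hb := hn1 n (leq_maxl _ _).
  have hrt := hn2 n (leq_maxr _ _).
  have hn0 := dy n; set k := h / 2 ^+ n in hn0 hb hrt.
  have [Emk _ /(_ b _ (ltW hb) oscb) mkv] := hm k (ltW hn0).
  exists (t + k); first by lra.
  set u := m k - v in mkv.
  have Eu : carrier E u by exact: nsB.
  have ETu : carrier E (T h u) by exact: sg_carrier.
  have e_inc : T k (m h) - m h - k%:C *: z = (2 ^- n : R)%:C *: (T h u - u).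
    rewrite tele // /z -/k scalerA -rmorphM {2}/k mulrAC mulfV ?gt_eqF // mul1r.
    by rewrite -scalerBr /u sgB // [in LHS]subrBB opprB.
  rewrite sgD //; last exact: ltW.
  have -> : T t (T k (m h)) - (t + k)%:C *: z - (T t (m h) - t%:C *: z) =
      T t (T k (m h) - m h - k%:C *: z) + k%:C *: (T t z - z).
    have ETk : carrier E (T k (m h)) by apply: sg_carrier => //; exact: ltW.
    rewrite sgB //; [|exact: nsB|exact: nsZ].
    rewrite sgB // sgZ // subrBB -scalerBl -rmorphB opprD addNKr rmorphN scaleNr.
    by rewrite scalerBr addrA subrK.
  have Ei : carrier E (T h u - u) by exact: nsB.
  rewrite e_inc; apply: (le_trans (nrmD hE _ _)).
  + by apply: sg_carrier => //; exact: nsZ.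
  + by apply: nsZ => //; apply: nsB => //; exact: sg_carrier.
  have p0 : 0 < (2 ^- n : R) by rewrite invr_gt0 exprn_gt0.
  have g1 := growth_abs t0 (lexx t) (nsZ hE (2 ^- n : R)%:C Ei).
  have g2 := nrmB hE ETu Eu; have g3 := growth_abs hge0 (lexx h) Eu.
  rewrite -/qt /N nrmZ // (gtr0_norm p0) -/N in g1.
  rewrite -/qh in g3.
  rewrite (nrmZ hE k); last by apply: nsB => //; exact: sg_carrier.
  rewrite (gtr0_norm hn0) -/N.
  have g4 : N (T t z - z) <= e1 / 2 by apply: osc2; rewrite t0 /=; lra.
  have g5 : k * N (T t z - z) <= k * (e1 / 2) by rewrite ler_pM2l.
  have g6 : qt * ((qh + 1) * N u) <= h1 * h.
    by rewrite mulrA mulrC -ler_pdivlMr // mulr_gt0 //; lra.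
  have g7 : qt * (2 ^- n * N (T h u - u)) <= 2 ^- n * (h1 * h).
    rewrite mulrCA ler_pM2l //; apply: le_trans g6; rewrite ler_pM2l //.
    by rewrite -/N in g2; lra.
  have -> : (e1 / 2 + h1) * (t + k - t) = k * (e1 / 2) + 2 ^- n * (h1 * h).
    by have -> : t + k - t = k; [ring | rewrite /k; ring].
  by rewrite addrC; apply: lerD => //; exact: le_trans g7.
Qed.

End Rep.
End Semigroups.

(** * Propagators and their comparison *)

Section Propagators.
Context {R : realType} {X : normedModType R[i]}.
Local Notation nX := (nrm (whole X)).
Let hX := @whole_normed R X.

Lemma nX_ge0 (x : X) : 0 <= nX x.
Proof. exact: (nrm_ge0 hX). Qed.

Lemma nX_tri (y x z : X) : nX (x - z) <= nX (x - y) + nX (y - z).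
Proof. exact: (nrm_tri hX). Qed.

Lemma nXC (x y : X) : nX (x - y) = nX (y - x).
Proof. exact: (nrmC hX). Qed.

Lemma nXD (x y : X) : nX (x + y) <= nX x + nX y.
Proof. exact: (nrmD hX). Qed.

Lemma nXZ (r : R) (x : X) : nX (r%:C *: x) = `|r| * nX x.
Proof. exact: (nrmZ hX). Qed.

Lemma nX0 : nX 0 = 0.
Proof. exact: (nrm0 hX). Qed.

Lemma nX_eq (x y : X) : (forall e : R, 0 < e -> nX (x - y) <= e) -> x = y.
Proof. exact: (nrm_eq hX). Qed.

Lemma dense_nX (D : set X) : dense D -> forall x e, 0 < e ->
  exists2 y, D y & nX (y - x) < e.
Proof.
move=> dD x e e0; have := dD (ball x e%:C).
case=> [||y [/= + Dy]].
- by exists x; apply: ballxx; rewrite ltcR.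
- by apply: ball_open; rewrite ltcR.
- by rewrite -ball_normE /= normX_real ltcR nXC => h; exists y.
Qed.

Variable Y : set X.

(** A two-parameter evolution P t s on [0, 1] whose right derivative on the
    diagonal is known on Y only. Step products, their limit and single
    semigroups are all of this kind, so that one comparison lemma serves for
    all of them. Lipschitz bounds stand for linearity and boundedness. *)
Record propagator (K : R) (P : R -> R -> X -> X) (G : R -> X -> X) : Prop := {
  prop_id : forall (t : R) x, 0 <= t <= 1 -> P t t x = x;
  prop_comp : forall (r s t : R) x, 0 <= r -> r <= s -> s <= t -> t <= 1 ->
    P t s (P s r x) = P t r x;
  prop_lip : forall (s t : R) x y, 0 <= s -> s <= t -> t <= 1 ->
    nX (P t s x - P t s y) <= K * nX (x - y);
  prop_left : forall (t : R) x (e : R), 0 <= t <= 1 -> 0 < e -> exists2 d : R, 0 < d &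
    forall s : R, 0 <= s <= t -> t - s < d -> nX (P t s x - x) < e;
  prop_right : forall (s : R) y (e : R), 0 <= s < 1 -> Y y -> 0 < e -> exists2 d : R, 0 < d &
    forall h : R, 0 < h -> h < d -> s + h <= 1 ->
      nX (P (s + h) s y - y - h%:C *: G s y) <= e * h }.

(** The function r |-> P T r (v r) has increments
    P T (r + h) (v (r + h) - P (r + h) r (v r)), which to first order are
    K h times the defect of v as a solution. *)
Lemma propagator_compare (K : R) P G (v g : R -> X) (a b T e : R) :
  propagator K P G -> 0 <= K -> 0 <= a -> a <= b -> b <= T -> T <= 1 -> 0 <= e ->
  (forall t : R, a <= t < b -> Y (v t)) ->
  (forall t : R, a <= t <= b -> forall e : R, 0 < e -> exists2 d : R, 0 < d &
    forall r : R, a <= r <= t -> t - r < d -> nX (v r - v t) < e) ->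
  (forall t : R, a <= t < b -> forall e : R, 0 < e -> exists2 d : R, 0 < d &
    forall h : R, 0 < h -> h < d -> t + h <= b ->
      nX (v (t + h) - v t - h%:C *: g t) <= e * h) ->
  (forall t : R, a <= t < b -> nX (G t (v t) - g t) <= e) ->
  nX (P T b (v b) - P T a (v a)) <= K * e * (b - a).
Proof.
move=> hP K0 a0 ab bT T1 e0 Yv cv dv Gg.
apply: (@mean_value_ineq _ _ (whole X) (fun r => P T r (v r))) => //.
- exact: mulr_ge0.
- move=> t /andP[at_ tb] e1 e10.
  have KK : 0 <= K * K by exact: mulr_ge0.
  have e20 : 0 < e1 / (K * K + K + 1) by apply: divr_gt0 => //; lra.
  have t01 : 0 <= t <= 1 by apply/andP; split; lra.
  have [d1 d10 hd1] := cv t (ltac:(by rewrite at_)) _ e20.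
  have [d2 d20 hd2] := prop_left hP (v t) t01 e20.
  exists (Num.min d1 d2) => [|r /andP[ar rt]]; first by rewrite lt_min d10.
  rewrite lt_min => /andP[rd1 rd2].
  rewrite -(prop_comp hP (s := t)) //; [|lra|lra].
  have h1 := prop_lip hP (P t r (v r)) (v t) (ltac:(lra) : 0 <= t) (ltac:(lra) : t <= T) T1.
  apply: (le_lt_trans h1).
  have h2 := nX_tri (P t r (v t)) (P t r (v r)) (v t).
  have h3 := prop_lip hP (v r) (v t) (ltac:(lra) : 0 <= r) rt (ltac:(lra) : t <= 1).
  have h4 : nX (v r - v t) < e1 / (K * K + K + 1) by apply: hd1 => //; rewrite ar.
  have h5 : nX (P t r (v t) - v t) < e1 / (K * K + K + 1).
    by apply: hd2 => //; rewrite rt andbT; lra.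
  set f := e1 / _ in e20 h4 h5 *.
  have -> : e1 = K * (K * f) + K * f + f by rewrite /f; field; rewrite gt_eqF //; lra.
  have h6 : K * nX (v r - v t) <= K * f by apply: ler_wpM2l => //; exact: ltW.
  have : K * nX (P t r (v r) - v t) <= K * (K * f + f).
    by apply: ler_wpM2l => //; lra.
  rewrite mulrDr; lra.
- move=> t /andP[at_ tb] h1 h10.
  have e20 : 0 < h1 / (2 * (K + 1)) by apply: divr_gt0 => //; lra.
  have t01 : 0 <= t < 1 by apply/andP; split; lra.
  have atb : a <= t < b by rewrite at_.
  have [d1 d10 hd1] := dv t atb _ e20.
  have [d2 d20 hd2] := prop_right hP t01 (Yv t atb) e20.
  pose h := Num.min (b - t) (Num.min (d1 / 2) (d2 / 2)).
  have h0 : 0 < h by rewrite /h !lt_min; apply/and3P; split; lra.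
  have [hb [hh1 hh2]] : h <= b - t /\ h <= d1 / 2 /\ h <= d2 / 2.
    by rewrite /h !ge_min !lexx !orbT.
  exists (t + h); first by rewrite ltrDl h0 -lerBrDl.
  have t0 : 0 <= t by exact: le_trans a0 at_.
  have tth : t <= t + h by rewrite lerDl ltW.
  have thb : t + h <= b by rewrite -lerBrDl.
  have thT : t + h <= T by exact: le_trans thb bT.
  have th0 : 0 <= t + h by exact: le_trans t0 tth.
  rewrite -(prop_comp hP _ t0 tth thT T1).
  apply: (le_trans (prop_lip hP _ _ th0 thT T1)).
  have h1d : h < d1 by move: hh1 d10; lra_goal.
  have h2d : h < d2 by move: hh2 d20; lra_goal.
  have g1 := hd1 h h0 h1d thb.
  have g2 := hd2 h h0 h2d (le_trans thT T1).
  have g3 := Gg t atb.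
  have g4 := nX_tri (v t + h%:C *: g t) (v (t + h)) (P (t + h) t (v t)).
  have g5 := nX_tri (v t + h%:C *: G t (v t)) (v t + h%:C *: g t) (P (t + h) t (v t)).
  rewrite opprD addrA in g4.
  rewrite [X in _ <= _ + X]nXC opprD !addrA in g5.
  have g6 : nX (v t + h%:C *: g t - v t - h%:C *: G t (v t)) <= h * e.
    rewrite [v t + _]addrC addrK -scalerBr nXZ gtr0_norm //.
    by rewrite nXC ler_pM2l.
  rewrite [t + h - t]addrC addKr.
  set f := h1 / _ in e20 g1 g2.
  have g7 : K * nX (v (t + h) - P (t + h) t (v t)) <= K * (2 * (f * h) + h * e).
    by apply: ler_wpM2l => //; move: g1 g2 g4 g5 g6; lra_goal.
  apply: (le_trans g7).
  have K1 : K + 1 != 0 by rewrite gt_eqF // ltr_wpDl.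
  have -> : h1 = 2 * (K * f) + 2 * f by rewrite /f; field.
  have : 0 < f * h by exact: mulr_gt0.
  by rewrite !mulrDr !mulrDl; lra_goal.
Qed.

Lemma propagator_lipschitz (K : R) P G y (s t e : R) :
  propagator K P G -> 0 <= K -> 0 <= s -> s <= t -> t <= 1 -> Y y -> 0 <= e ->
  (forall r : R, s <= r < t -> nX (G r y) <= e) ->
  nX (P t s y - y) <= K * e * (t - s).
Proof.
move=> hP K0 s0 st t1 Yy e0 hG.
have t01 : 0 <= t <= 1 by rewrite t1 andbT; lra.
rewrite -{2}(prop_id hP y t01) nXC.
apply: (propagator_compare (v := fun=> y) (g := fun=> 0) hP) => //.
- by move=> r _ e1 e10; exists 1 => // r' _ _; rewrite subrr nX0.
- move=> r _ e1 e10; exists 1 => // h h0 _ _.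
  by rewrite subrr scaler0 subr0 nX0 mulr_ge0 // ltW.
- by move=> r hr; rewrite subr0; exact: hG.
Qed.

Lemma semigroup_propagator K (B : operator X) T :
  generates `[0, +oo[ (whole X) B T -> Y `<=` dom B ->
  (forall (s : R) x, 0 <= s <= 1 -> nX (T s x) <= K * nX x) ->
  propagator K (fun t s => T (t - s)) (fun=> B).
Proof.
move=> gen YB TK; have [hT _] := gen; split.
- by move=> t x _; rewrite subrr (sg0 hT).
- move=> r s t x r0 rs st t1; rewrite -(sgD hT) ?subr_ge0 //.
  by congr (T _ x); lra.
- move=> s t x y s0 st t1; rewrite -(sgB hT) ?subr_ge0 //.
  by apply: TK; lra.
- move=> t x e _ e0; have [d d0 hd] := sg_cont hX hT (lexx 0) (I : carrier (whole X) x) e0.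
  exists d => // s /andP[s0 st] tsd.
  rewrite -{2}(sg0 hT (I : carrier (whole X) x)); apply: hd; first by lra.
  by rewrite subr0 ger0_norm //; lra.
- move=> s y e _ /YB By e0.
  have [_ _ /(_ e e0)[d d0 hd]] := proj1 (generatesP hX hT y (B y) gen) (conj By erefl).
  exists d => // h h0 hd' _; rewrite [s + h]addrC addrK.
  exact: hd.
Qed.

End Propagators.

(** * Restricted and opposite semigroups *)

Section PartSemigroup.
Context {R : realType} {X : normedModType R[i]}.
Local Notation nX := (nrm (whole X)).
Let hX := @whole_normed R X.

(** On the domain of the part, W s y solves the equation generated by B in X, so
    it equals S s y; both sides are continuous in y, and the domain is dense. *)
Lemma part_semigroup (E : normed_subspace X) (B : operator X) (S W : R -> X -> X)
    (K CX w : R) :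
  is_banach E -> (forall y, carrier E y -> nX y <= CX * nrm E y) ->
  carrier E `<=` dom B ->
  generates `[0, +oo[ (whole X) B S -> 0 <= K ->
  (forall (s : R) x, 0 <= s <= 1 -> nX (S s x) <= K * nX x) ->
  generates `[0, +oo[ E (part B (carrier E)) W ->
  (forall (s : R) y, 0 <= s -> carrier E y -> nrm E (W s y) <= expR (w * s) * nrm E y) ->
  forall (s : R) y, 0 <= s <= 1 -> carrier E y -> W s y = S s y.
Proof.
move=> bE emb EB genS K0 SK genW growthW.
have hE : is_normed_subspace E by case: bE.
have [hW _] := genW; have [hS _] := genS.
pose C := `|CX| + 1; have C0 : 0 < C by rewrite /C; have := normr_ge0 CX; lra.
have {}emb y : carrier E y -> nX y <= C * nrm E y.
  move=> Ey; apply: (le_trans (emb y Ey)); apply: ler_wpM2r; first exact: nrm_ge0.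
  by rewrite /C; have := ler_norm CX; lra.
have onD s y : 0 <= s <= 1 -> dom (part B (carrier E)) y -> W s y = S s y.
  move=> s01 Dy; have /andP[s0 s1] := s01.
  pose z := B y.
  have [Ey Ez dy] := proj1 (generatesP hE hW y z genW) (conj Dy erefl).
  have EW t u : 0 <= t -> carrier E u -> carrier E (W t u) by move=> *; exact: sg_carrier.
  have dW t e : 0 <= t -> 0 < e -> exists2 d : R, 0 < d & forall h : R, 0 < h -> h < d ->
      nrm E (W (t + h) y - W t y - h%:C *: W t z) <= e * h.
    move=> t0 e0; set q := expR (`|w| * t); have q0 : 0 < q by exact: expR_gt0.
    have [d d0 hd] := dy (e / q) (divr_gt0 e0 q0).
    exists d => // h h0 /(hd h h0) hle.
    have hge0 := ltW h0.
    have Eu : carrier E (W h y - y) by apply: nsB => //; exact: EW.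
    rewrite (sgD hW) // -(sgB hW) //; last exact: EW.
    rewrite -(sgZ hE hW) // -(sgB hW) //; last exact: nsZ.
    apply: (le_trans (growth_abs hE growthW t0 (lexx t) (nsB hE Eu (nsZ hE _ Ez)))).
    by rewrite -/q mulrC -ler_pdivlMr // mulrAC.
  have Wdom t : 0 <= t -> dom (part B (carrier E)) (W t y) /\ B (W t y) = W t z.
    move=> t0; apply/(generatesP hE hW _ _ genW); split; [exact: EW|exact: EW|].
    move=> e e0; have [d d0 hd] := dW t e t0 e0; exists d => // h h0 hd'.
    by rewrite -(sgD hW (ltW h0) t0 Ey) [h + t]addrC; exact: hd.
  apply: nX_eq => e e0; apply: (@le_trans _ _ 0); last exact: ltW.
  have hP := semigroup_propagator genS EB SK.
  have := @propagator_compare _ _ _ _ _ _ (fun r => W r y) (fun r => W r z) 0 s s 0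
    hP K0 (lexx 0) s0 (lexx s) s1 (lexx 0) _ _ _ _.
  rewrite subrr (sg0 hS) // subr0 (sg0 hW) // mulr0 mul0r; apply.
  + by move=> t /andP[t0 _]; exact: EW.
  + move=> t /andP[t0 _] e1 e10.
    have [d d0 hd] := sg_cont hE hW t0 Ey (divr_gt0 e10 C0).
    exists d => // r /andP[r0 rt] trd.
    apply: (le_lt_trans (emb _ (nsB hE (EW r y r0 Ey) (EW t y t0 Ey)))).
    rewrite mulrC -ltr_pdivlMr //; apply: hd => //.
    by rewrite distrC ger0_norm //; lra.
  + move=> t /andP[t0 _] e1 e10.
    have [d d0 hd] := dW t (e1 / C) t0 (divr_gt0 e10 C0).
    exists d => // h h0 hd' _.
    have th0 : 0 <= t + h by lra.
    have Eu : carrier E (W (t + h) y - W t y - h%:C *: W t z).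
      by apply: nsB => //; [apply: nsB => //; exact: EW|apply: nsZ => //; exact: EW].
    apply: (le_trans (emb _ Eu)); rewrite mulrC -ler_pdivlMr // mulrAC.
    exact: hd.
  + by move=> t /andP[t0 _]; have [_ ->] := Wdom t t0; rewrite subrr nX0.
move=> s y s01 Ey; have /andP[s0 s1] := s01.
apply: nX_eq => e e0.
set q := expR (`|w| * s); have q0 : 0 < q by exact: expR_gt0.
pose f := e / (C * (q + K)).
have CqK : 0 < C * (q + K) by apply: mulr_gt0 => //; lra.
have f0 : 0 < f by exact: divr_gt0.
have [u Du [Eu uy]] := generator_dense hE hW growthW bE genW Ey f0.
have Wuy := growth_abs hE growthW s0 (lexx s) (nsB hE Eu Ey).
rewrite (sgB hW) // -/q in Wuy.
have EWB : carrier E (W s u - W s y) by apply: nsB => //; exact: sg_carrier.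
have h1 := nX_tri (W s u) (W s y) (S s y).
rewrite (nXC (W s y) (W s u)) in h1.
have h2 := emb _ EWB.
have h3 : nX (W s u - S s y) <= K * nX (u - y).
  by rewrite (onD s u s01 Du) -(sgB hS) //; exact: SK.
have h4 := emb _ (nsB hE Eu Ey).
have h5 : C * nrm E (W s u - W s y) <= C * (q * f).
  by rewrite ler_pM2l //; apply: (le_trans Wuy); rewrite ler_pM2l.
have h6 : K * nX (u - y) <= K * (C * f).
  by apply: ler_wpM2l => //; apply: (le_trans h4); rewrite ler_pM2l.
have -> : e = C * (q * f) + K * (C * f).
  by rewrite /f; field; apply/andP; split; rewrite gt_eqF //; lra.
lra.
Qed.

(** On D, which S leaves invariant, r |-> S' r (S r x) has zero right
    derivative: the first order terms B y and B' y cancel. *)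
Lemma opposite_semigroups (D : set X) (B B' : operator X) (S S' : R -> X -> X) (K : R) :
  dense D -> 0 <= K -> (forall (s : R) x, 0 <= s -> D x -> D (S s x)) ->
  generates `[0, +oo[ (whole X) B S -> generates `[0, +oo[ (whole X) B' S' ->
  (forall x, D x -> [/\ dom B x, dom B' x & B' x = - B x]) ->
  (forall (s : R) x, 0 <= s <= 1 -> nX (S s x) <= K * nX x) ->
  (forall (s : R) x, 0 <= s <= 1 -> nX (S' s x) <= K * nX x) ->
  forall (s : R) x, 0 <= s <= 1 -> S' s (S s x) = x.
Proof.
move=> denseD K0 SD genS genS' BB' SK SK'.
have [hS _] := genS; have [hS' _] := genS'.
have onD s x : 0 <= s <= 1 -> D x -> S' s (S s x) = x.
  move=> /andP[s0 s1] Dx; apply: nX_eq => e e0.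
  apply: (@le_trans _ _ 0); last exact: ltW.
  rewrite -{2}(sg0 hS (I : carrier (whole X) x)) -(sg0 hS' (I : carrier (whole X) (S 0 x))).
  rewrite -[leRHS](mul0r (s - 0)).
  apply: (@mean_value_ineq _ _ (whole X) (fun r => S' r (S r x))) => //.
  - move=> t /andP[t0 ts] e1 e10.
    have e20 : 0 < e1 / (K + 1) by apply: divr_gt0 => //; lra.
    have [d1 d10 hd1] := sg_cont hX hS t0 (I : carrier (whole X) x) e20.
    have [d2 d20 hd2] := sg_cont hX hS' t0 (I : carrier (whole X) (S t x)) e20.
    exists (Num.min d1 d2) => [|r /andP[r0 rt]]; first by rewrite lt_min d10.
    rewrite lt_min => /andP[rd1 rd2].
    have h1 : nX (S r x - S t x) < e1 / (K + 1).
      by apply: hd1 => //; rewrite distrC ger0_norm; lra.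
    have h2 : nX (S' r (S t x) - S' t (S t x)) < e1 / (K + 1).
      by apply: hd2 => //; rewrite distrC ger0_norm; lra.
    have h3 := nX_tri (S' r (S t x)) (S' r (S r x)) (S' t (S t x)).
    have h4 : nX (S' r (S r x) - S' r (S t x)) <= K * nX (S r x - S t x).
      by rewrite -(sgB hS') //; apply: SK'; lra.
    set f := e1 / (K + 1) in h1 h2.
    have -> : e1 = K * f + f by rewrite /f; field; lra.
    have : K * nX (S r x - S t x) <= K * f by apply: ler_wpM2l => //; exact: ltW.
    lra.
  - move=> t /andP[t0 ts] h1 h10; rewrite add0r.
    set y := S t x; have Dy : D y by exact: SD.
    have [By B'y eB] := BB' y Dy.
    pose q := K * (1 + K) + K + 1 + 1.
    have q0 : 0 < q by rewrite /q; have := mulr_ge0 K0 K0; lra.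
    have e20 : 0 < h1 / q by exact: divr_gt0.
    have [_ _ /(_ _ e20)[d1 d10 hd1]] :=
      proj1 (generatesP hX hS y (B y) genS) (conj By erefl).
    have [_ _ /(_ _ e20)[d2 d20 hd2]] :=
      proj1 (generatesP hX hS' y (B' y) genS') (conj B'y erefl).
    have [d3 d30 hd3] := sg_cont hX hS' (lexx 0) (I : carrier (whole X) (B y)) e20.
    pose h := Num.min (s - t) (Num.min (d1 / 2) (Num.min (d2 / 2) (d3 / 2))).
    have h0 : 0 < h by rewrite /h !lt_min; apply/and4P; split; lra.
    have [hs [hh1 [hh2 hh3]]] : h <= s - t /\ h <= d1 / 2 /\ h <= d2 / 2 /\ h <= d3 / 2.
      by rewrite /h !ge_min !lexx !orbT.
    have hge0 := ltW h0.
    exists (t + h); first by rewrite ltrDl h0 -lerBrDl.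
    have -> : S (t + h) x = S h y by rewrite addrC (sgD hS).
    rewrite (sgD hS') //.
    rewrite [t + h - t]addrC addKr.
    have g1 : nX (S h y - y - h%:C *: B y) <= h1 / q * h by apply: hd1 => //; lra.
    have g2 : nX (S' h y - y - h%:C *: B' y) <= h1 / q * h by apply: hd2 => //; lra.
    have g3 : nX (S' h (B y) - S' 0 (B y)) < h1 / q.
      by apply: hd3 => //; rewrite subr0 gtr0_norm //; lra.
    rewrite (sg0 hS') // in g3.
    set f := h1 / q in e20 g1 g2 g3.
    have h01 : 0 <= h <= 1 by rewrite hge0 /=; move: hs t0 s1; lra_goal.
    have t01 : 0 <= t <= 1 by rewrite t0 (le_trans (ltW ts)).
    rewrite -(sgB hS') //.
    apply: (le_trans (SK' t _ t01)).
    have -> : S' h (S h y) - y = S' h (S h y - y - h%:C *: B y)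
        + (S' h y - y - h%:C *: B' y) + h%:C *: (S' h (B y) - B y).
      rewrite !(sgB hS') // (sgZ hX hS') // eB scalerN opprK scalerBr.
      rewrite !addrA (ACl ((1 * 5) * (2 * 4) * (3 * 7) * (6 * 8))) /=.
      by rewrite !addNr subrr !addr0.
    have k1 := SK' h (S h y - y - h%:C *: B y) h01.
    have k2 := nXD (S' h (S h y - y - h%:C *: B y) + (S' h y - y - h%:C *: B' y))
      (h%:C *: (S' h (B y) - B y)).
    have k3 := nXD (S' h (S h y - y - h%:C *: B y)) (S' h y - y - h%:C *: B' y).
    have k4 : nX (h%:C *: (S' h (B y) - B y)) <= h * f.
      by rewrite nXZ gtr0_norm // ler_pM2l // ltW.
    have k5 : K * nX (S h y - y - h%:C *: B y) <= K * (f * h) by exact: ler_wpM2l.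
    apply: (@le_trans _ _ (K * (K * (f * h) + f * h + h * f))).
      by apply: ler_wpM2l => //; move: k1 k2 k3 k4 k5 g2; lra_goal.
    have -> : h1 = q * f by rewrite /f mulrC divfK // gt_eqF.
    have fh : 0 < f * h by exact: mulr_gt0.
    have KKf : 0 <= K * K * (f * h) by apply: mulr_ge0; [exact: mulr_ge0|exact: ltW].
    by rewrite /q; move: fh KKf (mulr_ge0 K0 (ltW fh)); lra_goal.
move=> s x s01; have /andP[s0 s1] := s01.
apply: nX_eq => e e0.
have KK := mulr_ge0 K0 K0.
have e20 : 0 < e / (K * K + 1) by apply: divr_gt0 => //; lra.
have [y Dy xy] := dense_nX denseD x e20.
have h1 := nX_tri (S' s (S s y)) (S' s (S s x)) x.
rewrite {2}(onD s y s01 Dy) -(sgB hS') // -(sgB hS) // in h1.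
have h2 := SK' s (S s (x - y)) s01; have h3 := SK s (x - y) s01.
have h4 : K * nX (S s (x - y)) <= K * (K * nX (x - y)) by exact: ler_wpM2l.
rewrite nXC in xy; set f := e / _ in xy.
have -> : e = K * (K * f) + f by rewrite /f; field; rewrite gt_eqF //; lra.
have h5 : K * (K * nX (x - y)) <= K * (K * f) by do 2 apply: ler_wpM2l => //; exact: ltW.
by rewrite (nXC y x) in h1; lra.
Qed.

End PartSemigroup.

(** * Step products *)

Section Products.
Context {R : realType} {X : normedModType R[i]}.
Local Notation nX := (nrm (whole X)).
Let hX := @whole_normed R X.

(** The one-sided data of the hyperbolic theory in the form in which they are
    used: semigroups S t on X with generators B t, stability of their ordered
    products over a total time at most 1, and norms N t on Y for which S t is
    quasicontractive. [kf_closed] is how uniform convexity enters the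
    convergence proof. *)
Record kato_family (Y : set X) (N : R -> X -> R) (B : R -> operator X)
    (S : R -> R -> X -> X) (K Bd c w0 : R) : Prop := {
  kf_K : 0 <= K;
  kf_Bd : 0 <= Bd;
  kf_c : 0 <= c;
  kf_gen : forall t : R, 0 <= t <= 1 -> generates `[0, +oo[ (whole X) (B t) (S t);
  kf_stable : forall l : seq (R * R),
    all (fun p => (0 <= p.1 <= 1) && (0 <= p.2)) l ->
    sorted <=%R (map fst l) -> \sum_(p <- l) p.2 <= 1 ->
    forall x, nX (foldl (fun y p => S p.1 p.2 y) x l) <= K * nX x;
  kf_dense : dense Y;
  kf_dom : forall t : R, 0 <= t <= 1 -> Y `<=` dom (B t);
  kf_cont : forall y, Y y -> forall t : R, 0 <= t <= 1 -> forall e : R, 0 < e ->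
    exists2 d : R, 0 < d &
      forall r : R, 0 <= r <= 1 -> `|r - t| < d -> nX (B r y - B t y) < e;
  kf_norm : forall t : R, 0 <= t <= 1 -> is_normed_subspace (NormedSubspace Y (N t));
  kf_linear : forall t : R, 0 <= t <= 1 -> linear_on Y (B t);
  kf_bounded : forall (t : R) y, 0 <= t <= 1 -> Y y -> nX (B t y) <= Bd * N t y;
  kf_lip : forall (s t : R) y, 0 <= s <= 1 -> 0 <= t <= 1 -> Y y ->
    N t y <= expR (c * `|t - s|) * N s y;
  kf_inv : forall (t h : R) y, 0 <= t <= 1 -> 0 <= h -> Y y -> Y (S t h y);
  kf_growth : forall (t h : R) y, 0 <= t <= 1 -> 0 <= h <= 1 -> Y y ->
    N t (S t h y) <= expR (w0 * h) * N t y;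
  kf_orbit : forall (t : R) y (e : R), 0 <= t <= 1 -> Y y -> 0 < e -> exists2 d : R, 0 < d &
    forall h : R, 0 <= h -> h < d -> N t (S t h y - y) < e;
  kf_closed : forall (t : R) y (C : R), 0 <= t <= 1 ->
    (forall d : R, 0 < d -> exists v, [/\ Y v, nX (v - y) < d & N t v <= C]) ->
    Y y /\ N t y <= C }.

(** Midpoints, and not end points, of the cells: this makes the step products
    compatible with time reversal. *)
Definition node (n k : nat) : R := (k%:R + 2^-1) / n%:R.

(** The time spent before t in the k-th of n equal cells of [0, 1]. *)
Definition cell (n k : nat) (t : R) : R :=
  Num.max 0 (Num.min n%:R^-1 (t - k%:R / n%:R)).

(** The factor of cell k runs for the time that [s, t] spends in this cell. Taking
    all factors, most of them trivial, avoids any case distinction on the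
    positions of s and t. *)
Definition step_product (S : R -> R -> X -> X) (n m : nat) (t s : R) : X -> X :=
  iteri m (fun k => S (node n k) (cell n k t - cell n k s)).

Section Cells.
Variables (n : nat) (n0 : (0 < n)%N).
Let dl : R := n%:R^-1.

Lemma dl_gt0 : 0 < dl. Proof. by rewrite invr_gt0 ltr0n. Qed.
Let dl0 := dl_gt0.

Lemma cell_le0 k t : t <= k%:R * dl -> cell n k t = 0.
Proof.
move=> h; apply/max_idPl; rewrite ge_min; apply/orP; right.
by rewrite subr_le0.
Qed.

Lemma cell_full k t : k.+1%:R * dl <= t -> cell n k t = dl.
Proof.
rewrite -natr1 mulrDl mul1r => h; rewrite /cell -/dl (min_idPl _); last by lra.
by apply/max_idPr; exact: ltW.
Qed.

Lemma cell_mid k t : k%:R * dl <= t -> t <= k.+1%:R * dl ->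
  cell n k t = t - k%:R * dl.
Proof.
rewrite -natr1 mulrDl mul1r => h h'; rewrite /cell -/dl (min_idPr _); last by lra.
by apply/max_idPr; lra.
Qed.

Lemma cell_bounds k t : 0 <= cell n k t <= dl.
Proof.
apply/andP; split; first by rewrite le_max lexx.
by rewrite ge_max ltW //= ge_min lexx.
Qed.

Lemma cell_mono k s t : s <= t -> cell n k s <= cell n k t.
Proof.
by move=> st; rewrite /cell ge_max le_max lexx /= le_max le_min2 ?orbT // lerD2r.
Qed.

Lemma node_bounds k : (k < n)%N -> 0 <= node n k <= 1.
Proof.
move=> kn; rewrite /node divr_ge0 ?addr_ge0 ?invr_ge0 //= ler_pdivrMr ?ltr0n //.
rewrite mul1r (@le_trans _ _ k.+1%:R) ?ler_nat // -[k.+1%:R]natr1 lerD2l; lra.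
Qed.

Lemma node_mono : {homo node n : k l / (k <= l)%N >-> k <= l}.
Proof.
by move=> k l kl; rewrite /node ler_pM2r ?invr_gt0 ?ltr0n // lerD2r ler_nat.
Qed.

Lemma cell_right m t : 0 <= t -> t < m%:R * dl ->
  exists2 k, (k < m)%N & k%:R * dl <= t < k.+1%:R * dl.
Proof.
elim: m => [|m IH] t0; first by rewrite mul0r; lra.
have [tm _|tm tm1] := ltP t (m%:R * dl); last by exists m; rewrite ?tm.
by have [k km kt] := IH t0 tm; exists k => //; exact: ltnW.
Qed.

Lemma cell_left m t : 0 < t -> t <= m%:R * dl ->
  exists2 k, (k < m)%N & k%:R * dl < t <= k.+1%:R * dl.
Proof.
elim: m => [|m IH] t0; first by rewrite mul0r; lra.
have [tm _|tm tm1] := leP t (m%:R * dl); last by exists m; rewrite ?tm.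
by have [k km kt] := IH t0 tm; exists k => //; exact: ltnW.
Qed.

Lemma ndl : n%:R * dl = 1.
Proof. by rewrite mulfV // pnatr_eq0 -lt0n. Qed.

Lemma node_near k t : k%:R * dl <= t <= k.+1%:R * dl -> `|node n k - t| <= dl.
Proof.
rewrite -natr1 mulrDl mul1r /node -/dl mulrDl => /andP[h h'].
by rewrite ler_norml; apply/andP; split; lra.
Qed.

End Cells.

Section Propagator.
Variables (Y : set X) (N : R -> X -> R) (B : R -> operator X).
Variables (S : R -> R -> X -> X) (K Bd c w0 : R).
Hypothesis kf : kato_family Y N B S K Bd c w0.
Variables (n : nat) (n0 : (0 < n)%N).
Let dl : R := n%:R^-1.
Let P := step_product S n.

Let rep k : (k < n)%N -> strongly_continuous_rep `[0, +oo[ (whole X) (S (node n k)).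
Proof. by move=> kn; case: (kf_gen kf (node_bounds n0 kn)). Qed.

Let step_productS m t s x :
  P m.+1 t s x = S (node n m) (cell n m t - cell n m s) (P m t s x).
Proof. by []. Qed.

Lemma step_product_eq m t s x :
  (forall k, (k < m)%N -> cell n k t = cell n k s) -> (m <= n)%N -> P m t s x = x.
Proof.
elim: m => [//|m IH] h mn; rewrite step_productS.
rewrite h // subrr IH; [|by move=> k km; apply: h; exact: ltnW|exact: ltnW].
exact: (sg0 (rep mn)).
Qed.

Lemma step_product_after m t s x : m%:R * dl <= s -> s <= t -> (m <= n)%N ->
  P m t s x = x.
Proof.
move=> ms st; apply: step_product_eq => k km.
have h : k.+1%:R * dl <= s.
  by apply: le_trans ms; rewrite ler_pM2r ?dl_gt0 // ler_nat.
by rewrite !cell_full //; exact: le_trans st.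
Qed.

Lemma step_product_comp m r s t x : r <= s -> s <= t -> (m <= n)%N ->
  P m t s (P m s r x) = P m t r x.
Proof.
move=> rs st; elim: m => [//|m IH] mn.
rewrite !step_productS.
(* Either s is not past the start of cell m, and then this cell contributes
   nothing on [r, s]; or it is, and then the earlier cells contribute nothing
   on [s, t]. *)
have [sm|ms] := leP s (m%:R * dl).
  rewrite (cell_le0 sm) (cell_le0 (le_trans rs sm)) !subr0 (sg0 (rep mn)) //.
  by rewrite IH // ltnW.
rewrite (step_product_after _ (ltW ms) st (ltnW mn)).
rewrite -(sgD (rep mn)) ?subr_ge0 ?cell_mono //.
rewrite -(IH (ltnW mn)) (step_product_after _ (ltW ms) st (ltnW mn)).
by congr (S _ _ _); rewrite addrA subrK.
Qed.

Lemma step_productB m t s x y : s <= t -> (m <= n)%N ->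
  P m t s (x - y) = P m t s x - P m t s y.
Proof.
move=> st; elim: m => [//|m IH] mn; rewrite !step_productS (IH (ltnW mn)).
by rewrite (sgB (rep mn)) // subr_ge0 cell_mono.
Qed.

Lemma step_productZ m t s (a : R[i]) x : s <= t -> (m <= n)%N ->
  P m t s (a *: x) = a *: P m t s x.
Proof.
move=> st; elim: m => [//|m IH] mn; rewrite !step_productS (IH (ltnW mn)).
by rewrite (sgZ hX (rep mn)) // subr_ge0 cell_mono.
Qed.

Lemma step_product_bound t s x : s <= t -> nX (P n t s x) <= K * nX x.
Proof.
move=> st.
pose g k := (node n k, cell n k t - cell n k s).
have foldP m : P m t s x = foldl (fun y p => S p.1 p.2 y) x (map g (iota 0 m)).
  elim: m => [//|m IH]; rewrite -addn1 iotaD map_cat foldl_cat /= -IH.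
  by rewrite addn1 step_productS.
rewrite foldP; apply: (kf_stable kf).
- apply/allP => p /mapP[k]; rewrite mem_iota add0n => /andP[_ kn] ->.
  by rewrite node_bounds //= subr_ge0 cell_mono.
- rewrite -map_comp; apply: (@homo_sorted _ _ _ leq) (iota_sorted 0 n).
  exact: node_mono.
- suff h m : \sum_(p <- map g (iota 0 m)) p.2 <= m%:R * dl.
    by rewrite -(ndl n0); exact: h.
  elim: m => [|m IH]; first by rewrite big_nil mul0r.
  rewrite -addn1 iotaD map_cat big_cat /= big_seq1 natrD mulrDl mul1r.
  apply: lerD => //=; have := cell_bounds n0 m t; have := cell_bounds n0 m s.
  by rewrite add0n -/dl; lra.
Qed.

Lemma step_product_single k t s x : (k < n)%N -> k%:R * dl <= s -> s <= t ->
  t <= k.+1%:R * dl -> P n t s x = S (node n k) (t - s) x.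
Proof.
move=> kn ks st tk.
have h m : (m <= n)%N -> P m t s x = if (m <= k)%N then x else S (node n k) (t - s) x.
  elim: m => [//|m IH] mn; case: (boolP (m.+1 <= k)%N) => mk.
    by apply: step_product_after => //; apply: le_trans ks; rewrite ler_pM2r ?dl_gt0 // ler_nat.
  rewrite -ltnNge in mk.
  rewrite step_productS (IH (ltnW mn)).
  move: mk; rewrite ltnS leq_eqVlt => /orP[/eqP km|km].
    subst m; rewrite leqnn !cell_mid //; try exact: le_trans ks st; try exact: le_trans st tk.
    by congr (S _ _ _); lra.
  rewrite leqNgt km /= !cell_le0 ?subrr.
  - exact: (sg0 (rep mn)).
  - apply: (le_trans st); apply: (le_trans tk); by rewrite ler_pM2r ?dl_gt0 // ler_nat.
  - by apply: (le_trans tk); rewrite ler_pM2r ?dl_gt0 // ler_nat.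
by rewrite h // leqNgt kn.
Qed.

Lemma step_product_propagator : exists phi : R -> R,
  (forall s : R, 0 <= s < 1 -> 0 <= phi s <= 1 /\ `|phi s - s| <= n%:R^-1) /\
  propagator Y K (P n) (fun s => B (phi s)).
Proof.
have ex s : exists k, 0 <= s < 1 -> (k < n)%N /\ k%:R * dl <= s < k.+1%:R * dl.
  have [s01|] := boolP (0 <= s < 1); last by exists 0%N.
  have /andP[s0 s1] := s01.
  have [|k kn ks] := @cell_right n n s s0; first by rewrite ndl.
  by exists k.
have [k hk] := choice ex.
exists (fun s => node n (k s)); split.
  move=> s /hk[kn /andP[h h']]; split; first exact: node_bounds.
  by apply: node_near; rewrite h ltW.
split.
- by move=> t x _; apply: step_product_eq.
- by move=> r s t x _ rs st _; exact: step_product_comp.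
- by move=> s t x y _ st _; rewrite -step_productB //; exact: step_product_bound.
- move=> t x e /andP[t0 t1] e0.
  move: t0; rewrite le_eqVlt => /orP[/eqP<-|t0].
    exists 1 => // s /andP[s0 s0'] _; have -> : s = 0 by lra.
    by rewrite step_product_eq // subrr nX0.
  have [|l ln /andP[lt tl]] := @cell_left n n t t0; first by rewrite ndl.
  have [d d0 hd] := sg_cont hX (rep ln) (lexx 0) (I : carrier (whole X) x) e0.
  exists (Num.min d (t - l%:R * dl)) => [|s /andP[s0 st]].
    by rewrite lt_min d0 subr_gt0.
  rewrite lt_min => /andP[sd sl].
  rewrite (step_product_single _ ln) //; last by lra.
  rewrite -{2}(sg0 (rep ln) (I : carrier (whole X) x)); apply: hd; first by lra.
  by rewrite subr0 ger0_norm; lra.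
- move=> s y e s01 Yy e0; have [kn /andP[ks sk]] := hk s s01.
  have [_ _ /(_ e e0)[d d0 hd]] := proj1 (generatesP hX (rep kn) y (B (node n (k s)) y)
    (kf_gen kf (node_bounds n0 kn))) (conj (kf_dom kf (node_bounds n0 kn) Yy) erefl).
  exists (Num.min d ((k s).+1%:R * dl - s)) => [|h h0].
    by rewrite lt_min d0 subr_gt0.
  rewrite lt_min => /andP[h1 h2] _.
  rewrite (step_product_single _ kn) //; [|lra|lra].
  by rewrite [s + h]addrC addrK; exact: hd.
Qed.

End Propagator.
End Products.

(** * Convergence of the step products *)

Section Limit.
Context {R : realType} {X : completeNormedModType R[i]}.
Local Notation nX := (nrm (whole X)).
Let hX := @whole_normed R X.
Variables (Y : set X) (N : R -> X -> R) (B : R -> operator X).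
Variables (S : R -> R -> X -> X) (K Bd c w0 : R).
Hypothesis kf : kato_family Y N B S K Bd c w0.
Let P n := step_product S n n.
Let C := c + `|w0|.
Let M := Bd * expR c.

Lemma kf_constants : [/\ 0 <= K, 0 <= C, 0 <= M & 0 <= c].
Proof.
have c0 := kf_c kf; split => //; first exact: kf_K kf.
  by rewrite /C addr_ge0.
by rewrite mulr_ge0 ?expR_ge0 //; exact: kf_Bd kf.
Qed.

Lemma ler_frac (a e : R) : 0 <= a -> 0 <= e -> a * (e / (a + 1)) <= e.
Proof.
by move=> a0 e0; rewrite mulrCA ler_piMr // ler_pdivrMr; lra.
Qed.

Lemma kf_N_ge0 (t : R) y : 0 <= t <= 1 -> Y y -> 0 <= N t y.
Proof. by move=> t01; exact: (nrm_ge0 (kf_norm kf t01)). Qed.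

Lemma kf_YB (t : R) y z : 0 <= t <= 1 -> Y y -> Y z -> Y (y - z).
Proof. by move=> t01; exact: (nsB (kf_norm kf t01)). Qed.

Lemma kf_lip1 (s t : R) y : 0 <= s <= 1 -> 0 <= t <= 1 -> Y y ->
  N t y <= expR c * N s y.
Proof.
have [_ _ _ c0] := kf_constants.
move=> s01 t01 Yy; apply: (le_trans (kf_lip kf s01 t01 Yy)).
apply: ler_wpM2r; first exact: kf_N_ge0.
rewrite ler_expR -[leRHS]mulr1; apply: ler_wpM2l => //.
by rewrite ler_norml; move: s01 t01 => /andP[? ?] /andP[? ?]; apply/andP; split; lra.
Qed.

Lemma kf_generator_bound (s t : R) y : 0 <= s <= 1 -> 0 <= t <= 1 -> Y y ->
  nX (B t y) <= M * N s y.
Proof.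
move=> s01 t01 Yy; apply: (le_trans (kf_bounded kf t01 Yy)).
by rewrite /M -mulrA; apply: ler_wpM2l; [exact: kf_Bd kf|exact: kf_lip1].
Qed.

Lemma kf_generatorB (t : R) x y : 0 <= t <= 1 -> Y x -> Y y -> B t (x - y) = B t x - B t y.
Proof. by move=> t01; apply: linear_onB; exact: kf_linear kf _ t01. Qed.

(** Comparison with a constant curve. *)
Lemma step_product_lipschitz n (s t u : R) y : (0 < n)%N -> 0 <= s -> s <= t -> t <= 1 ->
  0 <= u <= 1 -> Y y -> nX (P n t s y - y) <= K * (M * N u y) * (t - s).
Proof.
have [K0 _ M0 _] := kf_constants.
move=> n0 s0 st t1 u01 Yy.
have [phi [hphi hP]] := step_product_propagator kf n0.
apply: (propagator_lipschitz hP) => //.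
  by apply: mulr_ge0 => //; exact: kf_N_ge0.
move=> r /andP[r0 r1]; have [|p01 _] := hphi r.
  by apply/andP; split; lra.
exact: kf_generator_bound.
Qed.

(** The heart of the convergence proof: over a short time the products follow the
    semigroup frozen at t, when started at one fixed point of Y. *)
Lemma step_product_local (t : R) y (e : R) : 0 <= t < 1 -> Y y -> 0 < e ->
  exists2 h0 : R, 0 < h0 & exists n0, forall n, (n0 < n)%N -> forall h T,
    0 <= h <= h0 -> t + h <= T -> T <= 1 ->
    nX (P n T (t + h) (S t h y) - P n T t y) <= K * e * h.
Proof.
have [K0 C0 M0 c0] := kf_constants.
move=> /andP[t0 t1] Yy e0.
have t01 : 0 <= t <= 1 by rewrite t0 ltW.
have [hS _] := kf_gen kf t01.
have [d1 d10 hd1] := kf_cont kf Yy t01 (ltac:(lra) : 0 < e / 2).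
have e20 : 0 < e / 4 / (M + 1) by apply: divr_gt0; lra.
have [d2 d20 hd2] := kf_orbit kf t01 Yy e20.
exists (Num.min (d1 / 2) (d2 / 2)); first by rewrite lt_min; apply/andP; split; lra.
have [|n0 hn0] := @seq_small R (d1 / 2); first by lra.
exists n0 => -[//|n] nn h T /andP[h0]; rewrite le_min => /andP[h1 h2] thT T1.
have [phi [hphi hP]] := step_product_propagator kf (ltn0Sn n).
(* Compare the product with the orbit r |-> S t (r - t) y, which stays close to
   y in Y, so that B (phi r) and B t nearly agree on it. *)
have eh : t + h - t = h by rewrite [t + h]addrC addrK.
suff : nX (P n.+1 T (t + h) (S t (t + h - t) y) - P n.+1 T t (S t (t - t) y))
    <= K * e * (t + h - t) by rewrite eh subrr (sg0 hS).
have Yv r : t <= r -> Y (S t (r - t) y).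
  by move=> tr; apply: (kf_inv kf) => //; rewrite subr_ge0.
apply: (propagator_compare (v := fun r => S t (r - t) y)
  (g := fun r => B t (S t (r - t) y)) hP) => //.
- by rewrite lerDl.
- exact: ltW.
- by move=> r /andP[tr _]; exact: Yv.
- move=> r /andP[tr _] e1 e10.
  have rt0 : 0 <= r - t by rewrite subr_ge0.
  have [d d0 hd] := sg_cont hX hS rt0 (I : carrier (whole X) y) e10.
  exists d => // r' /andP[tr' r'r] hr'; apply: hd; first by rewrite subr_ge0.
  have -> : r' - t - (r - t) = r' - r by rewrite opprB addrA subrK.
  by rewrite distrC ger0_norm ?subr_ge0.
- move=> r /andP[tr _] e1 e10.
  have Bv := kf_dom kf t01 (Yv r tr).
  have [_ _ /(_ e1 e10)[d d0 hd]] :=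
    proj1 (generatesP hX hS _ _ (kf_gen kf t01)) (conj Bv erefl).
  exists d => // k k0 kd _.
  have -> : r + k - t = k + (r - t) by rewrite [r + k]addrC addrA.
  rewrite (sgD hS) //; [exact: hd|exact: ltW|by rewrite subr_ge0].
- move=> r /andP[tr rh].
  have [|p01 pr] := hphi r.
    by rewrite (le_trans t0 tr) /=; move: rh thT T1; lra_goal.
  set v := S t (r - t) y; have {}Yv : Y v := Yv r tr.
  have Nv : N t (v - y) < e / 4 / (M + 1).
    by apply: hd2; [rewrite subr_ge0|move: rh h2 d20; lra_goal].
  have Yvy := kf_YB t01 Yv Yy.
  have b1 := kf_generator_bound t01 p01 Yvy.
  have b2 := kf_generator_bound t01 t01 Yvy.
  have b3 : nX (B (phi r) y - B t y) < e / 2.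
    apply: hd1 => //; rewrite -(subrK r (phi r)) -addrA.
    apply: (le_lt_trans (ler_normD _ _)).
    have rt0 : 0 <= r - t by rewrite subr_ge0.
    have := le_lt_trans pr (hn0 n nn); rewrite (ger0_norm rt0).
    by move: rh h1; lra_goal.
  rewrite kf_generatorB // in b1; rewrite kf_generatorB // in b2.
  have h3 := nX_tri (B (phi r) y) (B (phi r) v) (B t v).
  have h4 := nX_tri (B t y) (B (phi r) y) (B t v).
  rewrite [X in _ <= _ + X]nXC in h4.
  have h5 : M * N t (v - y) <= M * (e / 4 / (M + 1)) by apply: ler_wpM2l => //; exact: ltW.
  have e40 : 0 <= e / 4 by move: e0; lra_goal.
  by have := ler_frac M0 e40; move: b1 b2 b3 h3 h4 h5; lra_goal.
Qed.

(** Chaining the local steps. The final time T is fixed throughout, so the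
    errors of the steps add up without being multiplied by the stability
    constant each time. *)
Lemma step_product_chain (s T : R) y0 (e : R) : 0 <= s -> s <= T -> T <= 1 -> Y y0 -> 0 < e ->
  exists y', [/\ Y y', N T y' <= expR (C * (T - s)) * N s y0 &
    forall h : R, 0 < h -> exists n0, forall n, (n0 < n)%N ->
      nX (P n T s y0 - y') <= e * (T - s) + h].
Proof.
have [K0 C0 M0 c0] := kf_constants.
move=> s0 sT T1 Yy0 e0.
have s01 : 0 <= s <= 1 by apply/andP; split; lra.
have Ns0 := kf_N_ge0 s01 Yy0.
(* The states of the chain are the times and points that satisfy the bound in
   Y; a step may move by L in X per unit of time, and may change the final value
   of the products by e per unit of time, for large n. *)
pose Z := {p : R * X | [/\ s <= p.1 <= T, Y p.2 &
  N p.1 p.2 <= expR (C * (p.1 - s)) * N s y0]}.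
pose t_ (z : Z) := (sval z).1; pose y_ (z : Z) := (sval z).2.
have tz z : s <= t_ z <= T by case: z => p [].
have Yz z : Y (y_ z) by case: z => p [].
have Nz z : N (t_ z) (y_ z) <= expR (C * (t_ z - s)) * N s y0 by case: z => p [].
have t01 z : 0 <= t_ z <= 1 by have /andP[zs zT] := tz z; rewrite (le_trans s0 zs) (le_trans zT T1).
pose Q := expR C * N s y0.
have Q0 : 0 <= Q by apply: mulr_ge0 => //; exact: expR_ge0.
have NQ z : N (t_ z) (y_ z) <= Q.
  apply: (le_trans (Nz z)); apply: ler_wpM2r => //.
  rewrite ler_expR -[leRHS]mulr1; apply: ler_wpM2l => //.
  by have /andP[? ?] := tz z; lra.
pose L := M * Q + 1.
have MQ0 : 0 <= M * Q by exact: mulr_ge0.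
pose le (p q : Z) := [/\ t_ p <= t_ q, nX (y_ q - y_ p) <= L * (t_ q - t_ p) &
  forall h : R, 0 < h -> exists n0, forall n, (n0 < n)%N ->
    nX (P n T (t_ q) (y_ q) - P n T (t_ p) (y_ p)) <= e * (t_ q - t_ p) + h].
have le_refl z : le z z.
  split; rewrite ?subrr ?mulr0 ?nX0 //.
  by move=> h h0; exists 0%N => n _; rewrite subrr nX0 add0r ltW.
have le_tr x y z : le x y -> le y z -> le x z.
  move=> [xy h1 h2] [yz g1 g2]; split; first exact: le_trans yz.
    by have := nX_tri (y_ y) (y_ z) (y_ x); move: h1 g1; lra_goal.
  move=> h h0; have h20 : 0 < h / 2 by exact: divr_gt0.
  have [n1 hn1] := h2 _ h20; have [n2 hn2] := g2 _ h20.
  exists (maxn n1 n2) => n; rewrite gtn_max => /andP[/hn1 k1 /hn2 k2].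
  have := nX_tri (P n T (t_ y) (y_ y)) (P n T (t_ z) (y_ z)) (P n T (t_ x) (y_ x)).
  by move: k1 k2; lra_goal.
have N00 : N s y0 <= expR (C * (s - s)) * N s y0.
  by rewrite subrr mulr0 expR0 mul1r.
have sz : s <= s <= T by rewrite lexx.
pose z0 : Z := exist _ (s, y0) (And3 sz Yy0 N00).
have [||||z [_ _ hz] zT] := @maximal_chain_reaches R Z t_ le T le_refl le_tr _ _ _ _ z0.
- by move=> z; have /andP[] := tz z.
- by move=> x y [].
- move=> z zT; have /andP[sz' _] := tz z.
  have z01 : 0 <= t_ z < 1 by rewrite (le_trans s0 sz') (lt_le_trans zT T1).
  have [h1 h10 [n0 hn0]] := step_product_local z01 (Yz z) (divr_gt0 e0 (ltr_wpDl K0 ltr01)).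
  have [hS _] := kf_gen kf (t01 z).
  have Bz := kf_dom kf (t01 z) (Yz z).
  have [_ _ /(_ 1 ltr01)[d d0 hd]] :=
    proj1 (generatesP hX hS _ _ (kf_gen kf (t01 z))) (conj Bz erefl).
  pose h := Num.min (T - t_ z) (Num.min h1 (d / 2)).
  have h0 : 0 < h by rewrite /h !lt_min h10 subr_gt0 zT divr_gt0.
  have [hT [hh1 hd2]] : h <= T - t_ z /\ h <= h1 /\ h <= d / 2.
    by rewrite /h !ge_min !lexx !orbT.
  have hge0 := ltW h0.
  have Yh : Y (S (t_ z) h (y_ z)) by exact: (kf_inv kf).
  have sh : s <= t_ z + h <= T by rewrite -lerBrDl hT (le_trans sz') // lerDl.
  have th01 : 0 <= t_ z + h <= 1.
    by move: sh => /andP[sh hT']; rewrite (le_trans s0 sh) (le_trans hT' T1).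
  have Nh : N (t_ z + h) (S (t_ z) h (y_ z)) <= expR (C * (t_ z + h - s)) * N s y0.
    apply: (le_trans (kf_lip kf (t01 z) th01 Yh)).
    rewrite [t_ z + h - t_ z]addrC addKr gtr0_norm //.
    have -> : C * (t_ z + h - s) = c * h + (`|w0| * h + C * (t_ z - s)).
      by rewrite /C; ring.
    rewrite !expRD -!mulrA; apply: ler_wpM2l; first exact: expR_ge0.
    apply: (le_trans (kf_growth kf (t01 z) _ (Yz z))).
      by rewrite hge0 /=; move: hT T1 sz' s0; lra_goal.
    apply: ler_pM; [exact: expR_ge0|exact: kf_N_ge0| |exact: Nz].
    by rewrite ler_expR; apply: ler_wpM2r => //; exact: ler_norm.
  exists (exist _ (t_ z + h, S (t_ z) h (y_ z)) (And3 sh Yh Nh) : Z).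
    rewrite /le /t_ /y_ /= -/(t_ z) -/(y_ z).
    have thz : t_ z + h - t_ z = h by rewrite [t_ z + h]addrC addrK.
    split; [by rewrite lerDl| |].
      rewrite thz.
      have hd' : h < d by move: hd2 d0; lra_goal.
      have g1 := hd h h0 hd'.
      have g2 := nX_tri (h%:C *: B (t_ z) (y_ z)) (S (t_ z) h (y_ z) - y_ z) 0.
      rewrite !subr0 nXZ gtr0_norm // in g2.
      have g3 : h * nX (B (t_ z) (y_ z)) <= h * (M * Q).
        apply: ler_wpM2l => //.
        apply: (le_trans (kf_generator_bound (t01 z) (t01 z) (Yz z))).
        exact: ler_wpM2l.
      by rewrite /L mulrDl mul1r [M * Q * h]mulrC; move: g1 g2 g3; lra_goal.
    move=> h2 h20; exists n0 => n nn; rewrite thz.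
    apply: (le_trans (hn0 n nn h T _ _ T1)); [by rewrite hge0|by move: sh => /andP[]|].
    have : K * (e / (K + 1)) * h <= e * h.
      by apply: ler_wpM2r => //; apply: ler_frac => //; exact: ltW.
    by move: h20; lra_goal.
  by rewrite /t_ /= -/(t_ z) ltrDl.
- move=> u hu.
  have [||t [tT ut ct]] := @monotone_limit R (fun k => t_ (u k)) T.
  + by move=> k; case: (hu k).
  + by move=> k; have /andP[] := tz (u k).
  rewrite /= in ut ct.
  have le_u k l : (k <= l)%N -> le (u k) (u l).
    elim: l => [|l IH]; first by rewrite leqn0 => /eqP->.
    rewrite leq_eqVlt => /orP[/eqP->|]; first exact: le_refl.
    by rewrite ltnS => /IH h; exact: le_tr (hu l).
  have L0 : 0 < L by rewrite /L ltr_wpDl.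
  have dist k l : (k <= l)%N -> nX (y_ (u l) - y_ (u k)) <= L * (t - t_ (u k)).
    move=> kl; have [_ h _] := le_u k l kl; apply: (le_trans h).
    by apply: ler_wpM2l; [exact: ltW|rewrite lerD2r].
  have near h : 0 < h -> exists n0, forall k, (n0 <= k)%N -> L * (t - t_ (u k)) < h.
    move=> h0; have [n0 hn0] := ct (h / L) (divr_gt0 h0 L0).
    by exists n0 => k /hn0 hk; rewrite mulrC -ltr_pdivlMr //; move: hk; lra_goal.
  have cauchy h : 0 < h -> exists n0 : nat, forall m n : nat, (n0 <= m)%N ->
      (n0 <= n)%N -> nX (y_ (u m) - y_ (u n)) < h.
    move=> h0; have [n0 hn0] := near h h0.
    have half m n : (m <= n)%N -> (n0 <= m)%N -> nX (y_ (u m) - y_ (u n)) < h.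
      by move=> mn nm; rewrite nXC (le_lt_trans (dist m n mn)) // hn0.
    exists n0 => m n nm nn; have [mn|/ltnW mn] := leqP m n; first exact: half.
    by rewrite nXC half.
  have [y [_ /cvg0_seq hy]] := (proj2 (whole_banach X)) (fun k => y_ (u k)) (fun=> I) cauchy.
  have {}hy := hy (fun k => nX_ge0 _).
  have disty k : nX (y - y_ (u k)) <= L * (t - t_ (u k)).
    apply/ler_addgt0Pr => h h0; have [n0 hn0] := hy h h0.
    have h1 := dist k (maxn k n0) (leq_maxl _ _).
    have h2 := hn0 (maxn k n0) (leq_maxr _ _).
    have := nX_tri (y_ (u (maxn k n0))) y (y_ (u k)).
    by rewrite [X in _ <= X + _]nXC; move: h1 h2; lra_goal.
  have /andP[su0 _] := tz (u 0%N); have u0t := ut 0%N; simpl in u0t.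
  have st : s <= t by exact: le_trans u0t.
  have t1 : 0 <= t <= 1 by rewrite (le_trans s0 st) (le_trans tT T1).
  (* c <= C leaves room for replacing the norm at time t_ by the one at t. *)
  have [Yy Ny] : Y y /\ N t y <= expR (C * (t - s)) * N s y0.
    apply: (kf_closed kf) => // d d0; have [n0 hn0] := near d d0.
    exists (y_ (u n0)); split => //.
      by rewrite nXC (le_lt_trans (disty _)) // hn0.
    apply: (le_trans (kf_lip kf (t01 (u n0)) t1 (Yz _))).
    have -> : C * (t - s) = C * (t - t_ (u n0)) + C * (t_ (u n0) - s) by ring.
    rewrite expRD -mulrA; apply: ler_pM; [exact: expR_ge0|exact: kf_N_ge0| |exact: Nz].
    have ht : 0 <= t - t_ (u n0) by rewrite subr_ge0 ut.
    rewrite ler_expR (ger0_norm ht).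
    by apply: ler_wpM2r => //; rewrite /C lerDl.
  have stT : s <= t <= T by rewrite st.
  exists (exist _ (t, y) (And3 stT Yy Ny) : Z) => k.
  split; [exact: (ut k)|exact: disty|].
  move=> h h0.
  pose L1 := K * (L + K * (expR c * (M * Q)))+ 1.
  have eMQ : 0 <= expR c * (M * Q) by apply: mulr_ge0 => //; exact: expR_ge0.
  have KMQ : 0 <= K * (expR c * (M * Q)) by exact: mulr_ge0.
  have L10 : 0 < L1.
    by rewrite /L1 ltr_wpDl // mulr_ge0 // addr_ge0 // ltW.
  have h20 : 0 < h / 2 by exact: divr_gt0.
  have [n1 hn1] := ct (h / 2 / L1) (divr_gt0 h20 L10).
  pose l := maxn k n1.
  have hl := hn1 l (leq_maxr _ _).
  have [_ _ /(_ (h / 2) h20)[n2 hn2]] := le_u k l (leq_maxl _ _).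
  exists n2 => n nn; have {}hn2 := hn2 n nn.
  change (nX (P n T t y - P n T (t_ (u k)) (y_ (u k))) <= e * (t - t_ (u k)) + h).
  have n0 : (0 < n)%N by exact: leq_ltn_trans nn.
  have [phi [_ hP0]] := step_product_propagator kf n0.
  have hP : propagator Y K (P n) (fun r => B (phi r)) := hP0.
  have /andP[sl lT] := tz (u l); have ltt := ut l; simpl in ltt.
  have tl0 : 0 <= t_ (u l) by exact: le_trans s0 sl.
  have [t0 t1'] := andP t1.
  have g1 : nX (P n T t y - P n T (t_ (u l)) (y_ (u l))) <= h / 2.
    rewrite -(prop_comp hP (y_ (u l)) (s := t) (r := t_ (u l)) (t := T)) //.
    apply: (le_trans (prop_lip hP _ _ t0 tT T1)).
    have b1 := nX_tri (y_ (u l)) y (P n t (t_ (u l)) (y_ (u l))).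
    have b2 := step_product_lipschitz n0 tl0 ltt t1' (t01 (u l)) (Yz (u l)).
    have b3 := disty l.
    have b4 : K * (M * N (t_ (u l)) (y_ (u l))) * (t - t_ (u l)) <=
        K * (expR c * (M * Q)) * (t - t_ (u l)).
      apply: ler_wpM2r; first by rewrite subr_ge0.
      apply: ler_wpM2l => //.
      apply: (@le_trans _ _ (M * Q)); first exact: ler_wpM2l.
      by rewrite ler_peMl // -expR0 ler_expR.
    rewrite [X in _ <= _ + X]nXC in b1.
    have b5 : K * nX (y - P n t (t_ (u l)) (y_ (u l))) <=
        K * ((L + K * (expR c * (M * Q))) * (t - t_ (u l))).
      by apply: ler_wpM2l => //; rewrite mulrDl; move: b1 b2 b3 b4; lra_goal.
    apply: (le_trans b5).
    have : L1 * (t - t_ (u l)) <= h / 2.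
      by rewrite mulrC -ler_pdivlMr //; move: hl; lra_goal.
    have : 0 <= t - t_ (u l) by rewrite subr_ge0.
    by rewrite /L1 mulrDl mul1r mulrA; lra_goal.
  have := nX_tri (P n T (t_ (u l)) (y_ (u l))) (P n T t y) (P n T (t_ (u k)) (y_ (u k))).
  have : e * (t_ (u l) - t_ (u k)) <= e * (t - t_ (u k)).
    by rewrite ler_pM2l // lerD2r.
  by move: g1 hn2; lra_goal.
exists (y_ z); split; [exact: Yz|by have := Nz z; rewrite zT|].
move=> h h0; have [n0 hn0] := hz h h0; exists n0 => n nn.
have n1 : (0 < n)%N by exact: leq_ltn_trans nn.
have [phi [_ hP0]] := step_product_propagator kf n1.
have hP : propagator Y K (P n) (fun r => B (phi r)) := hP0.
have T01 : 0 <= T <= 1 by rewrite T1 andbT (le_trans s0).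
have h1 := hn0 n nn.
rewrite zT (prop_id hP _ T01) in h1.
by rewrite nXC; exact: h1.
Qed.

End Limit.

(** * The limit propagator *)

Section Evolution.
Context {R : realType} {X : completeNormedModType R[i]}.
Local Notation nX := (nrm (whole X)).
Let hX := @whole_normed R X.

(** Convergence of sequences whose entry at 0, where there are no cells, is
    meaningless. *)
Definition tends (a : nat -> X) (l : X) : Prop :=
  forall e : R, 0 < e -> exists n0, forall n, (n0 < n)%N -> nX (a n - l) < e.

Lemma tends_unique a l m : tends a l -> tends a m -> l = m.
Proof.
move=> al am; apply: nX_eq => e e0.
have e20 : 0 < e / 2 by lra.
have [n1 h1] := al _ e20; have [n2 h2] := am _ e20.
have := h1 (maxn n1 n2).+1; rewrite ltnS leq_maxl => /(_ isT) g1.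
have := h2 (maxn n1 n2).+1; rewrite ltnS leq_maxr => /(_ isT) g2.
by have := nX_tri (a (maxn n1 n2).+1) l m; rewrite (nXC l (a _)); lra.
Qed.

Lemma tends_le a l z (C : R) : tends a l ->
  (forall n, (0 < n)%N -> nX (a n - z) <= C) -> nX (l - z) <= C.
Proof.
move=> al h; apply/ler_addgt0Pr => e e0; have [n1 h1] := al _ e0.
have g1 := h1 n1.+1 (ltnSn _); have g2 := h n1.+1 isT.
by have := nX_tri (a n1.+1) l z; rewrite (nXC l (a _)); lra.
Qed.

Lemma tends_ext a b l : tends a l -> (forall n, (0 < n)%N -> a n = b n) -> tends b l.
Proof.
move=> al ab e /al[n0 h]; exists n0 => n nn.
by rewrite -ab ?h // (leq_ltn_trans _ nn).
Qed.

Lemma tendsD a b l m : tends a l -> tends b m -> tends (fun n => a n + b n) (l + m).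
Proof.
move=> al bm e e0; have e20 : 0 < e / 2 by lra.
have [n1 h1] := al _ e20; have [n2 h2] := bm _ e20.
exists (maxn n1 n2) => n; rewrite gtn_max => /andP[/h1 g1 /h2 g2].
by rewrite opprD addrACA; have := nXD (a n - l) (b n - m); lra.
Qed.

Lemma tendsZ (k : R[i]) a l : tends a l -> tends (fun n => k *: a n) (k *: l).
Proof.
move=> al e e0.
pose r := complex.Re `|k|.
have kr : `|k| = r%:C by have := ger0_Im (normr_ge0 k); rewrite /r; case: `|k| => x y /= ->.
have r0 : 0 <= r by rewrite -lecR -kr normr_ge0.
have nk x : nX (k *: x) = r * nX x.
  have [_ [_ _ /(_ k x I) + _]] := hX.
  by rewrite kr -rmorphM => /(congr1 (@complex.Re R)).
have [|n1 h1] := al (e / (r + 1)); first by apply: divr_gt0 => //; lra.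
exists n1 => n /h1; rewrite -scalerBr nk ltr_pdivlMr; last by lra.
by have := nX_ge0 (a n - l); lra.
Qed.

Variables (Y : set X) (N : R -> X -> R) (B : R -> operator X).
Variables (S : R -> R -> X -> X) (K Bd c w0 : R).
Hypothesis kf : kato_family Y N B S K Bd c w0.
Let P n := step_product S n n.
Let C := c + `|w0|.

Lemma step_product_converges : exists U : R -> R -> X -> X, forall t s x,
  0 <= s -> s <= t -> t <= 1 -> tends (fun n => P n t s x) (U t s x).
Proof.
suff /choice[U hU] : forall q : R * R * X, exists l,
    0 <= q.1.2 -> q.1.2 <= q.1.1 -> q.1.1 <= 1 ->
    tends (fun n => P n q.1.1 q.1.2 q.2) l.
  by exists (fun t s x => U ((t, s), x)) => t s x; exact: hU ((t, s), x).
move=> [[t s] x] /=.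
have [s0|] := boolP (0 <= s); last by exists 0.
have [st|] := boolP (s <= t); last by exists 0.
have [t1|] := boolP (t <= 1); last by exists 0.
have K0 : 0 <= K by exact: kf_K kf.
have cauchyY y e : Y y -> 0 < e -> exists n0, forall m n, (n0 < m)%N -> (n0 < n)%N ->
    nX (P m t s y - P n t s y) <= e.
  move=> Yy e0; have e40 : 0 < e / 4 by lra.
  have [y' [_ _ /(_ _ e40)[n0 hn0]]] := step_product_chain kf s0 st t1 Yy e40.
  exists n0 => m n /hn0 h1 /hn0 h2.
  have h3 := nX_tri y' (P m t s y) (P n t s y).
  rewrite (nXC y') in h3.
  have h4 : e / 4 * (t - s) <= e / 4 by rewrite ler_piMr; lra.
  by rewrite /P in h1 h2 h3 *; lra.
have cauchy e : 0 < e -> exists n0 : nat, forall m n : nat, (n0 <= m)%N -> (n0 <= n)%N ->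
    nX (P m.+1 t s x - P n.+1 t s x) < e.
  move=> e0.
  have e20 : 0 < e / 4 / (K + 1) by apply: divr_gt0 => //; lra.
  have [y Yy xy] := dense_nX (kf_dense kf) x e20.
  have e40 : 0 < e / 4 by lra.
  have [n0 hn0] := cauchyY y _ Yy e40.
  exists n0 => m n nm nn.
  have h1 := hn0 m.+1 n.+1 nm nn.
  have h2 k : nX (P k.+1 t s x - P k.+1 t s y) <= e / 4.
    rewrite -(step_productB kf) //.
    apply: (le_trans (step_product_bound kf (ltn0Sn k) _ st)).
    rewrite nXC; apply: (@le_trans _ _ (K * (e / 4 / (K + 1)))).
      by apply: ler_wpM2l => //; exact: ltW.
    by apply: ler_frac => //; exact: ltW.
  have h3 := nX_tri (P m.+1 t s y) (P m.+1 t s x) (P n.+1 t s x).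
  have h4 := nX_tri (P n.+1 t s y) (P m.+1 t s y) (P n.+1 t s x).
  have := h2 m; have := h2 n; rewrite nXC; lra.
have [l [_ /cvg0_seq hl]] := (proj2 (whole_banach X)) _ (fun=> I) cauchy.
have {}hl := hl (fun n => nX_ge0 _).
exists l => _ _ _ e /hl[n0 hn0]; exists n0 => -[//|n] nn; exact: hn0.
Qed.

(** Everything passes to the limit from the step products, except for the
    derivative, which comes from [step_product_local], and the bound in Y, which
    comes from the end points of the chains. *)
Lemma evolution_limit : exists U : R -> R -> X -> X,
  [/\ propagator Y K U B,
      forall (s t : R) x, 0 <= s -> s <= t -> t <= 1 ->
        tends (fun n => P n t s x) (U t s x),
      forall s t : R, 0 <= s -> s <= t -> t <= 1 -> bounded_on (whole X) (whole X) (U t s) &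
      forall (s t : R) y, 0 <= s -> s <= t -> t <= 1 -> Y y ->
        Y (U t s y) /\ N t (U t s y) <= expR (C * (t - s)) * N s y].
Proof.
have [U hU] := step_product_converges.
have K0 : 0 <= K by exact: kf_K kf.
have Ulip s t x y : 0 <= s -> s <= t -> t <= 1 ->
    nX (U t s x - U t s y) <= K * nX (x - y).
  move=> s0 st t1; rewrite -[leLHS]/(nX _) -[U t s x - U t s y]subr0.
  apply: (@tends_le (fun n => P n t s x - P n t s y)).
    apply: tendsD; first exact: hU.
    by rewrite -scaleN1r; apply: tends_ext (tendsZ (-1) (hU t s y s0 st t1)) _ => n _;
      rewrite scaleN1r.
  move=> n n0; rewrite subr0 -(step_productB kf) //.
  exact: (step_product_bound kf).
have Uid t x : 0 <= t <= 1 -> U t t x = x.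
  move=> /andP[t0 t1]; apply: (tends_unique (hU t t x t0 (lexx t) t1)) => e e0.
  exists 0%N => n n0; rewrite /P (step_product_eq kf n0) //.
  by rewrite subrr nX0.
have UY s t y : 0 <= s -> s <= t -> t <= 1 -> Y y ->
    Y (U t s y) /\ N t (U t s y) <= expR (C * (t - s)) * N s y.
  move=> s0 st t1 Yy.
  have t01 : 0 <= t <= 1 by apply/andP; split; lra.
  apply: (kf_closed kf t01) => d d0.
  have d20 : 0 < d / 4 by lra.
  have [y' [Yy' Ny' /(_ _ d20)[n0 hn0]]] := step_product_chain kf s0 st t1 Yy d20.
  exists y'; split => //.
  have [n1 hn1] := hU t s y s0 st t1 _ d20.
  pose n := (maxn n0 n1).+1.
  have h1 := hn0 n (leq_maxl _ _); have h2 := hn1 n (leq_maxr _ _).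
  have h3 := nX_tri (P n t s y) y' (U t s y).
  rewrite (nXC y' (P _ _ _ _)) in h3.
  have h4 : d / 4 * (t - s) <= d / 4 by rewrite ler_piMr; lra.
  by unfold P in *; lra.
have UlipY s t y : 0 <= s -> s <= t -> t <= 1 -> Y y ->
    nX (U t s y - y) <= K * (Bd * expR c * N t y) * (t - s).
  move=> s0 st t1 Yy; apply: (tends_le (hU t s y s0 st t1)) => n n0.
  apply: (step_product_lipschitz kf) => //; apply/andP; split; lra.
exists U; split => //.
- split => //.
  + move=> r s t x r0 rs st t1.
    have s0 : 0 <= s by exact: le_trans rs.
    have s1 : s <= 1 by exact: le_trans t1.
    apply: nX_eq => e e0.
    have e20 : 0 < e / (K + 2) by apply: divr_gt0 => //; lra.
    have [n1 h1] := hU t s (U s r x) s0 st t1 _ e20.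
    have [n2 h2] := hU s r x r0 rs s1 _ e20.
    have [n3 h3] := hU t r x r0 (le_trans rs st) t1 _ e20.
    pose n := (maxn n1 (maxn n2 n3)).+1.
    have {}h1 := h1 n (leq_maxl _ _).
    have {}h2 := h2 n (leq_trans (leq_maxl _ _) (leq_maxr _ _)).
    have {}h3 := h3 n (leq_trans (leq_maxr _ _) (leq_maxr _ _)).
    have n0 : (0 < n)%N by [].
    have h4 := step_product_bound kf n0 (U s r x - P n s r x) st.
    rewrite (step_productB kf) // (step_product_comp kf) // in h4.
    rewrite [X in _ <= _ * X]nXC in h4.
    have h5 : K * nX (P n s r x - U s r x) <= K * (e / (K + 2)).
      by apply: ler_wpM2l => //; exact: ltW.
    have h6 := nX_tri (P n t s (U s r x)) (U t s (U s r x)) (U t r x).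
    have h7 := nX_tri (P n t r x) (P n t s (U s r x)) (U t r x).
    rewrite (nXC (U t s _) (P _ _ _ _)) in h6.
    set f := e / (K + 2) in h1 h2 h3 h5 *.
    have -> : e = K * f + 2 * f by rewrite /f; field; lra.
    by unfold P in *; lra.
  + move=> t x e t01 e0; have /andP[t0 t1] := t01.
    have e20 : 0 < e / 4 / (K + 1) by apply: divr_gt0 => //; lra.
    have [y Yy xy] := dense_nX (kf_dense kf) x e20.
    pose L := K * (Bd * expR c * N t y).
    have L0 : 0 <= L.
      apply: mulr_ge0 => //; apply: mulr_ge0; last exact: (kf_N_ge0 kf).
      by apply: mulr_ge0; [exact: kf_Bd kf|exact: expR_ge0].
    exists (e / 4 / (L + 1)) => [|s /andP[s0 st] tsd]; first by apply: divr_gt0; lra.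
    have h1 := Ulip s t x y s0 st t1.
    have h2 := UlipY s t y s0 st t1 Yy; rewrite -/L in h2.
    have h3 : L * (t - s) <= e / 4.
      apply: (@le_trans _ _ (L * (e / 4 / (L + 1)))).
        by apply: ler_wpM2l => //; exact: ltW.
      by apply: ler_frac => //; lra.
    have h4 : K * nX (x - y) <= e / 4.
      apply: (@le_trans _ _ (K * (e / 4 / (K + 1)))).
        by apply: ler_wpM2l => //; rewrite nXC; exact: ltW.
      by apply: ler_frac => //; lra.
    have h5 : e / 4 / (K + 1) <= e / 4.
      by rewrite ler_pdivrMr ?ler_peMr; lra.
    have h6 := nX_tri (U t s y) (U t s x) x.
    have h7 := nX_tri y (U t s y) x.
    by lra.
  + move=> s y e s01 Yy e0; have /andP[s0 s1] := s01.
    have e20 : 0 < e / 2 / (K + 1) by apply: divr_gt0 => //; have := K0; lra.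
    have [h0 h00 [n0 hn0]] := step_product_local kf s01 Yy e20.
    have s01' : 0 <= s <= 1 by rewrite s0 ltW.
    have [hS _] := kf_gen kf s01'.
    have Bs := kf_dom kf s01' Yy.
    have [_ _ /(_ (e / 2) (ltac:(lra)))[d d0 hd]] :=
      proj1 (generatesP hX hS _ _ (kf_gen kf s01')) (conj Bs erefl).
    exists (Num.min d h0) => [|h hh0]; first by rewrite lt_min d0.
    rewrite lt_min => /andP[hd1 hh1] sh1.
    have hge0 := ltW hh0.
    have g1 := hd h hh0 hd1.
    have sh0 : 0 <= s + h by rewrite addr_ge0.
    have g2 : nX (U (s + h) s y - S s h y) <= e / 2 * h.
      have ssh : s <= s + h by rewrite lerDl.
      have U_s := hU (s + h) s y s0 ssh sh1.
      apply/ler_addgt0Pr => f f0; have [n1 hn1] := U_s _ f0.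
      pose n := (maxn n0 n1).+1.
      have k1 := hn0 n (leq_maxl _ _) h (s + h) (ltac:(by rewrite hge0 ltW)) (lexx _) sh1.
      have k2 := hn1 n (leq_maxr _ _).
      have nn : (0 < n)%N by [].
      have e1 : step_product S n n (s + h) (s + h) (S s h y) = S s h y.
        exact: (step_product_eq kf nn).
      rewrite e1 in k1.
      have k3 : K * (e / 2 / (K + 1)) * h <= e / 2 * h.
        by apply: ler_wpM2r => //; apply: ler_frac => //; lra.
      have k4 := nX_tri (P n (s + h) s y) (U (s + h) s y) (S s h y).
      rewrite (nXC (U _ _ _) (P _ _ _ _)) (nXC (P _ _ _ _) (S s h y)) in k4.
      by unfold P in *; lra.
    have g3 := nXD (U (s + h) s y - S s h y) (S s h y - y - h%:C *: B s y).
    rewrite !addrA subrK in g3.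
    lra.
- by move=> s t x; exact: hU.
- move=> s t s0 st t1; split; first by move=> x _.
    move=> a x y _ _.
    apply: (tends_unique (hU t s (a *: x + y) s0 st t1)).
    apply: tends_ext (tendsD (tendsZ a (hU t s x s0 st t1)) (hU t s y s0 st t1)) _.
    move=> n n0; rewrite /P.
    have eN : step_product S n n t s (- y) = - step_product S n n t s y.
      by rewrite -scaleN1r (step_productZ kf) // scaleN1r.
    rewrite -(step_productZ kf) // -[X in _ + X]opprK -eN.
    by rewrite -(step_productB kf) // opprK.
  exists K => x _; have := Ulip s t x 0 s0 st t1.
  suff -> : U t s 0 = 0 by rewrite !subr0.
  apply: (tends_unique (hU t s 0 s0 st t1)) => e e0; exists 0%N => n n0.
  have -> : P n t s 0 = 0.
    by rewrite -{1}(subrr 0) /P (step_productB kf) // subrr.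
  by rewrite subrr nX0.
Qed.

End Evolution.

(** * The two time directions *)

Section Verification.
Context {R : realType} {X : completeNormedModType R[i]}.
Local Notation nX := (nrm (whole X)).
Let hX := @whole_normed R X.

Lemma equivalent_banach (E : normed_subspace X) (N : X -> R) :
  is_banach E -> is_norm (carrier E) N -> equivalent_norms (carrier E) (nrm E) N ->
  is_banach (NormedSubspace (carrier E) N).
Proof.
move=> [hE complete] hN [a [b [a0 b0 ab]]].
have hF : is_normed_subspace (NormedSubspace (carrier E) N) by split=> //; case: hE.
split=> // u Eu cauchy.
have [e e0|y [Ey /cvg0_seq hy]] := complete u Eu.
  have [n0 hn0] := cauchy (a * e) (mulr_gt0 a0 e0); exists n0 => m n hm hn.
  have [h _] := ab _ (nsB hE (Eu m) (Eu n)).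
  by rewrite -(ltr_pM2l a0); apply: (le_lt_trans h); exact: hn0.
have {}hy := hy (fun n => nrm_ge0 hE (nsB hE (Eu n) Ey)).
exists y; split => //; apply/cvg0_seq => [n|e e0].
  exact: (nrm_ge0 hF (nsB hF (Eu n) Ey)).
have [n0 hn0] := hy (e / b) (divr_gt0 e0 b0); exists n0 => n /hn0.
rewrite ltr_pdivlMr // mulrC; apply: le_lt_trans.
by have [_] := ab _ (nsB hE (Eu n) Ey).
Qed.

Lemma bounded_of_continuous (f : R -> X) : {within `[0, 1], continuous f} ->
  exists C, forall t : R, 0 <= t <= 1 -> nX (f t) <= C.
Proof.
move=> /continuous_within_whole fc.
have gc : {within `[0, 1], continuous (fun t => nX (f t) : R)}.
  apply/subspace_continuousP => t It; apply/cvgrPdist_lt => e e0.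
  have [d d0 hd] := fc t It e e0.
  rewrite near_withinE; apply/nbhs_ballP; exists d => //= r.
  rewrite /ball /= distrC => rt Ir.
  apply: le_lt_trans (hd r Ir rt); rewrite ler_norml.
  have := nrm_subr hX (I : carrier (whole X) (f r)) (I : carrier (whole X) (f t)).
  have := nrm_subr hX (I : carrier (whole X) (f t)) (I : carrier (whole X) (f r)).
  by rewrite (nXC (f t)) => h1 h2; apply/andP; split; lra.
have [c _ hc] := @EVT_max R _ 0 1 ler01 gc.
by exists (nX (f c)) => t t01; apply: hc; rewrite in_itv.
Qed.

Variables (A : R -> operator X) (M w : R) (Y : normed_subspace X).
Variables (N : bool -> R -> X -> R) (c : bool -> R) (w0 : R).
Hypothesis M_ge1 : 1 <= M.
Hypothesis A_stable : forall b, stable M w (signed b A).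
Hypothesis Y_admissible : forall b t, t \in `[0, 1] -> admissible (signed b A t) Y.
Hypothesis Y_dom : forall t, t \in `[0, 1] -> carrier Y `<=` dom (A t).
Hypothesis AY_bounded : forall t, t \in `[0, 1] -> bounded_on Y (whole X) (A t).
Hypothesis AY_continuous : forall y, carrier Y y ->
  {within `[0, 1], continuous (fun t => A t y)}.
Hypothesis N_norm : forall b t, t \in `[0, 1] -> is_norm (carrier Y) (N b t).
Hypothesis N_equiv : forall b t, t \in `[0, 1] ->
  equivalent_norms (carrier Y) (nrm Y) (N b t).
Hypothesis N_convex : forall b t, t \in `[0, 1] ->
  uniformly_convex (NormedSubspace (carrier Y) (N b t)).
Hypothesis c_gt0 : forall b, 0 < c b.
Hypothesis N_lipschitz : forall b s t y, s \in `[0, 1] -> t \in `[0, 1] ->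
  carrier Y y -> N b t y <= expR (c b * `|t - s|) * N b s y.
Hypothesis part_generator : forall b t, t \in `[0, 1] ->
  is_semigroup_generator (NormedSubspace (carrier Y) (N b t))
    (part (signed b A t) (carrier Y)).
Hypothesis part_quasicontraction : forall b t tau y, t \in `[0, 1] -> 0 <= tau ->
  carrier Y y ->
  N b t (semigroup (NormedSubspace (carrier Y) (N b t))
    (part (signed b A t) (carrier Y)) tau y) <= expR (w0 * tau) * N b t y.

Let flip (t : R) : t \in `[0, 1] -> 1 - t \in `[0, 1].
Proof. by rewrite !in_itv /= => /andP[t0 t1]; apply/andP; split; lra. Qed.

Let mem01 (t : R) : 0 <= t <= 1 -> t \in `[0, 1].
Proof. by rewrite in_itv. Qed.

Lemma semigroup_generates (E : normed_subspace X) (B : operator X) :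
  is_semigroup_generator E B -> generates `[0, +oo[ E B (semigroup E B).
Proof. by move=> h; exact: (@getPex _ [set T | generates `[0, +oo[ E B T]). Qed.

Lemma signed_semigroup b (t : R) : 0 <= t <= 1 ->
  generates `[0, +oo[ (whole X) (signed b A t) (semigroup (whole X) (signed b A t)).
Proof. by move=> /mem01 t01; apply: semigroup_generates; have [+ _] := A_stable b; exact. Qed.

Lemma signed_stable b (l : seq (R * R)) :
  all (fun p => (0 <= p.1 <= 1) && (0 <= p.2)) l ->
  sorted <=%R (map fst l) -> \sum_(p <- l) p.2 <= 1 ->
  forall x, nX (foldl (fun y p => semigroup (whole X) (signed b A p.1) p.2 y) x l)
    <= M * expR `|w| * nX x.
Proof.
move=> al sl s1 x; have [_ /(_ l _ sl x) h] := A_stable b.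
apply: (le_trans (h _)).
  by apply: sub_all al => p /andP[p1 p2]; rewrite mem01.
apply: ler_wpM2r; first exact: nX_ge0.
apply: ler_wpM2l; first by have := M_ge1; lra.
have s0 : 0 <= \sum_(p <- l) p.2.
  by rewrite big_seq; apply: sumr_ge0 => p /(allP al) /andP[].
rewrite ler_expR (@le_trans _ _ (`|w| * \sum_(p <- l) p.2)) //.
  by apply: ler_wpM2r => //; exact: ler_norm.
by rewrite ler_piMr.
Qed.

Lemma Y_banach : is_banach Y.
Proof. by have [] := Y_admissible true (mem01 (ltac:(rewrite lexx ler01) : 0 <= 0 <= (1 : R))). Qed.

Lemma Y_normed : is_normed_subspace Y.
Proof. by case: Y_banach. Qed.

Lemma YN_banach b (t : R) : 0 <= t <= 1 -> is_banach (NormedSubspace (carrier Y) (N b t)).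
Proof.
by move=> /mem01 t01; apply: equivalent_banach; [exact: Y_banach|exact: N_norm|exact: N_equiv].
Qed.

Lemma YN_normed b (t : R) : 0 <= t <= 1 ->
  is_normed_subspace (NormedSubspace (carrier Y) (N b t)).
Proof. by move=> /(YN_banach b)[]. Qed.

Lemma YN_embedded b (t : R) : 0 <= t <= 1 ->
  exists C, forall y, carrier Y y -> nX y <= C * N b t y.
Proof.
move=> /mem01 t01; have [_ _ _ [_ _ [C hC]] _] := Y_admissible b t01.
have [a [a' [a0 _ ha]]] := N_equiv b t01.
exists (`|C| / a) => y Yy; apply: (le_trans (hC y Yy)).
have Ny := nrm_ge0 Y_normed Yy.
apply: (@le_trans _ _ (`|C| * nrm Y y)); first by apply: ler_wpM2r => //; exact: ler_norm.
rewrite -mulrA; apply: ler_wpM2l => //.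
by rewrite ler_pdivlMl //; have [] := ha y Yy.
Qed.

(** Uniform boundedness for the norm of Y at time 0, transported to the other
    times by the Lipschitz dependence of the norms on time. *)
Lemma generators_bounded b : exists2 Bd : R, 0 <= Bd & forall (t : R) y, 0 <= t <= 1 ->
  carrier Y y -> nX (signed b A t y) <= Bd * N b t y.
Proof.
have [||C C0 hC] := @uniform_boundedness _ _ Y R [set t | 0 <= t <= 1] (fun t => A t) Y_banach.
- by move=> t /mem01; exact: AY_bounded.
- by move=> y Yy; have [C hC] := bounded_of_continuous (AY_continuous Yy); exists C.
have h0 : (0 : R) \in `[0, 1] by rewrite mem01 // lexx ler01.
have [a [a' [a0 _ ha]]] := N_equiv b h0.
exists (C * (a^-1 * expR (c b))).
  by rewrite mulr_ge0 // mulr_ge0 ?expR_ge0 // invr_ge0 ltW.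
move=> t y t01 Yy.
apply: (@le_trans _ _ (C * nrm Y y)).
  case: b {ha h0}; first exact: hC.
  have -> : signed false A t y = - A (1 - t) y by [].
  rewrite (nrmN hX) //; apply: hC => //=.
  by have := flip (mem01 t01); rewrite in_itv.
rewrite -mulrA; apply: ler_wpM2l => //; rewrite -mulrA ler_pdivlMl //.
have [h1 _] := ha y Yy; apply: (le_trans h1).
apply: (le_trans (N_lipschitz b (mem01 t01) h0 Yy)).
apply: ler_wpM2r; first exact: (nrm_ge0 (YN_normed b t01) Yy).
rewrite ler_expR -[leRHS]mulr1; apply: ler_wpM2l; first exact: ltW.
by rewrite sub0r normrN; move: t01 => /andP[? ?]; rewrite ger0_norm.
Qed.

(** Turns the growth bound on the semigroup of the part into one on the
    restriction of e^(B s), which is the operator in the step products. *)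
Lemma part_is_restriction b (t h : R) y : 0 <= t <= 1 -> 0 <= h <= 1 -> carrier Y y ->
  semigroup (NormedSubspace (carrier Y) (N b t)) (part (signed b A t) (carrier Y)) h y =
  semigroup (whole X) (signed b A t) h y.
Proof.
move=> t01 h01 Yy; have t01' := mem01 t01.
have [CX hCX] := YN_embedded b t01.
apply: (part_semigroup (YN_banach b t01) hCX _ (signed_semigroup b t01)
  (K := M * expR `|w|) _ _ (semigroup_generates (part_generator b t01')) (w := w0)) => //.
- case: b {hCX} => /=; first exact: Y_dom.
  by apply: Y_dom; exact: flip.
- by apply: mulr_ge0; [have := M_ge1; lra|exact: expR_ge0].
- move=> s x /andP[s0 s1]; apply: (@signed_stable b [:: (t, s)]) => //=.
    by rewrite t01 s0.
  by rewrite big_seq1.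
- by move=> s z s0 Yz; exact: part_quasicontraction.
Qed.

Lemma signed_kato b : exists Bd, kato_family (carrier Y) (N b) (signed b A)
  (fun t => semigroup (whole X) (signed b A t)) (M * expR `|w|) Bd (c b) w0.
Proof.
have [Bd Bd0 hBd] := generators_bounded b; exists Bd.
have inv (t h : R) y : 0 <= t <= 1 -> 0 <= h -> carrier Y y ->
    carrier Y (semigroup (whole X) (signed b A t) h y).
  move=> /mem01 t01 h0 Yy; have [_ _ _ _ hS] := Y_admissible b t01.
  exact: (sg_carrier hS h0 Yy).
split => //.
- by apply: mulr_ge0; [have := M_ge1; lra|exact: expR_ge0].
- exact: ltW.
- exact: signed_semigroup.
- exact: signed_stable.
- by have [] := Y_admissible b (mem01 (ltac:(rewrite lexx ler01) : 0 <= 0 <= (1 : R))).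
- move=> t /mem01 t01; case: b {hBd inv} => /=; first exact: Y_dom.
  by apply: Y_dom; exact: flip.
- move=> y Yy t t01 e e0.
  have cA := proj1 (continuous_within_whole _ _) (AY_continuous Yy).
  have memJ (r : R) : 0 <= r <= 1 -> [set` `[0, 1]] r by move=> ?; exact: mem01.
  have t01' : 0 <= 1 - t <= 1 by have := flip (mem01 t01); rewrite in_itv.
  case: b {hBd inv}.
    have [d d0 hd] := cA t (memJ _ t01) e e0.
    by exists d => // r r01; exact: hd (memJ _ r01).
  have [d d0 hd] := cA (1 - t) (memJ _ t01') e e0; exists d => // r r01 rt.
  have r01' : 0 <= 1 - r <= 1 by have := flip (mem01 r01); rewrite in_itv.
  have -> : signed false A r y - signed false A t y = - (A (1 - r) y - A (1 - t) y).
    by rewrite /= opprB opprK addrC.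
  rewrite (nrmN hX) //; apply: hd; first exact: memJ.
  by rewrite opprB addrC addrA subrK distrC.
- exact: YN_normed.
- move=> t /mem01 t01; case: b {hBd inv} => /= a x y Yx Yy.
    by have [_ -> ] := AY_bounded t01.
  have [_ lin _] := AY_bounded (flip t01).
  by rewrite lin // opprD scalerN.
- by move=> s t y s01 t01 Yy; apply: N_lipschitz => //; exact: mem01.
- move=> t h y t01 h01 Yy; rewrite -part_is_restriction //.
  by case/andP: h01 => h0 _; apply: part_quasicontraction => //; exact: mem01.
- move=> t y e t01 Yy e0; have [_ _ _ _ hS] := Y_admissible b (mem01 t01).
  have [a [a' [_ a0 ha]]] := N_equiv b (mem01 t01).
  have [d d0 hd] := sg_cont Y_normed hS (lexx 0) Yy (divr_gt0 e0 a0).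
  exists d => // h h0 hhd.
  have [_ h1] := ha _ (nsB Y_normed (inv t h y t01 h0 Yy) Yy).
  apply: (le_lt_trans h1); rewrite mulrC -ltr_pdivlMr //.
  have := hd h h0; rewrite (sg0 hS Yy) subr0 ger0_norm //; exact.
- move=> t y C t01 hC; have [CX hCX] := YN_embedded b t01.
  exact: (uniformly_convex_ball_closed (YN_normed b t01) (N_convex b (mem01 t01)) (YN_banach b t01) hCX hC).
Qed.

End Verification.

(** * Time reversal *)

Section Reversal.
Context {R : realType} {X : normedModType R[i]}.

Lemma iteri_inverse (T : Type) n (f g : nat -> T -> T) x :
  (forall k y, (k < n)%N -> g (n.-1 - k)%N (f k y) = y) ->
  iteri n g (iteri n f x) = x.
Proof.
elim: n f g x => [//|n IH] f g x gf.
have shift m z : iteri m.+1 g z = iteri m (fun k => g k.+1) (g 0%N z).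
  by elim: m => [//|m IHm]; rewrite iteriS IHm.
rewrite shift iteriS.
have -> : g 0%N (f n (iteri n f x)) = iteri n f x.
  by have := gf n (iteri n f x) (ltnSn n); rewrite /= subnn.
apply: IH => k y kn.
have := gf k y (ltnW kn); rewrite /=.
by case: n kn {gf shift} => // n; rewrite ltnS => kn; rewrite /= subSn.
Qed.

Lemma cell_reverse n k (t : R) : (k < n)%N ->
  cell n (n.-1 - k) (1 - t) = n%:R^-1 - cell n k t.
Proof.
case: n => // n kn; rewrite /= /cell.
have dl0 : 0 < (n.+1%:R^-1 : R) by rewrite invr_gt0 ltr0n.
set dl := n.+1%:R^-1 in dl0 *.
have -> : 1 - t - (n - k)%:R * dl = dl - (t - k%:R * dl).
  have : n.+1%:R * dl = 1 by rewrite mulfV // pnatr_eq0.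
  by rewrite natrB // -[n.+1%:R]natr1; lra.
set z := t - _.
have [zn|zp] := leP z 0.
  rewrite (min_idPl _); last by lra.
  rewrite (min_idPr _); last by lra.
  by rewrite (max_idPr _) ?(max_idPl _) ?subr0 //; exact: ltW.
have [zd|zd] := leP dl z.
  rewrite (min_idPr _); last by lra.
  rewrite (max_idPl _); last by lra.
  by rewrite (max_idPr _) ?subrr //; exact: ltW.
rewrite (min_idPr _); last by lra.
by rewrite !(max_idPr _) //; lra.
Qed.

Lemma node_reverse n k : (k < n)%N -> node n (n.-1 - k) = 1 - node n k :> R.
Proof.
case: n => // n kn; rewrite /node /= natrB //.
have n0 : n.+1%:R != 0 :> R by rewrite pnatr_eq0.
apply: (mulIf n0); rewrite mulrBl !mulfVK // mul1r -[n.+1%:R]natr1.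
lra.
Qed.

(** Reversing time reverses the order of the cells and swaps S and S' in each, so
    the factors cancel from the inside. *)
Lemma step_product_inverse (S S' : R -> R -> X -> X) n (s t : R) x :
  (0 < n)%N -> s <= t ->
  (forall (tau h : R) x, 0 <= tau <= 1 -> 0 <= h <= 1 -> S' (1 - tau) h (S tau h x) = x) ->
  step_product S' n n (1 - s) (1 - t) (step_product S n n t s x) = x.
Proof.
move=> n0 st SS'; apply: iteri_inverse => k y kn.
rewrite !cell_reverse // node_reverse //.
have -> : n%:R^-1 - cell n k s - (n%:R^-1 - cell n k t) = cell n k t - cell n k s by lra.
apply: SS'; first exact: node_bounds.
rewrite subr_ge0 cell_mono //=.
have /andP[_ h1] := cell_bounds n0 k t; have /andP[h2 _] := cell_bounds n0 k s.
have h3 : n%:R^-1 <= (1 : R) by rewrite invf_le1 ?ltr0n // ler1n.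
by rewrite lerBlDr (le_trans h1) // (le_trans h3) // lerDl.
Qed.

End Reversal.

(** * Derivatives *)

Section Derivatives.
Context {R : realType} {X : normedModType R[i]}.
Local Notation nX := (nrm (whole X)).
Let hX := @whole_normed R X.

Lemma derivative_withinP (J : set R) (u : R -> X) (t : R) l :
  has_derivative_within J u t l <->
  forall e : R, 0 < e -> exists2 d : R, 0 < d & forall r : R, J r -> r != t ->
    `|r - t| < d -> nX (u r - u t - (r - t)%:C *: l) <= e * `|r - t|.
Proof.
have quot r : r != t -> nX ((r - t)^-1%:C *: (u r - u t) - l) =
    `|r - t|^-1 * nX (u r - u t - (r - t)%:C *: l).
  by move=> rt; rewrite nrm_quotient // subr_eq0.
split.
- move=> /cvg_whole h e /h; rewrite !near_withinE => /nbhs_ballP[d /= d0 hd].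
  exists d => // r Jr rt rd.
  have : nX ((r - t)^-1%:C *: (u r - u t) - l) < e.
    by apply: hd => //; rewrite /ball /= distrC.
  have p0 : 0 < `|r - t| by rewrite normr_gt0 subr_eq0.
  by rewrite quot // mulrC ltr_pdivrMr // => /ltW.
- move=> h; apply/cvg_whole => e e0; have [|d d0 hd] := h (e / 2); first by lra.
  rewrite !near_withinE; apply/nbhs_ballP; exists d => // r rb rt Jr.
  have rd : `|r - t| < d by move: rb; rewrite /ball /= distrC.
  have h1 := hd r Jr rt rd.
  have p0 : 0 < `|r - t| by rewrite normr_gt0 subr_eq0.
  change (nX ((r - t)^-1%:C *: (u r - u t) - l) < e).
  rewrite quot // mulrC ltr_pdivrMr //; apply: (le_lt_trans h1).
  by rewrite ltr_pM2r //; lra.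
Qed.

(** The mean value inequality for u x - x *: g t on both sides of t, where the
    right derivative g x - g t is small. *)
Lemma derivative_of_right_derivative (u g : R -> X) (a b t : R) :
  (forall t, a <= t <= b -> forall e : R, 0 < e -> exists2 d : R, 0 < d &
     forall r, a <= r <= b -> `|r - t| < d -> nX (u r - u t) < e) ->
  (forall t, a <= t < b -> forall e : R, 0 < e -> exists2 d : R, 0 < d &
     forall h, 0 < h -> h < d -> t + h <= b ->
       nX (u (t + h) - u t - h%:C *: g t) <= e * h) ->
  a <= t <= b ->
  (forall e : R, 0 < e -> exists2 d : R, 0 < d &
     forall r, a <= r <= b -> `|r - t| < d -> nX (g r - g t) < e) ->
  has_derivative_within `[a, b] u t (g t).
Proof.
move=> cu du tab cg; apply/derivative_withinP => e e0.
have [d d0 hd] := cg e e0; exists d => // r Jr rt rd.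
have {}Jr : a <= r <= b by move: Jr; rewrite /= in_itv.
have incr p q : a <= p -> p <= q -> q <= b ->
    (forall x, p <= x <= q -> `|x - t| < d) ->
    nX (u q - u p - (q - p)%:C *: g t) <= e * (q - p).
  move=> ap pq qb near.
  have -> : u q - u p - (q - p)%:C *: g t =
      (u q - q%:C *: g t) - (u p - p%:C *: g t).
    by rewrite [RHS]subrBB -scalerBl -rmorphB -(opprB q p) rmorphN scaleNr.
  apply: (@mean_value_ineq _ _ (whole X) (fun x => u x - x%:C *: g t) p q e) => //.
  - exact: ltW.
  - move=> x /andP[px xq] e1 e10.
    have [|d1 d10 hd1] := cu x _ (e1 / 2) (ltac:(lra)); first by apply/andP; split; lra.
    have gt0 := nX_ge0 (g t).
    exists (Num.min d1 (e1 / 2 / (nX (g t) + 1))).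
      by rewrite lt_min d10 /=; apply: divr_gt0; lra.
    move=> y /andP[py yx]; rewrite lt_min ltr_pdivlMr; last by lra.
    move=> /andP[xy1 xy2].
    rewrite subrBB -scalerBl -rmorphB.
    apply: (le_lt_trans (nXD _ _)); rewrite nXZ ger0_norm; last by lra.
    have : nX (u y - u x) < e1 / 2.
      by apply: hd1; [apply/andP; split; lra|rewrite distrC ger0_norm; lra].
    by rewrite mulrDr mulr1 in xy2; lra.
  - move=> x /andP[px xq] h h0.
    have [|d1 d10 hd1] := du x _ h h0; first by apply/andP; split; lra.
    pose k := Num.min (q - x) (d1 / 2).
    have k0 : 0 < k by rewrite /k lt_min; apply/andP; split; lra.
    have [kq kd] : k <= q - x /\ k <= d1 / 2 by rewrite /k !ge_min !lexx orbT.
    exists (x + k); first by apply/andP; split; lra.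
    have h1 := hd1 k k0 (ltac:(lra)) (ltac:(lra)).
    have h2 : nX (g x - g t) < e.
      by apply: hd; [apply/andP; split; lra|apply: near; rewrite px ltW].
    rewrite subrBB -scalerBl -rmorphB.
    have -> : x - (x + k) = - k by lra.
    have -> : x + k - x = k by lra.
    rewrite rmorphN scaleNr.
    have h3 := nXD (u (x + k) - u x - k%:C *: g x) (k%:C *: (g x - g t)).
    rewrite scalerBr addrA subrK -scalerBr nXZ gtr0_norm // in h3.
    have h4 : k * nX (g x - g t) <= k * e by rewrite ler_pM2l // ltW.
    by rewrite mulrDl; lra.
have /andP[ta tb] := tab; have /andP[ra rb] := Jr.
have [tr|rt'] := leP t r.
  rewrite ger0_norm ?subr_ge0 //; apply: incr => // x /andP[tx xr].
  move: rd; rewrite !ger0_norm ?subr_ge0 // => rd; lra.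
have lt' := ltW rt'.
rewrite distrC ger0_norm ?subr_ge0 //.
have -> : u r - u t - (r - t)%:C *: g t = - (u t - u r - (t - r)%:C *: g t).
  by rewrite -(opprB t r) rmorphN scaleNr opprK opprB opprB addrC.
rewrite (nrmN hX) //; apply: incr => // x /andP[tx xr].
by move: rd; rewrite !(distrC _ t) !ger0_norm ?subr_ge0 // => rd; lra.
Qed.

End Derivatives.

(** * Right continuity in the smaller space *)

Section Regularity.
Context {R : realType} {X : completeNormedModType R[i]}.
Local Notation nX := (nrm (whole X)).
Let hX := @whole_normed R X.

Lemma expR_near1 (a b e : R) : 0 <= a -> 0 <= b -> 0 < e ->
  exists2 d : R, 0 < d & forall h : R, 0 <= h -> h < d -> expR (a * h) * b <= b + e.
Proof.
move=> a0 b0 e0.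
have e10 : 0 < e / (b + 1) by apply: divr_gt0 => //; lra.
have /cvgrPdist_lt/(_ _ e10)/nbhs_ballP[d /= d0 hd] := @continuous_expR R 0.
exists (d / (a + 1)) => [|h h0 hh]; first by apply: divr_gt0 => //; lra.
have := hd (a * h); rewrite /ball /= sub0r normrN ger0_norm ?mulr_ge0 //.
rewrite ltr_pdivlMr in hh; last by lra.
have ah : a * h < d by lra.
move=> /(_ ah); rewrite expR0 distrC => /ltW/ler_normlW.
move=> h1.
have : (expR (a * h) - 1) * b <= e / (b + 1) * b by apply: ler_wpM2r.
have := ler_frac b0 (ltW e0).
by rewrite [b * _]mulrC; lra.
Qed.

(** The bound on the norm of U r t y at time r, compared with the norm at time t,
    excludes a loss of norm in the limit, so convergence in X improves to
    convergence in Y. *)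
Lemma limit_right_continuous (Y : set X) (N : R -> X -> R) (B : R -> operator X)
    (S : R -> R -> X -> X) (K Bd c w0 : R) (U : R -> R -> X -> X) :
  kato_family Y N B S K Bd c w0 -> propagator Y K U B ->
  (forall (s t : R) y, 0 <= s -> s <= t -> t <= 1 -> Y y ->
     Y (U t s y) /\ N t (U t s y) <= expR ((c + `|w0|) * (t - s)) * N s y) ->
  (forall (t : R) y (e : R), 0 <= t <= 1 -> Y y -> 0 < e -> exists2 d : R, 0 < d &
     forall v, Y v -> nX (v - y) < d -> N t v <= N t y + d -> N t (v - y) < e) ->
  forall (t : R) y (e : R), 0 <= t <= 1 -> Y y -> 0 < e -> exists2 d : R, 0 < d &
    forall r : R, t <= r <= 1 -> r - t < d -> N t (U r t y - y) < e.
Proof.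
move=> kf hP UY RR t y e t01 Yy e0; have /andP[t0 t1] := t01.
have K0 := kf_K kf; have c0 := kf_c kf.
have N0 := kf_N_ge0 kf t01 Yy.
have [d1 d10 hd1] := RR t y e t01 Yy e0.
pose G := Bd * expR c * N t y.
have G0 : 0 <= G by rewrite mulr_ge0 // mulr_ge0 ?expR_ge0 //; exact: kf_Bd kf.
have KG0 : 0 <= K * G by exact: mulr_ge0.
have [d2 d20 hd2] := @expR_near1 (c + (c + `|w0|)) (N t y) d1
  (ltac:(by rewrite !addr_ge0)) N0 d10.
exists (Num.min d2 (d1 / (K * G + 1))) => [|r /andP[tr r1]].
  by rewrite lt_min d20 /=; apply: divr_gt0 => //; lra.
rewrite lt_min ltr_pdivlMr; last by lra.
move=> /andP[rd2 rd1].
have r0 : 0 <= r by exact: le_trans tr.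
have r01 : 0 <= r <= 1 by rewrite r0.
have [YU NU] := UY t r y t0 tr r1 Yy.
apply: hd1 => //.
- have := propagator_lipschitz hP K0 t0 tr r1 Yy G0.
  move=> /(_ _)/le_lt_trans; apply.
    move=> x /andP[tx xr]; apply: (kf_generator_bound kf) => //.
    by apply/andP; split; lra.
  by rewrite mulrDr mulr1 in rd1; lra.
- apply: (le_trans (kf_lip kf r01 t01 YU)).
  apply: le_trans (hd2 (r - t) _ rd2); last by rewrite subr_ge0.
  rewrite distrC ger0_norm ?subr_ge0 // [(c + _) * _]mulrDl expRD -mulrA.
  by apply: ler_wpM2l => //; exact: expR_ge0.
Qed.

End Regularity.

(** * Existence and uniqueness *)

Section Main.
Context {R : realType} {X : completeNormedModType R[i]}.
Local Notation nX := (nrm (whole X)).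
Let hX := @whole_normed R X.

Lemma continuous_within_pairs (D : set (R * R)) (f : R * R -> X) :
  {within D, continuous f} <->
  forall p, D p -> forall e : R, 0 < e -> exists2 d : R, 0 < d &
    forall q, D q -> `|q.1 - p.1| < d -> `|q.2 - p.2| < d -> nX (f q - f p) < e.
Proof.
split.
- move=> /subspace_continuousP h p /h /cvg_whole h' e /h'.
  rewrite near_withinE => /nbhs_ballP[d /= d0 hd].
  exists d => // q Dq q1 q2; apply: hd => //.
  by split; rewrite /ball /= distrC.
- move=> h; apply/subspace_continuousP => p Dp; apply/cvg_whole => e e0.
  have [d d0 hd] := h p Dp e e0.
  rewrite near_withinE; apply/nbhs_ballP; exists d => //= q [].
  by rewrite /ball /= => q1 q2 Dq; apply: hd => //; rewrite distrC.
Qed.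

Lemma dense_eq (Y : set X) (f g : X -> X) (C D : R) : dense Y ->
  (forall x y, nX (f x - f y) <= C * nX (x - y)) ->
  (forall x y, nX (g x - g y) <= D * nX (x - y)) ->
  (forall y, Y y -> f y = g y) -> forall x, f x = g x.
Proof.
move=> dY fC gD fg x; apply: nX_eq => e e0.
pose q := `|C| + `|D| + 1.
have q0 : 0 < q by rewrite /q; have := normr_ge0 C; have := normr_ge0 D; lra.
have [y Yy xy] := dense_nX dY x (divr_gt0 e0 q0).
rewrite ltr_pdivlMr // nXC in xy.
have h1 := nX_tri (f y) (f x) (g x); rewrite [X in _ <= _ + nX (X - _)](fg y Yy) in h1.
have h2 := fC x y; have h3 := gD y x; rewrite (nXC y x) in h3.
have xy0 := nX_ge0 (x - y).
have h4 : C * nX (x - y) <= `|C| * nX (x - y) by apply: ler_wpM2r => //; exact: ler_norm.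
have h5 : D * nX (x - y) <= `|D| * nX (x - y) by apply: ler_wpM2r => //; exact: ler_norm.
by rewrite /q !mulrDr mulr1 in xy; lra.
Qed.

Lemma bounded_lipschitz (f : X -> X) : bounded_on (whole X) (whole X) f ->
  exists C, forall x y, nX (f x - f y) <= C * nX (x - y).
Proof.
move=> [_ lf [C hC]]; exists C => x y.
by rewrite -(linear_onB lf) //; exact: hC.
Qed.

(** Comparison of U with the solution V r s y, which has no defect. *)
Lemma evolution_unique (A : R -> operator X) (Y : set X) (K : R)
    (U V : R -> R -> X -> X) :
  dense Y -> 0 <= K -> propagator Y K U A -> evolution_system A Y V ->
  forall s t : R, 0 <= s -> s <= t -> t <= 1 -> V t s = U t s.
Proof.
move=> dY K0 hP [Vb Vsol Vcomp Vcont] s t s0 st t1; apply/funext => x.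
have [s1|s1] := ltP s 1.
  have [C hC] := bounded_lipschitz (Vb s t s0 st t1).
  apply: (dense_eq (f := V t s) (g := U t s) dY hC) => [x' y'|y Yy].
    exact: (prop_lip hP x' y' s0 st t1).
  have [Vs VY Vd _] := Vsol s y s0 s1 Yy.
  have inI r : s <= r <= t -> r \in `[s, 1].
    by rewrite in_itv /= => /andP[? ?]; apply/andP; split; lra.
  have inJ r : s <= r <= 1 -> [set` `[s, 1]] r by move=> h; rewrite /= in_itv.
  have Vder r (e : R) : s <= r <= t -> 0 < e -> exists2 d : R, 0 < d &
      forall q : R, s <= q <= 1 -> q != r -> `|q - r| < d ->
        nX (V q s y - V r s y - (q - r)%:C *: A r (V r s y)) <= e * `|q - r|.
    move=> rI e0; have [_ /derivative_withinP/(_ e e0)[d d0 hd]] := Vd r (inI r rI).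
    by exists d => // q /inJ; exact: hd.
  apply: nX_eq => e e0; apply: (@le_trans _ _ 0); last exact: ltW.
  have t01 : 0 <= t <= 1 by rewrite t1 andbT; lra.
  have := @propagator_compare _ _ _ _ _ _ (fun r => V r s y) (fun r => A r (V r s y))
    s t t 0 hP K0 s0 st (lexx t) t1 (lexx 0).
  rewrite (prop_id hP _ t01) Vs mulr0 mul0r; apply.
  - by move=> r /andP[sr rt]; apply: VY; apply: inI; rewrite sr ltW.
  - move=> r rI e1 e10; have /andP[sr rt] := rI.
    have [d d0 hd] := Vder r 1 rI ltr01.
    have g0 := nX_ge0 (A r (V r s y)).
    exists (Num.min d (e1 / (nX (A r (V r s y)) + 2))).
      by rewrite lt_min d0 /=; apply: divr_gt0 => //; lra.
    move=> q /andP[sq qr]; rewrite lt_min ltr_pdivlMr; last by lra.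
    move=> /andP[rq1 rq2].
    have [->|qr'] := eqVneq q r; first by rewrite subrr nX0.
    have qI : s <= q <= 1 by rewrite sq (le_trans qr) // (le_trans rt t1).
    have := hd q qI qr'; rewrite distrC ger0_norm ?subr_ge0 // mul1r => /(_ rq1) h1.
    have := nXD (V q s y - V r s y - (q - r)%:C *: A r (V r s y))
      ((q - r)%:C *: A r (V r s y)).
    rewrite subrK nXZ distrC ger0_norm ?subr_ge0 //.
    have : 0 <= r - q by rewrite subr_ge0.
    by rewrite mulrDr in rq2; move: h1 rq2; lra_goal.
  - move=> r /andP[sr rt] e1 e10.
    have [|d d0 hd] := Vder r e1 _ e10; first by rewrite sr ltW.
    exists d => // h h0 hd' rht.
    have := hd (r + h); rewrite [r + h - r]addrC addKr gtr0_norm //; apply => //.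
      by rewrite (le_trans rht t1) andbT (le_trans sr) // lerDl ltW.
    by rewrite gt_eqF // ltrDl.
  - by move=> r _; rewrite subrr nX0.
(* At s = t = 1 there is no initial value problem; use V r r with r -> 1. *)
have es : s = 1 by lra.
have et : t = 1 by lra.
subst s t; rewrite (prop_id hP x) ?lexx ?ler01 //.
apply: nX_eq => e e0.
pose tri := [set p : R * R | 0 <= p.1 /\ p.1 <= p.2 /\ p.2 <= 1].
have tri1 : tri (1, 1) by rewrite /tri /= lexx ler01.
have [d d0 hd] := proj1 (continuous_within_pairs _ _) (Vcont x) (1, 1) tri1 e e0.
pose r := Num.max 0 (1 - d / 2).
have r0 : 0 <= r by rewrite /r le_max lexx.
have r1 : r < 1 by rewrite /r gt_max ltr01 /=; lra.
have rd : 1 - d / 2 <= r by rewrite /r le_max lexx orbT.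
have Vrr z : V r r z = z.
  have [C hC] := bounded_lipschitz (Vb r r r0 (lexx r) (ltW r1)).
  apply: (dense_eq (f := V r r) (g := id) (D := 1) dY hC) => [x' y'|y Yy].
    by rewrite mul1r.
  by have [] := Vsol r y r0 r1 Yy.
have rr : tri (r, r) by split => //=; rewrite lexx; split => //; exact: ltW.
have near : `|r - 1| < d by rewrite distrC ger0_norm; lra.
have h : nX (V r r x - V 1 1 x) < e by exact: (hd (r, r) rr near near).
by rewrite Vrr nXC in h; exact: ltW.
Qed.

(** The forward and the backward limits are inverse to each other, and each
    supplies the continuity in Y from one side. *)
Lemma reversible_evolution (Y : set X) (A : R -> operator X)
    (N : bool -> R -> X -> R) (S : bool -> R -> R -> X -> X) (K : R)
    (Bd c : bool -> R) (w0 : R) :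
  (forall b, kato_family Y (N b) (signed b A) (S b) K (Bd b) (c b) w0) ->
  (forall b (t : R) y (e : R), 0 <= t <= 1 -> Y y -> 0 < e -> exists2 d : R, 0 < d &
     forall v, Y v -> nX (v - y) < d -> N b t v <= N b t y + d -> N b t (v - y) < e) ->
  exists2 U, propagator Y K U A & evolution_system A Y U.
Proof.
move=> kf RR.
have [U [hP hU Ub UY]] := evolution_limit (kf true).
have [U' [hP' hU' _ UY']] := evolution_limit (kf false).
have K0 : 0 <= K by exact: kf_K (kf true).
have Rc := limit_right_continuous (kf true) hP UY (RR true).
have Rc' := limit_right_continuous (kf false) hP' UY' (RR false).
have dY := kf_dense (kf true).
have flip (t : R) : 0 <= t <= 1 -> 0 <= 1 - t <= 1.
  by move=> /andP[? ?]; apply/andP; split; lra.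
have SK b (t h : R) x : 0 <= t <= 1 -> 0 <= h <= 1 -> nX (S b t h x) <= K * nX x.
  move=> t01 /andP[h0 h1]; apply: (kf_stable (kf b) (l := [:: (t, h)])) => //=.
    by rewrite t01 h0.
  by rewrite big_seq1.
have SS (tau h : R) x : 0 <= tau <= 1 -> 0 <= h <= 1 ->
    S false (1 - tau) h (S true tau h x) = x.
  move=> t01 h01; have t01' := flip _ t01.
  apply: (opposite_semigroups dY K0 _ (kf_gen (kf true) t01) (kf_gen (kf false) t01')) => //.
  - by move=> s z s0 Yz; exact: (kf_inv (kf true)).
  - move=> z Yz; split; [exact: (kf_dom (kf true) t01)|exact: (kf_dom (kf false) t01')|].
    have -> : signed false A (1 - tau) z = - A (1 - (1 - tau)) z by [].
    by rewrite opprB addrC subrK.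
  - by move=> s z s01; exact: SK.
  - by move=> s z s01; exact: SK.
have inverse (s t : R) x : 0 <= s -> s <= t -> t <= 1 -> U' (1 - s) (1 - t) (U t s x) = x.
  move=> s0 st t1.
  have t0' : 0 <= 1 - t by lra.
  have ts' : 1 - t <= 1 - s by lra.
  have s1' : 1 - s <= 1 by lra.
  apply: (tends_unique (hU' _ _ (U t s x) t0' ts' s1')) => e e0.
  have e20 : 0 < e / (K + 1) by apply: divr_gt0 => //; lra.
  have [n0 hn0] := hU s t x s0 st t1 _ e20; exists n0 => n nn.
  have n1 : (0 < n)%N by exact: leq_ltn_trans nn.
  rewrite -{2}(step_product_inverse x n1 st SS) -(step_productB (kf false) n1) //.
  apply: (le_lt_trans (step_product_bound (kf false) n1 _ ts')).
  have := hn0 n nn; rewrite nXC ltr_pdivlMr; last by lra.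
  have := nX_ge0 (U t s x - step_product (S true) n n t s x); lra.
have lipY (s t : R) y (u : R) : 0 <= s -> s <= t -> t <= 1 -> 0 <= u <= 1 -> Y y ->
    nX (U t s y - y) <= K * (Bd true * expR (c true) * N true u y) * (t - s).
  move=> s0 st t1 u01 Yy; apply: (propagator_lipschitz hP) => //.
    rewrite mulr_ge0 ?(kf_N_ge0 (kf true)) // mulr_ge0 ?expR_ge0 //.
    exact: kf_Bd (kf true).
  move=> r /andP[sr rt]; apply: (kf_generator_bound (kf true)) => //.
  by apply/andP; split; lra.
exists U => //; split.
- exact: Ub.
- move=> s y s0 s1 Yy.
  pose u r := U r s y.
  have Yu r : s <= r <= 1 -> Y (u r) by move=> /andP[sr r1]; case: (UY s r y).
  have in01 r : s <= r <= 1 -> 0 <= r <= 1.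
    by move=> /andP[? ?]; apply/andP; split; lra.
  have uU r q : s <= r -> r <= q -> q <= 1 -> u q = U q r (u r).
    by move=> sr rq q1; rewrite /u (prop_comp hP).
  (* To the right of t the forward bound controls u r in Y; to the left, u r is
     the value at r of the backward limit started from u t. *)
  have contAu t : s <= t <= 1 -> forall e : R, 0 < e -> exists2 d : R, 0 < d &
      forall r, s <= r <= 1 -> `|r - t| < d -> nX (A r (u r) - A t (u t)) < e.
    move=> tI e e0; have /andP[st t1] := tI; have t01 := in01 t tI.
    have t01' := flip t t01.
    pose G := Bd true * expR (c true) + Bd false * expR (c false).
    have Gp : 0 <= Bd true * expR (c true).
      by rewrite mulr_ge0 ?expR_ge0 //; exact: kf_Bd (kf true).
    have Gm : 0 <= Bd false * expR (c false).
      by rewrite mulr_ge0 ?expR_ge0 //; exact: kf_Bd (kf false).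
    have e20 : 0 < e / 2 / (G + 1) by apply: divr_gt0; [exact: divr_gt0|by rewrite /G ltr_wpDl // addr_ge0].
    have [d1 d10 hd1] := Rc t (u t) _ t01 (Yu t tI) e20.
    have [d2 d20 hd2] := Rc' (1 - t) (u t) _ t01' (Yu t tI) e20.
    have e21 : 0 < e / 2 by exact: divr_gt0.
    have [d3 d30 hd3] := kf_cont (kf true) (Yu t tI) t01 e21.
    exists (Num.min d1 (Num.min d2 d3)); first by rewrite !lt_min d10 d20.
    move=> r rI; rewrite !lt_min => /and3P[r1 r2 r3]; have /andP[sr r1'] := rI.
    have r01 := in01 r rI.
    have h3 : nX (A r (u t) - A t (u t)) < e / 2 by exact: hd3.
    have Yd : Y (u r - u t) by apply: (kf_YB (kf true) t01); exact: Yu.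
    have small n g : 0 <= g -> g <= G -> n < e / 2 / (G + 1) -> g * n <= e / 2.
      move=> g0 gG ng; apply: (@le_trans _ _ (G * (e / 2 / (G + 1)))).
        apply: (@le_trans _ _ (g * (e / 2 / (G + 1)))).
          by apply: ler_wpM2l => //; exact: ltW.
        by apply: ler_wpM2r => //; exact: ltW.
      by apply: ler_frac; [rewrite /G addr_ge0|rewrite divr_ge0 // ltW].
    suff h4 : nX (A r (u r - u t)) <= e / 2.
      have := nX_tri (A r (u t)) (A r (u r)) (A t (u t)).
      have := kf_generatorB (kf true) r01 (Yu r rI) (Yu t tI).
      by move=> /= <-; move: h3 h4; lra_goal.
    have [tr|rt] := leP t r.
      apply: (le_trans (kf_generator_bound (kf true) t01 r01 Yd)).
      apply: small => //; first by rewrite /G lerDl.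
      rewrite (uU t r) //; apply: hd1; first by rewrite tr.
      by move: r1; rewrite ger0_norm ?subr_ge0.
    have r01' := flip r r01.
    have -> : nX (A r (u r - u t)) = nX (signed false A (1 - r) (u r - u t)).
      have -> : signed false A (1 - r) (u r - u t) = - A (1 - (1 - r)) (u r - u t) by [].
      by rewrite (nrmN hX) // (_ : 1 - (1 - r) = r) // opprB addrC subrK.
    apply: (le_trans (kf_generator_bound (kf false) t01' r01' Yd)).
    apply: small => //; first by rewrite /G lerDr.
    have -> : u r = U' (1 - r) (1 - t) (u t).
      by rewrite (uU r t sr (ltW rt) t1) inverse //; [exact: le_trans s0 sr|exact: ltW].
    have rt0 := ltW rt.
    apply: hd2; first by rewrite lerD2l lerN2 rt0 lerBlDr lerDl; case/andP: r01.
    rewrite opprB addrC addrA subrK.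
    by move: r2; rewrite distrC ger0_norm ?subr_ge0.
  have contu t : s <= t <= 1 -> forall e : R, 0 < e -> exists2 d : R, 0 < d &
      forall r, s <= r <= 1 -> `|r - t| < d -> nX (u r - u t) < e.
    move=> tI e e0; have t01 := in01 t tI; have /andP[st t1] := tI.
    have s01 : 0 <= s <= 1 by rewrite s0 ltW.
    pose G := K * (Bd true * expR (c true) *
      (expR (c true) * (expR (c true + `|w0|) * N true s y))).
    have Ns0 := kf_N_ge0 (kf true) s01 Yy.
    have Bd0 := kf_Bd (kf true); have c0 := kf_c (kf true).
    have G0 : 0 <= G by rewrite /G !mulr_ge0 ?expR_ge0.
    have incr p q : s <= p -> p <= q -> q <= 1 -> nX (u q - u p) <= G * (q - p).
      move=> sp pq q1; rewrite (uU p q) //.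
      have pI : s <= p <= 1 by rewrite sp (le_trans pq q1).
      apply: (le_trans (lipY p q (u p) p _ pq q1 (in01 p pI) (Yu p pI))); first exact: le_trans s0 sp.
      apply: ler_wpM2r; first by rewrite subr_ge0.
      apply: ler_wpM2l => //; apply: ler_wpM2l; first by rewrite mulr_ge0 ?expR_ge0.
      have [|_ h] := UY s p y s0 sp _ Yy; first exact: le_trans pq q1.
      apply: (le_trans h).
      have h1 : expR ((c true + `|w0|) * (p - s)) <= expR (c true + `|w0|).
        rewrite ler_expR ler_piMr //; first by rewrite addr_ge0.
        by move: s0 pq q1; lra_goal.
      apply: (@le_trans _ _ (expR (c true + `|w0|) * N true s y)).
        by apply: ler_wpM2r.
      rewrite ler_peMl ?mulr_ge0 ?expR_ge0 //.
      by rewrite -expR0 ler_expR.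
    have G10 : 0 < G + 1 by rewrite ltr_wpDl.
    have e30 : 0 < e / (G + 1) by exact: divr_gt0.
    exists (e / (G + 1)) => // r /andP[sr r1].
    rewrite ltr_pdivlMr // => rt1.
    have h1 : `|r - t| * G <= `|r - t| * (G + 1) by apply: ler_wpM2l => //; rewrite lerDl.
    apply: le_lt_trans rt1; apply: le_trans h1; rewrite mulrC.
    have [tr|/ltW rt] := leP t r; first by rewrite ger0_norm ?subr_ge0 //; exact: incr.
    by rewrite nXC distrC ger0_norm ?subr_ge0 //; exact: incr.
  have inI t : t \in `[s, 1] -> s <= t <= 1 by rewrite in_itv.
  split.
  + by apply: (prop_id hP); rewrite s0 ltW.
  + by move=> t /inI/Yu.
  + move=> t /inI tI; split.
      exact: (kf_dom (kf true) (in01 t tI) (Yu t tI)).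
    apply: (derivative_of_right_derivative (g := fun r => A r (u r))) => //.
    * move=> r /andP[sr r1] e e0.
      have r01 : 0 <= r < 1 by rewrite r1 (le_trans s0 sr).
      have rI : s <= r <= 1 by rewrite sr ltW.
      have [d d0 hd] := prop_right hP r01 (Yu r rI) e0.
      exists d => // h h0 hhd rh1.
      change (nX (u (r + h) - u r - h%:C *: A r (u r)) <= e * h).
      rewrite (uU r (r + h)) //; last by rewrite lerDl ltW.
      exact: hd.
    * exact: contAu.
  + apply/continuous_within_whole => t /inI tI e e0.
    by have [d d0 hd] := contAu t tI e e0; exists d => // r /inI; exact: hd.
- by move=> r s t x r0 rs st t1; exact: (prop_comp hP).
- move=> x; apply/continuous_within_pairs => -[s t] /= [s0 [st t1]] e e0.
  have e40 : 0 < e / 4 / (K + 1) by rewrite !divr_gt0 // ltr_wpDl.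
  have [y Yy xy] := dense_nX dY x e40.
  have z01 : (0 : R) <= (0 : R) <= (1 : R) by rewrite lexx ler01.
  have N0 := kf_N_ge0 (kf true) z01 Yy.
  have Bd0 := kf_Bd (kf true); have c0 := kf_c (kf true).
  pose E0 := expR (c true); pose E1 := expR (c true + `|w0|).
  pose G := Bd true * E0 * (E1 * (E0 * N true 0 y)).
  have G0 : 0 <= G by rewrite /G !mulr_ge0 ?expR_ge0.
  have E01 : 1 <= E0 by rewrite /E0 -expR0 ler_expR.
  have E11 : 1 <= E1 by rewrite /E1 -expR0 ler_expR addr_ge0.
  have incr_t a p q : 0 <= a -> a <= p -> p <= q -> q <= 1 ->
      nX (U q a y - U p a y) <= K * G * (q - p).
    move=> a0 ap pq q1; have p1 : p <= 1 by exact: le_trans pq q1.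
    have a01 : 0 <= a <= 1 by rewrite a0 (le_trans ap p1).
    have p0 : 0 <= p by exact: le_trans a0 ap.
    have p01 : 0 <= p <= 1 by rewrite p0.
    rewrite -(prop_comp hP y a0 ap pq q1).
    have [YU NU] := UY a p y a0 ap p1 Yy.
    apply: (le_trans (lipY p q _ p p0 pq q1 p01 YU)).
    apply: ler_wpM2r; first by rewrite subr_ge0.
    apply: ler_wpM2l => //; apply: ler_wpM2l; first by rewrite mulr_ge0 ?expR_ge0.
    apply: (le_trans NU); apply: ler_pM; rewrite ?expR_ge0 ?(kf_N_ge0 (kf true)) //.
      rewrite ler_expR ler_piMr //; first by rewrite addr_ge0.
      by move: a0 ap p1; lra_goal.
    exact: (kf_lip1 (kf true)).
  have incr_s a b q : 0 <= a -> a <= b -> b <= q -> q <= 1 ->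
      nX (U q b y - U q a y) <= K * (K * G * (b - a)).
    move=> a0 ab bq q1; have b1 : b <= 1 by exact: le_trans bq q1.
    rewrite -(prop_comp hP y a0 ab bq q1).
    have b0 : 0 <= b by exact: le_trans a0 ab.
    apply: (le_trans (prop_lip hP _ _ b0 bq q1)); apply: ler_wpM2l => //.
    have a1 : 0 <= a <= 1 by rewrite a0 (le_trans ab b1).
    rewrite nXC -[X in nX (_ - X)](prop_id hP y a1).
    exact: incr_t.
  pose L := K * G + K * (K * G).
  have KG0 : 0 <= K * G by exact: mulr_ge0.
  have L0 : 0 <= L by rewrite /L addr_ge0 // mulr_ge0.
  have step (a b p q d : R) : 0 <= a -> a <= b -> b <= p -> p <= q -> q <= 1 ->
      b - a <= d -> q - p <= d -> nX (U p b y - U q a y) <= L * d.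
    move=> a0 ab bp pq q1 bad qpd.
    have h1 := incr_t b p q (le_trans a0 ab) bp pq q1.
    have h2 := incr_s a b q a0 ab (le_trans bp pq) q1.
    have h3 := nX_tri (U q b y) (U p b y) (U q a y).
    rewrite (nXC (U p b y) (U q b y)) in h3.
    have k1 : K * G * (q - p) <= K * G * d by apply: ler_wpM2l => //; exact: mulr_ge0.
    have k2 : K * (K * G * (b - a)) <= K * (K * G * d).
      by apply: ler_wpM2l => //; apply: ler_wpM2l => //; exact: mulr_ge0.
    by rewrite /L; move: h1 h2 h3 k1 k2; lra_goal.
  exists (e / 8 / (L + 1)); first by rewrite !divr_gt0 // ltr_wpDl.
  move=> [s' t'] /= [s0' [st' t1']]; set d := e / 8 / (L + 1) => sd td.
  have Ld : L * d <= e / 8 by apply: ler_frac => //; rewrite divr_ge0 // ltW.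
  have lipK p q : 0 <= p -> p <= q -> q <= 1 -> nX (U q p x - U q p y) <= e / 4.
    move=> p0 pq q1; apply: (le_trans (prop_lip hP x y p0 pq q1)).
    apply: (@le_trans _ _ (K * (e / 4 / (K + 1)))).
      by apply: ler_wpM2l => //; rewrite nXC; exact: ltW.
    by apply: ler_frac => //; rewrite divr_ge0 // ltW.
  (* The intervals [s, t] and [s', t'] are compared through one containing both. *)
  pose a := Num.min s s'; pose q := Num.max t t'.
  have a0 : 0 <= a by rewrite /a le_min s0.
  have q1 : q <= 1 by rewrite /q ge_max t1.
  have [as_ as'] : a <= s /\ a <= s' by rewrite /a !ge_min !lexx orbT.
  have [tq tq'] : t <= q /\ t' <= q by rewrite /q !le_max !lexx orbT.
  have dsa : s - a <= d /\ s' - a <= d.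
    move: (le_lt_trans (normr_ge0 _) sd); move: sd; rewrite ltr_norml => /andP[].
    by rewrite /a minEle; case: ifP => _ h1 h2 h3; split; move: h1 h2 h3; lra_goal.
  have dtq : q - t <= d /\ q - t' <= d.
    move: (le_lt_trans (normr_ge0 _) td); move: td; rewrite ltr_norml => /andP[].
    by rewrite /q maxEle; case: ifP => _ h1 h2 h3; split; move: h1 h2 h3; lra_goal.
  have h1 := step a s t q d a0 as_ st tq q1 (proj1 dsa) (proj1 dtq).
  have h2 := step a s' t' q d a0 as' st' tq' q1 (proj2 dsa) (proj2 dtq).
  have h3 := lipK s t s0 st t1; have h4 := lipK s' t' s0' st' t1'.
  have h5 := nX_tri (U t' s' y) (U t' s' x) (U t s x).
  have h6 := nX_tri (U q a y) (U t' s' y) (U t s x).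
  have h7 := nX_tri (U t s y) (U q a y) (U t s x).
  rewrite (nXC (U q a y) (U t s y)) (nXC (U t s y) (U t s x)) in h7.
  by move: h1 h2 h3 h4 h5 h6 h7 Ld e0; lra_goal.
Qed.

End Main.

Theorem theorem2p5 (R : realType) (X : completeNormedModType R[i])
    (A : R -> operator X) (M w : R) (Y : normed_subspace X)
    (N : bool -> R -> X -> R) (c : bool -> R) (w0 : R)
    (A_group : forall t, t \in `[0, 1] -> is_group_generator (whole X) (A t))
    (M_ge1 : 1 <= M)
    (A_stable : forall b, stable M w (signed b A))
    (Y_admissible : forall b t, t \in `[0, 1] -> admissible (signed b A t) Y)
    (Y_dom : forall t, t \in `[0, 1] -> Y `<=` dom (A t))
    (AY_bounded : forall t, t \in `[0, 1] -> bounded_on Y (whole X) (A t))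
    (AY_continuous : forall y, carrier Y y ->
      {within `[0, 1], continuous (fun t => A t y)})
    (N_norm : forall b t, t \in `[0, 1] -> is_norm Y (N b t))
    (N_equiv : forall b t, t \in `[0, 1] ->
      equivalent_norms Y (nrm Y) (N b t))
    (N_convex : forall b t, t \in `[0, 1] ->
      uniformly_convex (NormedSubspace Y (N b t)))
    (c_gt0 : forall b, 0 < c b)
    (N_lipschitz : forall b s t y, s \in `[0, 1] -> t \in `[0, 1] -> carrier Y y ->
      N b t y <= expR (c b * `|t - s|) * N b s y)
    (part_generator : forall b t, t \in `[0, 1] ->
      is_semigroup_generator (NormedSubspace Y (N b t)) (part (signed b A t) Y))
    (part_quasicontraction : forall b t tau y, t \in `[0, 1] -> 0 <= tau ->
      carrier Y y ->
      N b t (semigroup (NormedSubspace Y (N b t)) (part (signed b A t) Y) tau y)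
        <= expR (w0 * tau) * N b t y) :
  exists U : R -> R -> X -> X,
    evolution_system A Y U /\
    forall V : R -> R -> X -> X, evolution_system A Y V ->
      forall s t, 0 <= s -> s <= t -> t <= 1 -> V t s = U t s.
Proof.
have /choice[Bd kf] : forall b, exists Bd, kato_family (carrier Y) (N b) (signed b A)
    (fun t => semigroup (whole X) (signed b A t)) (M * expR `|w|) Bd (c b) w0.
  exact: signed_kato.
have [||U hP hU] := @reversible_evolution R X (carrier Y) A N
  (fun b t => semigroup (whole X) (signed b A t)) (M * expR `|w|) Bd c w0.
- exact: kf.
- move=> b t y e t01 Yy e0.
  have t01' : t \in `[0, 1] by rewrite in_itv.
  have [CX hCX] := YN_embedded Y_admissible N_equiv b t01.
  have hB := YN_banach Y_admissible N_norm N_equiv b t01.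
  exact: (radon_riesz (proj1 hB) (N_convex b t t01') hB hCX Yy e0).
exists U; split => // V hV.
exact: (evolution_unique (kf_dense (kf true)) (kf_K (kf true)) hP hV).
Qed.
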